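(* Let $(X,d)$ be a compact extended Ptolemy metric space containing at least three points. If any three points of $X$ lie on a circle in $X$ or on a Ptolemy segment in $X$, then $(X,d)$ is Möbius equivalent either to $(S^n,d_0)$ or to the hemisphere $(S^n_+,d_0)$ for some $n\in\mathbb{N}$.
   Context: An extended metric on a set $X$ (with at least two points) is a map $d:X\times X\to[0,\infty]$ such that there is a subset $\Omega(d)\subset X$ with at most one element, $d$ restricted to $X\setminus\Omega(d)$ is a metric with finite values, $d(x,\omega)=\infty$ for $x\in X\setminus\Omega(d)$, $\omega\in\Omega(d)$, and $d(\omega,\omega)=0$; the point $\omega$ is called the remote point, written $\infty$. The topology has as basis the open balls around points of $X\setminus\Omega(d)$ together with complements of closed balls; compactness refers to this topology. In product-of-distances expressions in which a single point equals $\infty$, factors involving $\infty$ are cancelled. A quadruple is admissible if no entry occurs three or four times; $\mathrm{crt}(x,y,z,w)=(d(x,y)d(z,w):d(x,z)d(y,w):d(x,w)d(y,z))\in\mathbb{R}P^2$ with $\mathrm{crt}(x,y,z,\infty)=(d(x,y):d(x,z):d(y,z))$, $\mathrm{crt}(x,y,\infty,\infty)=(0:1:1)$ (analogously for other positions). A Möbius map is an injective map preserving $\mathrm{crt}$ of all admissible quadruples; Möbius equivalent means there is a bijective Möbius map. $(X,d)$ is Ptolemy if $d(x,y)d(z,w)\le d(x,z)d(y,w)+d(x,w)d(y,z)$ for all quadruples. A circle in $X$ is a subset homeomorphic to $S^1$ such that for any four distinct points $x,y,z,w$ on it with $y,w$ in different components of the circle minus $\{x,z\}$, $d(x,z)d(y,w)=d(x,y)d(z,w)+d(x,w)d(y,z)$.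 A Ptolemy segment in $X$ is a subset homeomorphic to a compact interval such that $d(x_1,x_3)d(x_2,x_4)=d(x_1,x_2)d(x_3,x_4)+d(x_1,x_4)d(x_3,x_2)$ whenever $x_1,x_2,x_3,x_4$ lie in this order on it. $d_0$ denotes the chordal metric (restriction of the Euclidean metric of $\mathbb{R}^{n+1}$) on $S^n$ and on the closed hemisphere $S^n_+=\{x\in S^n: x_{n+1}\ge 0\}$. *)

(* Defs.v *)
From HB Require Import structures.
From mathcomp Require Import all_boot all_order all_algebra.
From mathcomp Require Import mathcomp_extra boolp classical_sets functions cardinality reals constructive_ereal ereal.
Set Implicit Arguments.
Unset Strict Implicit.
Unset Printing Implicit Defensive.
Import Order.TTheory GRing.Theory Num.Theory.
Local Open Scope classical_set_scope.
Local Open Scope ring_scope.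

Section ExtendedMetric.
Variables (R : realType) (X : Type) (d : X -> X -> \bar R) (Om : set X).

(* (X,d) is an extended metric space whose remote set Omega(d) is Om. *)
Definition ext_metric : Prop :=
  (forall a b, Om a -> Om b -> a = b) /\
  (forall x y, (0 <= d x y)%E) /\
  (forall x y, ~ Om x -> ~ Om y -> d x y \is a fin_num) /\
  (forall x y, ~ Om x -> ~ Om y -> d x y = d y x) /\
  (forall x y, ~ Om x -> ~ Om y -> (d x y = 0%E <-> x = y)) /\
  (forall x y z, ~ Om x -> ~ Om y -> ~ Om z -> (d x z <= d x y + d y z)%E) /\
  (forall x w, ~ Om x -> Om w -> d x w = +oo%E /\ d w x = +oo%E) /\
  (forall w, Om w -> d w w = 0%E).

Definition oball (a : X) (r : R) : set X := [set y | (d a y < r%:E)%E].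
Definition cball_compl (a : X) (r : R) : set X := [set y | ~ (d a y <= r%:E)%E].

Definition eopen (U : set X) : Prop :=
  forall x, U x -> exists a : X, exists r : R, ~ Om a /\
    ((oball a r x /\ oball a r `<=` U) \/
     (cball_compl a r x /\ cball_compl a r `<=` U)).

Definition ecompact : Prop :=
  forall C : set (set X), (forall U, C U -> eopen U) ->
    (forall x, exists2 U, C U & U x) ->
    exists2 F : set (set X), (F `<=` C /\ finite_set F) & (forall x, exists2 U, F U & U x).

Definition econnected (A : set X) : Prop :=
  ~ (exists U V : set X, eopen U /\ eopen V /\ A `<=` U `|` V /\
       (A `&` U) !=set0 /\ (A `&` V) !=set0 /\ A `&` U `&` V = set0).

Definition same_component (Y : set X) (y w : X) : Prop :=
  exists A : set X, A `<=` Y /\ econnected A /\ A y /\ A w.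

(* distance factor with the cancellation convention: factors involving the
   remote point are replaced by 1, and d(oo,oo) = 0 *)
Definition dd (a b : X) : R :=
  if a \in Om then (if b \in Om then 0 else 1)
  else if b \in Om then 1 else fine (d a b).

Definition ptolemy : Prop :=
  forall x y z w, dd x y * dd z w <= dd x z * dd y w + dd x w * dd y z.

Definition relopen (P : Type) (dist : P -> P -> R) (D V : set P) : Prop :=
  V `<=` D /\ forall p, V p -> exists2 e : R, 0 < e &
    forall q, D q -> dist p q < e -> V q.

Definition homeo_onto (P : Type) (dist : P -> P -> R) (D : set P) (f : P -> X)
    (C : set X) : Prop :=
  (forall p q, D p -> D q -> f p = f q -> p = q) /\
  f @` D = C /\
  (forall U, eopen U -> relopen dist D (D `&` f @^-1` U)) /\
  (forall V, relopen dist D V -> exists2 U, eopen U & f @` V = U `&` C).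

Definition S1 : set (R * R) := [set p | p.1 ^+ 2 + p.2 ^+ 2 = 1].
Definition dist2 (p q : R * R) : R := Num.sqrt ((p.1 - q.1) ^+ 2 + (p.2 - q.2) ^+ 2).
Definition I01 : set R := [set t | 0 <= t <= 1].
Definition dist1 (s t : R) : R := `|s - t|.

Definition is_circle (C : set X) : Prop :=
  (exists f : R * R -> X, homeo_onto dist2 S1 f C) /\
  forall x y z w, C x -> C y -> C z -> C w ->
    x <> y -> x <> z -> x <> w -> y <> z -> y <> w -> z <> w ->
    ~ same_component (C `&` [set u | u <> x /\ u <> z]) y w ->
    dd x z * dd y w = dd x y * dd z w + dd x w * dd y z.

Definition is_ptolemy_segment (S : set X) : Prop :=
  exists2 g : R -> X, homeo_onto dist1 I01 g S &
    forall t1 t2 t3 t4, 0 <= t1 -> t1 < t2 -> t2 < t3 -> t3 < t4 -> t4 <= 1 ->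
      dd (g t1) (g t3) * dd (g t2) (g t4) =
      dd (g t1) (g t2) * dd (g t3) (g t4) + dd (g t1) (g t4) * dd (g t3) (g t2).

End ExtendedMetric.

Definition admissible (X : Type) (x y z w : X) : Prop :=
  ~ (x = y /\ y = z) /\ ~ (x = y /\ y = w) /\ ~ (x = z /\ z = w) /\ ~ (y = z /\ z = w).

Definition proj_eq (R : realType) (a b c a' b' c' : R) : Prop :=
  exists l : R, l != 0 /\ a = l * a' /\ b = l * b' /\ c = l * c'.

Definition mobius_equiv (R : realType) (X Y : Type)
    (dX : X -> X -> \bar R) (OmX : set X) (dY : Y -> Y -> \bar R) (OmY : set Y)
    (A : set Y) : Prop :=
  exists f : X -> Y, injective f /\ f @` setT = A /\
    forall x y z w, admissible x y z w ->
      proj_eq (dd dX OmX x y * dd dX OmX z w) (dd dX OmX x z * dd dX OmX y w)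
              (dd dX OmX x w * dd dX OmX y z)
              (dd dY OmY (f x) (f y) * dd dY OmY (f z) (f w))
              (dd dY OmY (f x) (f z) * dd dY OmY (f y) (f w))
              (dd dY OmY (f x) (f w) * dd dY OmY (f y) (f z)).

Definition eucl (R : realType) (m : nat) (u v : 'rV[R]_m) : R :=
  Num.sqrt (\sum_(i < m) (u ord0 i - v ord0 i) ^+ 2).
Definition d0 (R : realType) (m : nat) (u v : 'rV[R]_m) : \bar R := (eucl u v)%:E.

Definition sphere (R : realType) (n : nat) : set 'rV[R]_n.+1 :=
  [set u | \sum_(i < n.+1) u ord0 i ^+ 2 = 1].
Definition hemisphere (R : realType) (n : nat) : set 'rV[R]_n.+1 :=
  [set u | @sphere R n u /\ 0 <= u ord0 ord_max].

(* Main.v *)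
(* Multiplying [d] by weights gives a bounded metric [dl] with the same cross-ratios. Sending a point [w]
   to infinity turns it into a metric [rho w] which satisfies the Ptolemy inequality again; circles and
   segments through [w] become geodesic rays, so from each [u] there is a ray through any given [v] or
   away from [v].

   For [w] generic (Baire), every pair of points is nearly contained in a long geodesic, so limits of
   normalized distance functions are affine along geodesics and separate points. Evaluating affine
   functions embeds the space isometrically into a finite-dimensional normed space, with an image that is
   closed and has interior. There the Ptolemy inequality for the vertices of parallelograms reads
   4 N u N v <= N (u + v) ^ 2 + N (u - v) ^ 2, which forces the norm to be Euclidean (compare the unit
   ball with the ellipse of least area).

   The complement of the image is convex, and remains so after inversion at any point of the image. If it
   is not empty, inverting at a boundary point shows that the image is a half-space. Stereographic
   projection then gives the sphere or the hemisphere. *)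

(* In a Ptolemy metric the distance to a point is convex along geodesics; the obstacle is to obtain
   affine functions from this. Take points [b'], [w], [a'] at spacing [ep] on a geodesic of [rho b]
   and send [w] to infinity. By the inversion formula, the excess of a point [p] over the distance
   from [a'] to [b'] in [rho w] is the second difference, at [w], of the [rho b]-distance to [p],
   divided by [ep] and by a factor that is bounded below on a finite set. A Lipschitz function has a
   small second difference somewhere, and by convexity one place serves finitely many [p]; so good
   [w] are dense, and Baire handles countably many nets at once. In the limit the normalized
   distances to [a'] and [b'] are convex with sum zero, hence affine. One ultrafilter on [nat] is
   fixed for the whole proof. Bounded real sequences and sequences in [X] all converge along it, so
   limit functions are defined without passing to subsequences. *)
Require Import Defs.
From HB Require Import structures.
From mathcomp Require Import all_boot all_order all_algebra.
From mathcomp Require Import mathcomp_extra boolp classical_sets functions cardinality reals constructive_ereal ereal.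
From mathcomp Require Import topology normedtype sequences.
From mathcomp Require Import ring lra.
Set Implicit Arguments.
Unset Strict Implicit.
Unset Printing Implicit Defensive.
Import Order.TTheory GRing.Theory Num.Theory numFieldNormedType.Exports.
Local Open Scope classical_set_scope.
Local Open Scope ring_scope.

(** * Ultrafilter limits *)

Section Ultrafilter.
Variables (R : realType) (U : set_system nat).
Hypothesis UU : UltraFilter U.

(** The limit is the supremum of the [r] with [r <= x n] on a set of [U]; for every larger [r] the
    ultrafilter contains the complementary set. *)
Lemma ultra_bounded_cvg (x : nat -> R) (B : R) :
  (forall n, `|x n| <= B) -> exists l : R, x n @[n --> U] --> l.
Proof.
move=> xB; have PF : ProperFilter U := ultra_proper.
pose E := [set r | U [set n | r <= x n]].
have supE : has_sup E.
  split; first by exists (- B); apply: filterS filterT => n _ /=; have := xB n; rewrite ler_norml => /andP[].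
  exists B => r /= Ur; have [n /= rn] := filter_ex Ur.
  by apply: le_trans rn _; have := xB n; rewrite ler_norml => /andP[].
exists (sup E); apply/cvgrPdist_lt => e e0.
have h1 : U [set n | sup E - e < x n].
  have [r /= Ur hr] := sup_adherent e0 supE.
  by apply: filterS Ur => n /= rn; apply: lt_le_trans hr rn.
have h2 : U [set n | x n < sup E + e].
  have [//|h] := in_ultra_setVsetC [set n | x n < sup E + e] UU.
  have : E (sup E + e).
    by rewrite /E /=; apply: filterS h => n /= /negP; rewrite -leNgt.
  move=> /(ub_le_sup supE.2); lra.
near do (rewrite ltr_norml).
by apply: filterS (filterI h1 h2) => n /= [a b]; lra.
Unshelve. all: by end_near. Qed.

Lemma ultra_cvg_le (x y : nat -> R) (a b : R) :
  x n @[n --> U] --> a -> y n @[n --> U] --> b -> U [set n | x n <= y n] -> a <= b.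
Proof.
move=> xa yb xy; have PF : ProperFilter U := ultra_proper.
rewrite leNgt; apply/negP => ba.
have h1 : U [set n | y n < (a + b) / 2] by apply: (cvgr_lt _ yb); lra.
have h2 : U [set n | (a + b) / 2 < x n] by apply: (cvgr_gt _ xa); lra.
have [n /= [[h3 h4] h5]] := filter_ex (filterI (filterI h1 h2) xy).
lra.
Qed.

Lemma ultra_cvg_unique (x : nat -> R) (a b : R) :
  x n @[n --> U] --> a -> x n @[n --> U] --> b -> a = b.
Proof.
have PF : ProperFilter U := ultra_proper.
move=> xa xb; apply/eqP; rewrite eq_le; apply/andP; split.
  by apply: (ultra_cvg_le xa xb); apply: filterS filterT => n _ /=.
by apply: (ultra_cvg_le xb xa); apply: filterS filterT => n _ /=.
Qed.

Lemma ultra_squeeze0 (x y : nat -> R) : U [set n | `|x n| <= y n] ->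
  y n @[n --> U] --> (0 : R) -> x n @[n --> U] --> (0 : R).
Proof.
have PF : ProperFilter U := ultra_proper.
move=> xy y0; apply/cvgrPdist_lt => e e0.
have h : U [set n | y n < e] by apply: (cvgr_lt _ y0).
by apply: filterS (filterI xy h) => n /= [a b]; rewrite sub0r normrN; apply: le_lt_trans a b.
Qed.

Lemma ultra_harmonic : \oo `<=` U -> (n.+1%:R^-1 : R) @[n --> U] --> (0 : R).
Proof.
move=> Uoo; have PF : ProperFilter U := ultra_proper.
by apply: cvg_trans (@cvg_harmonic R); apply: cvg_app.
Qed.

End Ultrafilter.

(** * Compact Ptolemy spaces and their inversions *)

Section PtolemySpace.
Variables (R : realType) (X : Type).

(** All that later steps keep of the compact topology: [pc_net] is total boundedness, and [pc_limit]
    makes every sequence converge along the same [U]. The bound [pc_le1] makes [dl] smaller than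
    each [rho w]. *)
Record ptolemy_compact (U : set_system nat) (dl : X -> X -> R) : Prop := PtolemyCompact {
  pc_ultra : UltraFilter U;
  pc_cofinite : \oo `<=` U;
  pc_eq0 : forall x y, dl x y = 0 <-> x = y;
  pc_sym : forall x y, dl x y = dl y x;
  pc_tri : forall x y z, dl x z <= dl x y + dl y z;
  pc_le1 : forall x y, dl x y <= 1;
  pc_ptolemy : forall x y z w, dl x y * dl z w <= dl x z * dl y w + dl x w * dl y z;
  pc_net : forall e, 0 < e -> exists n (f : nat -> X), forall x, exists2 i, (i < n)%N & dl x (f i) < e;
  pc_limit : forall x : nat -> X, exists y, dl (x n) y @[n --> U] --> (0 : R);
  pc_three : exists x y z : X, x <> y /\ y <> z /\ x <> z }.

Variable dl : X -> X -> R.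

(* The metric obtained by sending [w] to infinity; junk value [0] if [x] or [y] is [w]. *)
Definition rho (w x y : X) : R := dl x y / (dl x w * dl y w).

(* The ray from [u] points away from [v] or passes through [v]. *)
Definition has_rays : Prop := forall w u v, u <> w -> v <> w -> u <> v ->
  exists g : R -> X, g 0 = u /\ (forall t, 0 <= t -> g t <> w) /\
    (forall s t, 0 <= s -> 0 <= t -> rho w (g s) (g t) = `|s - t|) /\
    ((forall t, 0 <= t -> rho w v (g t) = rho w v u + t) \/ g (rho w v u) = v).

Variables (U : set_system nat).
Hypothesis pc : ptolemy_compact U dl.

Let UU : UltraFilter U. Proof. exact: pc_ultra pc. Qed.
Let PF : ProperFilter U. Proof. exact: (@ultra_proper _ _ UU). Qed.
#[local] Existing Instance PF.

Lemma dlxx x : dl x x = 0. Proof. exact/(pc_eq0 pc). Qed.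

Lemma dl_ge0 x y : 0 <= dl x y.
Proof. have := pc_tri pc x y x; rewrite dlxx (pc_sym pc y x); lra. Qed.

Lemma dl_gt0 x y : x <> y -> 0 < dl x y.
Proof.
by move=> xy; rewrite lt_neqAle dl_ge0 andbT; apply/eqP => h; apply: xy; apply/(pc_eq0 pc).
Qed.

Lemma dl_neq0 x y : x <> y -> dl x y != 0.
Proof. by move=> /dl_gt0; rewrite lt0r => /andP[]. Qed.

Lemma rhoC w x y : rho w x y = rho w y x.
Proof. by rewrite /rho (pc_sym pc x y) mulrC (mulrC (dl y w)) mulrC. Qed.

Lemma rhoxx w x : rho w x x = 0.
Proof. by rewrite /rho dlxx mul0r. Qed.

Lemma rho_ge0 w x y : 0 <= rho w x y.
Proof. by rewrite /rho divr_ge0 ?mulr_ge0 ?dl_ge0. Qed.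

Lemma rho_gt0 w x y : x <> w -> y <> w -> x <> y -> 0 < rho w x y.
Proof. by move=> *; rewrite /rho divr_gt0 ?mulr_gt0 ?dl_gt0. Qed.

Lemma rho_eq0 w x y : x <> w -> y <> w -> rho w x y = 0 -> x = y.
Proof. by move=> xw yw h; apply: contrapT => xy; have := rho_gt0 xw yw xy; rewrite h ltxx. Qed.

Lemma rhoE w x y : x <> w -> y <> w -> dl x y = rho w x y * (dl x w * dl y w).
Proof. by move=> xw yw; rewrite /rho divfK // mulf_neq0 ?dl_neq0. Qed.

(** This is the Ptolemy inequality for [x], [z], [y], [w], divided by [dl x w * dl y w * dl z w]. *)
Lemma rho_tri w x y z : x <> w -> y <> w -> z <> w ->
  rho w x z <= rho w x y + rho w y z.
Proof.
move=> xw yw zw; have := pc_ptolemy pc x z y w.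
have x0 := dl_gt0 xw; have y0 := dl_gt0 yw; have z0 := dl_gt0 zw.
rewrite (rhoE xw yw) (rhoE xw zw) (rhoE zw yw) (rhoC w z y) => h.
have p0 : 0 < dl x w * dl z w * dl y w by rewrite !mulr_gt0.
rewrite -(ler_pM2r p0); nra.
Qed.

Lemma rho_ptolemy w x y z t : x <> w -> y <> w -> z <> w -> t <> w ->
  rho w x y * rho w z t <= rho w x z * rho w y t + rho w x t * rho w y z.
Proof.
move=> xw yw zw tw; have := pc_ptolemy pc x y z t.
have x0 := dl_gt0 xw; have y0 := dl_gt0 yw; have z0 := dl_gt0 zw; have t0 := dl_gt0 tw.
rewrite (rhoE xw yw) (rhoE zw tw) (rhoE xw zw) (rhoE yw tw) (rhoE xw tw) (rhoE yw zw) => h.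
have p0 : 0 < dl x w * dl y w * dl z w * dl t w by rewrite !mulr_gt0.
rewrite -(ler_pM2r p0); nra.
Qed.

(** [rho b] and [rho w] have the same cross-ratios, so [rho w] is the inversion of [rho b] at [w],
    up to the scale [dl b w ^+ 2]. *)
Lemma rho_change b w x y : b <> w -> x <> b -> y <> b -> x <> w -> y <> w ->
  rho w x y = rho b x y / (dl b w ^+ 2 * (rho b x w * rho b y w)).
Proof.
move=> bw xb yb xw yw; rewrite /rho (pc_sym pc w b).
have := dl_neq0 bw; have := dl_neq0 xb; have := dl_neq0 yb; have := dl_neq0 xw; have := dl_neq0 yw.
by move=> h1 h2 h3 h4 h5; field; rewrite h1 h2 h3 h4 h5.
Qed.

(* [b] is the point at infinity of [rho b]; this is [rho_change] for [y = b]. *)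
Lemma rho_change_infty b w x : b <> w -> x <> b -> x <> w ->
  rho w x b = (dl b w ^+ 2 * rho b x w)^-1.
Proof.
move=> bw xb xw; rewrite /rho (pc_sym pc w b).
have := dl_neq0 bw; have := dl_neq0 xb; have := dl_neq0 xw.
by move=> h1 h2 h3; field; rewrite h1 h2 h3.
Qed.

Lemma dl_le_rho w x y : x <> w -> y <> w -> dl x y <= rho w x y.
Proof.
move=> xw yw; rewrite (rhoE xw yw) -[leRHS]mulr1 ler_wpM2l ?rho_ge0 //.
by rewrite mulr_ile1 ?dl_ge0 ?(pc_le1 pc).
Qed.

Lemma cvg_dl (x y : nat -> X) a b : dl (x n) a @[n --> U] --> (0 : R) ->
  dl (y n) b @[n --> U] --> (0 : R) -> dl (x n) (y n) @[n --> U] --> dl a b.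
Proof.
move=> xa yb; apply/(@subr_cvg0 _ _ _ U PF).
apply: (@ultra_squeeze0 _ _ UU (fun n => dl (x n) (y n) - dl a b) (fun n => dl (x n) a + dl (y n) b)).
  apply: filterS filterT => n _ /=; rewrite ler_norml.
  have := pc_tri pc (x n) a (y n); have := pc_tri pc a b (y n).
  have := pc_tri pc a (x n) b; have := pc_tri pc (x n) (y n) b.
  by rewrite (pc_sym pc b (y n)) (pc_sym pc a (x n)); lra.
by rewrite -[X in _ --> X](addr0 (0 : R)); exact: cvgD.
Qed.

Lemma cvg_dl_cst (a : X) : dl a a @[n --> U] --> (0 : R).
Proof. rewrite dlxx. exact: cvg_cst. Qed.

Lemma cvg_rho (w x y : nat -> X) c a b : a <> c -> b <> c ->
  dl (w n) c @[n --> U] --> (0 : R) -> dl (x n) a @[n --> U] --> (0 : R) ->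
  dl (y n) b @[n --> U] --> (0 : R) -> rho (w n) (x n) (y n) @[n --> U] --> rho c a b.
Proof.
move=> ac bc wc xa yb; rewrite /rho; apply: cvgM; first exact: cvg_dl.
apply: cvgV; first by rewrite mulf_neq0 ?dl_neq0.
by apply: cvgM; apply: cvg_dl.
Qed.

End PtolemySpace.

(** If on a grid of step [e] every second difference were at least [tol * e], the first difference
    would grow by [N * tol * e] over [N] steps. It stays between [- L * e] and [L * e], against
    [2 * L < N * tol]. *)
Lemma small_second_difference (R : realType) (F : R -> R) (t0 h tol L : R) :
  0 < h -> 0 < tol -> 0 <= L ->
  (forall s t, t0 - h <= s <= t0 + h -> t0 - h <= t <= t0 + h -> F s - F t <= L * `|s - t|) ->
  exists t e, 0 < e /\ t0 - h <= t - e /\ t + e <= t0 + h /\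
    F (t + e) + F (t - e) - 2 * F t < tol * e.
Proof.
move=> h0 tol0 L0 lip.
pose N := (Num.bound (2 * L / tol)).+1.
have N0 : 0 < N%:R :> R by rewrite ltr0n.
have NL : 2 * L < N%:R * tol.
  rewrite -ltr_pdivrMr //; apply: lt_le_trans (archi_boundP _) _.
    by rewrite divr_ge0 ?mulr_ge0 // ltW.
  by rewrite ler_nat.
pose e := 2 * h / N.+1%:R.
have e0 : 0 < e by rewrite divr_gt0 ?mulr_gt0 ?ltr0n.
pose s (k : nat) := t0 - h + k%:R * e.
have Ne : N.+1%:R * e = 2 * h by rewrite /e mulrC divfK // pnatr_eq0.
have sS k : s k.+1 = s k + e by rewrite /s -addn1 natrD mulrDl mul1r addrA.
have sB k : (k <= N.+1)%N -> t0 - h <= s k <= t0 + h.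
  move=> kN; have : k%:R * e <= N.+1%:R * e by rewrite ler_pM2r // ler_nat.
  have : 0 <= k%:R * e by rewrite mulr_ge0 ?ler0n ?(ltW e0).
  by rewrite Ne /s => ? ?; apply/andP; split; lra.
apply: contrapT => H.
have sd k : (k < N)%N -> tol * e <= F (s k.+2) + F (s k) - 2 * F (s k.+1).
  move=> kN; rewrite leNgt; apply/negP => lt; apply: H; exists (s k.+1), e.
  have := sB k.+2 kN; have := sB k (leqW (ltnW kN)); rewrite !sS in lt *.
  move=> /andP[? ?] /andP[? ?]; do !split => //; try lra.
  by move: lt; rewrite addrK.
have D k : (k <= N)%N -> F (s 1%N) - F (s 0%N) + k%:R * (tol * e) <= F (s k.+1) - F (s k).
  elim: k => [|k IH] kN; first by rewrite mul0r addr0.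
  by have := IH (ltnW kN); have := sd k kN; rewrite -[in k.+1%:R]addn1 natrD mulrDl mul1r; lra.
have l1 := lip _ _ (sB N.+1 (leqnn _)) (sB N (leqnSn _)).
have l2 := lip _ _ (sB 0%N isT) (sB 1%N isT).
have := D N (leqnn _).
have e1 : `|s N.+1 - s N| = e by rewrite sS addrC addKr ger0_norm // ltW.
have e2 : `|s 0%N - s 1%N| = e by rewrite sS opprD addrA subrr add0r normrN ger0_norm // ltW.
move: l1 l2; rewrite e1 e2 => l1 l2 l3.
have : N%:R * (tol * e) <= 2 * L * e by lra.
by rewrite mulrA ler_pM2r // leNgt NL.
Qed.

Lemma ultra_all_lt (U : set_system nat) (P : nat -> nat -> Prop) n :
  Filter U -> (forall i, (i < n)%N -> U [set k | P i k]) ->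
  U [set k | forall i, (i < n)%N -> P i k].
Proof.
move=> FU; elim: n => [|n IH] h; first by apply: filterS filterT.
apply: filterS (filterI (IH (fun i lt => h i (ltnW lt))) (h n (ltnSn n))) => k /= [h1 h2] i.
by rewrite ltnS leq_eqVlt => /orP[/eqP ->|]; auto.
Qed.

(** * Generic points at infinity *)

Section Generic.
Variables (R : realType) (X : Type) (dl : X -> X -> R) (U : set_system nat).
Hypothesis pc : ptolemy_compact U dl.
Hypothesis hr : has_rays dl.
Let UU : UltraFilter U. Proof. exact: pc_ultra pc. Qed.
Let PF : ProperFilter U. Proof. exact: (@ultra_proper _ _ UU). Qed.
#[local] Existing Instance PF.
Notation rho := (rho dl).

Lemma third_point a b : exists c : X, c <> a /\ c <> b.
Proof.
apply: contrapT => H.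
have E c : c = a \/ c = b by apply: contrapT => /not_orP[h1 h2]; apply: H; exists c.
have [x [y [z [xy [yz xz]]]]] := pc_three pc.
by case: (E x) => hx; case: (E y) => hy; case: (E z) => hz; congruence.
Qed.

(** There are no isolated points: a ray from [w0], with another point [e] at infinity, contains
    points at small nonzero [rho e]-distance from [w0], and [dl] is smaller still. *)
Lemma near_point w0 a b r : 0 < r -> a <> b -> exists w, w <> a /\ w <> b /\ dl w w0 < r.
Proof.
move=> r0 ab.
have main e : e <> w0 -> exists w, w <> e /\ w <> w0 /\ dl w w0 < r.
  move=> ew; have [c [ce cw]] := third_point e w0.
  have [g [g0 [gne [gd _]]]] := hr (fun h => ew (esym h)) ce (fun h => cw (esym h)).
  have h0 : 0 <= r / 2 by rewrite divr_ge0 ?ltW.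
  have d0 : rho e (g (r / 2)) w0 = r / 2 by rewrite -g0 gd // subr0 ger0_norm.
  exists (g (r / 2)); split; first exact: gne.
  split; first by move=> h; move: d0; rewrite h (rhoxx pc); lra.
  apply: le_lt_trans (dl_le_rho pc (gne _ h0) _) _; last by rewrite d0; lra.
  exact: nesym.
have [wa|wa] := pselect (w0 = a).
  by subst w0; have [w [h1 [h2 h3]]] := main b (nesym ab); exists w.
have [wb|wb] := pselect (w0 = b).
  by subst w0; have [w [h1 [h2 h3]]] := main a ab; exists w.
by exists w0; rewrite (dlxx pc).
Qed.

(* The points [f i] nearly lie between [a'] and [b'], and [a'] nearly realizes [rho w a b]: in the limit,
   [rho w _ a'] becomes an affine 1-Lipschitz function separating [a] and [b]. *)
Definition smooth_at (n : nat) (f : nat -> X) (a b : X) (e : R) (w : X) : Prop :=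
  a <> w /\ b <> w /\ exists a' b', a' <> w /\ b' <> w /\
    (forall i, (i < n)%N -> f i <> w /\ rho w (f i) a' + rho w (f i) b' - rho w a' b' < e) /\
    rho w a b - e < rho w a a' - rho w b a'.

Lemma cvg_dl_harmonic (x : nat -> X) a : (forall n, dl (x n) a < n.+1%:R^-1) ->
  dl (x n) a @[n --> U] --> (0 : R).
Proof.
move=> xa; apply: (@ultra_squeeze0 _ _ UU _ (fun n => n.+1%:R^-1)).
  by apply: filterS filterT => n _ /=; rewrite ger0_norm ?(dl_ge0 pc) // ltW.
exact: (@ultra_harmonic R U (pc_cofinite pc)).
Qed.

Lemma ultra_neq (x : nat -> X) a c : dl (x n) a @[n --> U] --> (0 : R) -> c <> a ->
  U [set n | c <> x n].
Proof.
move=> xa ca; have h := cvg_dl pc xa (cvg_dl_cst pc c).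
have : U [set n | 0 < dl (x n) c] by apply: (cvgr_gt _ h); apply: (dl_gt0 pc); apply: nesym.
by apply: filterS => n /= p cx; move: p; rewrite cx (dlxx pc) ltxx.
Qed.

(** For fixed [a'] and [b'] these are finitely many strict conditions, continuous in [w]; a sequence
    of bad points tending to [w] would violate one in the limit. *)
Lemma smooth_at_open n f a b e w : smooth_at n f a b e w ->
  exists2 r, 0 < r & forall w', dl w' w < r -> smooth_at n f a b e w'.
Proof.
move=> [aw [bw [a' [b' [a'w [b'w [hf hab]]]]]]]; apply: contrapT => H.
have : forall k : nat, exists w', dl w' w < k.+1%:R^-1 /\ ~ smooth_at n f a b e w'.
  move=> k; apply: contrapT => Hk; apply: H; exists k.+1%:R^-1; first by rewrite invr_gt0 ltr0n.
  by move=> w' h; apply: contrapT => h'; apply: Hk; exists w'.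
move=> /choice[x hx].
have xw := cvg_dl_harmonic (fun k => (hx k).1).
have C := cvg_dl_cst pc.
have R2 p q : p <> w -> q <> w -> rho (x k) p q @[k --> U] --> rho w p q.
  by move=> pw qw; apply: (cvg_rho pc pw qw xw (C p) (C q)).
have hF : U [set k | forall i, (i < n)%N ->
    f i <> x k /\ rho (x k) (f i) a' + rho (x k) (f i) b' - rho (x k) a' b' < e].
  apply: ultra_all_lt => i lt; have [fw h] := hf i lt.
  apply: filterI; first exact: ultra_neq xw fw.
  apply: (cvgr_lt _ _ _ h); apply: cvgB; last exact: R2.
  by apply: cvgD; apply: R2.
have hA : U [set k | 0 < rho (x k) a a' - rho (x k) b a' - (rho (x k) a b - e)].
  apply: (cvgr_gt (rho w a a' - rho w b a' - (rho w a b - e))); last by rewrite subr_gt0.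
  apply: cvgB; first by apply: cvgB; apply: R2.
  by apply: cvgB; [apply: R2|exact: cvg_cst].
have N c : c <> w -> U [set k | c <> x k] by exact: ultra_neq xw.
have [k /= [[[[[h1 h2] h3] h4] h5] h6]] := filter_ex (filterI (filterI (filterI (filterI
  (filterI (N a aw) (N b bw)) (N a' a'w)) (N b' b'w)) hF) hA).
apply: (hx k).2; split=> //; split=> //; exists a', b'; split=> //; split=> //.
by split; [exact: h5|rewrite -subr_gt0].
Qed.

Lemma avoid_finite (g : R -> X) (n : nat) (f : nat -> X) (eta : R) :
  (forall s t, 0 <= s -> 0 <= t -> g s = g t -> s = t) -> 0 < eta ->
  exists2 eta', 0 < eta' <= eta & forall t, 0 < t < eta' -> forall i, (i < n)%N -> f i <> g t.
Proof.
move=> inj e0; elim: n => [|n [eta' /andP[e1 e2] h]].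
  by exists eta; rewrite ?e0 ?lexx.
have [[s [s0 gs]]|no] := pselect (exists s, 0 < s /\ f n = g s).
  exists (Num.min eta' s); first by rewrite lt_min e1 s0 ge_min e2.
  move=> t; rewrite lt_min => /andP[t0 /andP[t1 t2]] i.
  rewrite ltnS leq_eqVlt => /orP[/eqP ->|lt]; last by apply: h => //; rewrite t0.
  by rewrite gs => /inj st; move: t2; rewrite st ?ltxx ?ltW.
exists eta'; first by rewrite e1.
move=> t tt i; rewrite ltnS leq_eqVlt => /orP[/eqP -> fg|lt]; last exact: h.
by apply: no; exists t; move/andP: tt => [].
Qed.

Lemma finite_lower_bound (n : nat) (p : nat -> R) : (forall i, (i < n)%N -> 0 < p i) ->
  exists2 c, 0 < c & forall i, (i < n)%N -> c <= p i.
Proof.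
elim: n => [|n IH] h; first by exists 1.
have [c c0 hc] := IH (fun i lt => h i (ltnW lt)).
exists (Num.min c (p n)); first by rewrite lt_min c0 h.
by move=> i; rewrite ltnS leq_eqVlt ge_min => /orP[/eqP ->|/hc ->//]; rewrite lexx orbT.
Qed.

(** In [rho w] the excess of [f i] is its second difference in [rho b] divided by
    [ep * (K * rho b (f i) w)], and [b], the former point at infinity, lies exactly between [a'] and
    [b']. As [a'] continues the geodesic from [a] to [w], [rho w a b] equals
    [rho w a a' - rho w b a']. *)
Lemma smooth_at_from_ray n f a b w a' b' (e ep c : R) :
  0 < e -> 0 < ep -> 0 < c ->
  a <> b -> w <> b -> a' <> b -> b' <> b -> a <> w ->
  rho b a' w = ep -> rho b b' w = ep -> rho b a' b' = 2 * ep ->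
  c <= dl w b ->
  (forall i, (i < n)%N -> c <= dl (f i) w /\ (f i <> b ->
     rho b (f i) a' + rho b (f i) b' - 2 * rho b (f i) w < e * c ^+ 2 * ep)) ->
  rho b a a' = rho b a w + ep -> smooth_at n f a b e w.
Proof.
move=> e0 ep0 c0 ab wb a'b b'b aw ra' rb' rab cwb hf ha.
have a'w : a' <> w by move=> h; move: ra'; rewrite h (rhoxx pc); lra.
have b'w : b' <> w by move=> h; move: rb'; rewrite h (rhoxx pc); lra.
have bw := nesym wb.
set K := dl b w ^+ 2.
have K0 : 0 < K by rewrite exprn_gt0 ?(dl_gt0 pc).
have rw := rho_change pc bw; have ri := rho_change_infty pc bw.
have raw : 0 < rho b a w by apply: (rho_gt0 pc).
split=> //; split=> //; exists a', b'; split=> //; split=> //; split; last first.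
  rewrite (rw _ _ ab a'b aw a'w) (ri _ ab aw) (rhoC pc w b) (ri _ a'b a'w) ra' ha -/K.
  rewrite [ltRHS](_ : _ = (K * rho b a w)^-1); first by lra.
  by field; rewrite !gt_eqF.
move=> i lt; have [ci hi] := hf i lt.
have pw : f i <> w by move=> h; move: ci; rewrite h (dlxx pc); lra.
split=> //; have [pb|pb] := pselect (f i = b).
  rewrite pb (rhoC pc w b a') (rhoC pc w b b') !ri // rw // ra' rb' rab -/K.
  rewrite [ltLHS](_ : _ = 0) //.
  by field; rewrite !gt_eqF.
have rp : 0 < rho b (f i) w by apply: (rho_gt0 pc).
rewrite !rw // ra' rb' rab -/K.
rewrite [ltLHS](_ : _ = (rho b (f i) a' + rho b (f i) b' - 2 * rho b (f i) w) / (ep * (K * rho b (f i) w))).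
  2: by field; rewrite !gt_eqF.
have P0 : 0 < ep * (K * rho b (f i) w) by rewrite mulr_gt0 // mulr_gt0.
rewrite (ltr_pdivrMr _ _ P0); apply: lt_le_trans (hi pb) _.
rewrite [leRHS](_ : _ = e * (K * rho b (f i) w) * ep); last by ring.
rewrite ler_pM2r // ler_pM2l //.
(* As [dl <= 1], this form shows [c ^+ 2 <= K * rho b (f i) w]. *)
have -> : K * rho b (f i) w = dl b w * dl (f i) w / dl (f i) b.
  have rhoD x y z : rho x y z = dl y z / (dl y x * dl z x) by [].
  rewrite /K rhoD (pc_sym pc w b).
  by field; rewrite !gt_eqF ?(dl_gt0 pc).
rewrite ler_pdivlMr ?(dl_gt0 pc) //.
have := pc_le1 pc (f i) b; have := dl_ge0 pc (f i) b; rewrite (pc_sym pc b w) => h1 h2.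
have h3 : c ^+ 2 <= dl w b * dl (f i) w by rewrite expr2 ler_pM // ltW.
have : c ^+ 2 * dl (f i) b <= c ^+ 2 * 1 by rewrite ler_pM2l // exprn_gt0.
lra.
Qed.

(** The point [w] lies on a ray of [rho b] starting near [w0], at a parameter where the summed
    distances to the [f i] have a small second difference. *)
Lemma smooth_at_dense n f a b e w0 r : a <> b -> 0 < e -> 0 < r ->
  exists2 w, dl w w0 < r & smooth_at n f a b e w.
Proof.
move=> ab e0 r0; have r2 : 0 < r / 2 by lra.
have [w1 [w1a [w1b w10]]] := near_point w0 r2 ab.
have [g [g0 [gb [gd galt]]]] := hr w1b ab w1a.
set T := rho b a w1 in galt.
have T0 : 0 < T by apply: (rho_gt0 pc) => //; apply: nesym.
have inj s t : 0 <= s -> 0 <= t -> g s = g t -> s = t.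
  move=> s0 t0 st; have := gd _ _ s0 t0; rewrite st (rhoxx pc) => /esym /eqP.
  by rewrite normr_eq0 subr_eq0 => /eqP.
have dg s t : 0 <= s -> 0 <= t -> dl (g s) (g t) <= `|s - t|.
  by move=> s0 t0; rewrite -gd //; apply: (dl_le_rho pc); apply: gb.
have eta0 : 0 < Num.min (r / 2) T by rewrite lt_min r2 T0.
have [eta /andP[eta1]] := avoid_finite n f inj eta0.
rewrite le_min => /andP[eta2 eta3] av.
pose t0 := eta / 2.
have t00 : 0 < t0 by rewrite /t0; lra.
have t0e : 0 < t0 < eta by rewrite /t0; lra.
have [c1 c10 hc1] : exists2 c, 0 < c & forall i, (i < n)%N -> c <= dl (f i) (g t0).
  by apply: finite_lower_bound => i lt; apply: (dl_gt0 pc); apply: av.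
have gb0 : 0 < dl (g t0) b by apply: (dl_gt0 pc); apply: gb; apply: ltW.
(* Half of the minimum, so that points within [c] of [g t0] still have distance at least [c] from
   [b] and from every [f i]. *)
pose c := Num.min c1 (dl (g t0) b) / 2.
have c0 : 0 < c by rewrite divr_gt0 // lt_min c10.
have cc1 : 2 * c <= c1 by rewrite /c mulrC divfK // ge_min lexx.
have ccb : 2 * c <= dl (g t0) b by rewrite /c mulrC divfK // ge_min lexx orbT.
pose h := Num.min (eta / 4) c.
have h0 : 0 < h by rewrite lt_min c0 andbT; lra.
have he : h <= eta / 4 by rewrite ge_min lexx.
have hc : h <= c by rewrite ge_min lexx orbT.
pose phi i t := if pselect (f i = b) then 0 else rho b (f i) (g t).
have philip i s t : 0 <= s -> 0 <= t -> phi i s - phi i t <= `|s - t|.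
  move=> s0 tt0; rewrite /phi; case: pselect => fb /=; first by rewrite subr0.
  rewrite -gd //; have := rho_tri pc fb (gb _ tt0) (gb _ s0).
  rewrite (rhoC pc b (g t) (g s)); lra.
(* Ptolemy for [f i] and three equally spaced points of the geodesic is midpoint convexity of the
   distance to [f i]. *)
have phiconv i t ep : 0 < ep -> 0 <= t - ep -> 0 <= phi i (t + ep) + phi i (t - ep) - 2 * phi i t.
  move=> ep0 te; rewrite /phi; case: pselect => fb /=; first by lra.
  have p1 : 0 <= t by lra.
  have p2 : 0 <= t + ep by lra.
  have := rho_ptolemy pc fb (gb _ p1) (gb _ te) (gb _ p2).
  rewrite !gd //.
  have -> : t - ep - (t + ep) = - (2 * ep) by ring.
  have -> : t - (t + ep) = - ep by ring.
  have -> : t - (t - ep) = ep by ring.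
  rewrite !normrN !ger0_norm ?mulr_ge0 ?(ltW ep0) // => H.
  rewrite -(pmulr_lge0 _ ep0); lra.
pose F t := \sum_(i < n) phi i t.
have [||||t [ep [ep0 [te1 [te2 Ft]]]]] := @small_second_difference R F t0 h (e * c ^+ 2) n%:R.
- exact: h0.
- by rewrite mulr_gt0 ?exprn_gt0.
- by [].
- move=> s t ss tt; rewrite /F -sumrB.
  apply: le_trans (_ : \sum_(i < n) `|s - t| <= _).
    by apply: ler_sum => i _; apply: philip; rewrite /t0 in ss tt; lra.
  by rewrite sumr_const card_ord mulr_natl.
have tm : 0 < t - ep by rewrite /t0 in te1; lra.
have tp : t + ep < eta by rewrite /t0 in te2; lra.
have tt0 : 0 <= t by lra.
have tp0 : 0 <= t + ep by lra.
have tm0 : 0 <= t - ep by lra.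
(* All summands have nonnegative second differences, so each is bounded by that of the sum. *)
have sd i : (i < n)%N -> phi i (t + ep) + phi i (t - ep) - 2 * phi i t < e * c ^+ 2 * ep.
  move=> lt; apply: le_lt_trans Ft.
  rewrite /F mulr_sumr -big_split /= -sumrB (bigD1 (Ordinal lt)) //= lerDl.
  by apply: sumr_ge0 => j _; apply: phiconv => //; exact: ltW.
have tc : dl (g t0) (g t) <= c.
  by apply: le_trans (dg _ _ (ltW t00) tt0) _; rewrite ler_norml; lra.
have cb : c <= dl (g t) b by have := pc_tri pc (g t0) (g t) b; lra.
have cf i : (i < n)%N -> c <= dl (f i) (g t).
  move=> lt; have := pc_tri pc (f i) (g t) (g t0); have := hc1 i lt.
  by rewrite (pc_sym pc (g t) (g t0)); lra.
have aw : a <> g t.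
  case: galt => [/(_ t tt0) ga|ga] h'; first by move: ga; rewrite -h' (rhoxx pc); lra.
  by have := inj _ _ (ltW T0) tt0 (etrans ga h'); lra.
have gp : rho b (g (t + ep)) (g t) = ep.
  by rewrite gd // [t + ep]addrC addrK ger0_norm // ltW.
have gm : rho b (g (t - ep)) (g t) = ep.
  by rewrite gd // [t - ep]addrC addrK normrN ger0_norm // ltW.
have gpm : rho b (g (t + ep)) (g (t - ep)) = 2 * ep.
  rewrite gd // (_ : t + ep - (t - ep) = 2 * ep); last by ring.
  by rewrite ger0_norm // mulr_ge0 // ltW.
exists (g t).
  apply: le_lt_trans (pc_tri pc _ w1 _) _.
  have := dg _ _ tt0 (lexx 0); rewrite g0 subr0 (ger0_norm tt0).
  by lra.
(* [a'] is the neighbour of [g t] on the side away from [a]: ahead if the ray points away from [a],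
   behind if it reaches [a] at [T], which is beyond [t]. *)
case: galt => [ga|ga].
  apply: (@smooth_at_from_ray n f a b (g t) (g (t + ep)) (g (t - ep)) e ep c) => //; try exact: gb.
    move=> i lt; split; first exact: cf.
    by move=> fb; have := sd i lt; rewrite /phi; case: pselect => //= _; lra.
  by rewrite !ga // addrA.
apply: (@smooth_at_from_ray n f a b (g t) (g (t - ep)) (g (t + ep)) e ep c) => //; try exact: gb.
- by rewrite (rhoC pc).
- move=> i lt; split; first exact: cf.
  by move=> fb; have := sd i lt; rewrite /phi; case: pselect => //= _; lra.
- rewrite -ga !gd ?(ltW T0) // !ger0_norm; lra.
Qed.

End Generic.

(** * Affine functions at a generic point *)

Section AffineFunctions.
Variables (R : realType) (X : Type) (dl : X -> X -> R) (U : set_system nat).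
Hypothesis pc : ptolemy_compact U dl.
Hypothesis hr : has_rays dl.
Let UU : UltraFilter U. Proof. exact: pc_ultra pc. Qed.
Let PF : ProperFilter U. Proof. exact: (@ultra_proper _ _ UU). Qed.
#[local] Existing Instance PF.
Notation rho := (rho dl).

(** The centres of nested closed balls have a limit along [U]; it lies in every ball because [U]
    contains the tails of [nat]. *)
Lemma baire (C : nat -> X -> Prop) :
  (forall n w, C n w -> exists2 r, 0 < r & forall w', dl w' w < r -> C n w') ->
  (forall n w0 r, 0 < r -> exists2 w, dl w w0 < r & C n w) ->
  exists w, forall n, C n w.
Proof.
move=> op de.
have step (np : nat * (X * R)) : exists q : X * R, 0 < np.2.2 -> 0 < q.2 /\
    forall x, dl x q.1 <= q.2 -> dl x np.2.1 <= np.2.2 /\ C np.1 x.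
  case: np => n [w0 r] /=; have [r0|r0] := pselect (0 < r); last by exists (w0, r).
  have [|w ww Cw] := de n w0 (r / 2); first by lra.
  have [r' r'0 hr'] := op n w Cw.
  exists (w, Num.min r' r / 2) => _ /=; split; first by rewrite divr_gt0 // lt_min r'0.
  move=> x xw; have h1 : Num.min r' r <= r' by rewrite ge_min lexx.
  have h2 : Num.min r' r <= r by rewrite ge_min lexx orbT.
  have h3 : 0 < Num.min r' r by rewrite lt_min r'0.
  by split; [have := pc_tri pc x w w0; lra|apply: hr'; lra].
have [nx hnx] := choice step.
have [x0 _] := pc_three pc.
pose s := fix s k := if k is k'.+1 then nx (k', s k') else (x0, 1).
have spos k : 0 < (s k).2 by elim: k => [|k IH] //=; case: (hnx (k, s k)).
have sball k x : dl x (s k.+1).1 <= (s k.+1).2 -> dl x (s k).1 <= (s k).2 /\ C k x.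
  by move=> h; have [_ h'] := hnx (k, s k) (spos k); apply: h'.
have nest k j x : dl x (s (k + j)%N).1 <= (s (k + j)%N).2 -> dl x (s k).1 <= (s k).2.
  elim: j => [|j IH]; first by rewrite addn0.
  by rewrite addnS => /sball[/IH].
have [y hy] := pc_limit pc (fun k => (s k).1).
exists y => n; apply: (sball n y _).2.
apply: (ultra_cvg_le UU (x := fun k => dl (s k).1 y + dl (s k).1 (s n.+1).1 - dl (s k).1 y) (y := fun=> (s n.+1).2) (a := dl y (s n.+1).1)); last first.
- have : \oo [set k | (n.+1 <= k)%N] by exists n.+1.
  move=> /(pc_cofinite pc); apply: filterS => k /= /subnKC kE.
  by rewrite addrAC subrr add0r -kE; apply: (nest n.+1 (k - n.+1)%N); rewrite (dlxx pc) ltW.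
- exact: cvg_cst.
- have h : dl (s k).1 (s n.+1).1 @[k --> U] --> dl y (s n.+1).1.
    by apply: (cvg_dl pc hy (cvg_dl_cst pc _)).
  rewrite -[X in _ --> X]subr0 -[X in X - 0]add0r; exact: cvgB (cvgD hy h) hy.
Qed.

Definition nonexp (w : X) (A : X -> R) : Prop :=
  forall x y, x <> w -> y <> w -> A x - A y <= rho w x y.

(** Denominators are cleared, so that degenerate triples need no case distinction. *)
Definition btw_affine (w : X) (A : X -> R) : Prop :=
  forall x y z, x <> w -> y <> w -> z <> w -> rho w x y + rho w y z = rho w x z ->
  A y * rho w x z = A x * rho w y z + A z * rho w x y.

Lemma generic_point : exists w, forall m, exists n (f : nat -> X),
  (forall x, exists2 i, (i < n)%N & dl x (f i) < m.+1%:R^-1) /\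
  forall i j, (i < n)%N -> (j < n)%N -> f i <> f j ->
    smooth_at dl n f (f i) (f j) m.+1%:R^-1 w.
Proof.
have e0 m : 0 < m.+1%:R^-1 :> R by rewrite invr_gt0 ltr0n.
have /choice[N /choice[F hF]] := fun m => pc_net pc (e0 m).
(* One condition for each triple [(m, i, j)], indexed by its code; a number that codes no triple
   imposes nothing. *)
pose C k w := if unpickle k is Some (m, i, j) then
  F m i <> F m j -> smooth_at dl (N m) (F m) (F m i) (F m j) m.+1%:R^-1 w else True.
have [||w hw] := @baire C.
- move=> k w; rewrite /C; case: unpickle => [[[m i] j]|]; last by exists 1.
  have [eq _|ne /(_ ne)h] := pselect (F m i = F m j); first by exists 1.
  by have [r r0 h'] := smooth_at_open pc h; exists r => // w' /h'.
- move=> k w0 r r0; rewrite /C; case: unpickle => [[[m i] j]|]; last by exists w0; rewrite ?(dlxx pc).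
  have [eq|ne] := pselect (F m i = F m j); first by exists w0; rewrite ?(dlxx pc).
  by have [w h1 h2] := smooth_at_dense pc hr (N m) (F m) w0 ne (e0 m) r0; exists w.
exists w => m; exists (N m), (F m); split; first exact: hF.
by move=> i j _ _; have := hw (pickle (m, i, j)); rewrite /C pickleK.
Qed.

(** [A] is the limit of the normalized distances [g m] to [(q m).1]. These are convex by the Ptolemy
    inequality, and so are the [h m] built from the opposite end [(q m).2]. As [g m + h m] tends to
    [0], the limit [- A] of [h m] is convex as well. *)
Lemma affine_functions_exist : exists w, forall a b, a <> w -> b <> w ->
  exists A, nonexp w A /\ btw_affine w A /\ A a - A b = rho w a b.
Proof.
have [w /choice[N /choice[F hF]]] := generic_point.
exists w => a b aw bw.
have [<-|ab] := pselect (a = b).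
  exists (fun=> 0); split; first by move=> x y _ _; rewrite subr0 (rho_ge0 pc).
  by split; [move=> *; rewrite !mul0r addr0|rewrite subr0 (rhoxx pc)].
have approx x : exists xi : nat -> nat, forall m, (xi m < N m)%N /\ dl x (F m (xi m)) < m.+1%:R^-1.
  suff /choice[xi h] : forall m, exists i, (i < N m)%N /\ dl x (F m i) < m.+1%:R^-1 by exists xi.
  by move=> m; have [i] := (hF m).1 x; exists i.
have [ai hai] := approx a; have [bi hbi] := approx b.
pose am m := F m (ai m); pose bm m := F m (bi m).
have cvgF x (xi : nat -> nat) : (forall m, (xi m < N m)%N /\ dl x (F m (xi m)) < m.+1%:R^-1) ->
    dl (F m (xi m)) x @[m --> U] --> (0 : R).
  by move=> h; apply: (cvg_dl_harmonic pc) => m; rewrite (pc_sym pc); case: (h m).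
have cam := cvgF _ _ hai; have cbm := cvgF _ _ hbi.
have good : U [set m | am m <> bm m].
  have : U [set m | 0 < dl (am m) (bm m)].
    by apply: (cvgr_gt _ (cvg_dl pc cam cbm)); apply: (dl_gt0 pc).
  by apply: filterS => m /= h e; move: h; rewrite e (dlxx pc) ltxx.
have /choice[q hq] : forall m, exists q : X * X, am m <> bm m -> am m <> w /\ bm m <> w /\ q.1 <> w /\ q.2 <> w /\
    (forall i, (i < N m)%N -> F m i <> w /\ rho w (F m i) q.1 + rho w (F m i) q.2 - rho w q.1 q.2 < m.+1%:R^-1) /\
    rho w (am m) (bm m) - m.+1%:R^-1 < rho w (am m) q.1 - rho w (bm m) q.1.
  move=> m; have [e|ne] := pselect (am m = bm m); first by exists (w, w).
  have [h1 [h2 [a' [b' [h3 [h4 [h5 h6]]]]]]] := (hF m).2 _ _ (hai m).1 (hbi m).1 ne.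
  by exists (a', b').
pose g m x := if pselect (am m <> bm m) then rho w x (q m).1 - rho w b (q m).1 else 0.
pose h m x := if pselect (am m <> bm m) then rho w x (q m).2 + rho w b (q m).1 - rho w (q m).1 (q m).2 else 0.
have glip m x y : x <> w -> y <> w -> g m x - g m y <= rho w x y.
  move=> xw yw; rewrite /g; case: pselect => [gd|_] /=; last by rewrite subr0 (rho_ge0 pc).
  have [_ [_ [q1 _]]] := hq m gd.
  by have := rho_tri pc xw yw q1; lra.
have /choice[A hA] : forall x, exists l : R, x <> w -> g m x @[m --> U] --> l.
  move=> x; have [->|xw] := pselect (x = w); first by exists 0.
  have [|l hl] := @ultra_bounded_cvg _ _ UU (fun m => g m x) (rho w x b); last by exists l.
  move=> m; rewrite ler_norml.
  have gb : g m b = 0 by rewrite /g; case: pselect => //= _; rewrite subrr.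
  have := glip m _ _ xw bw; have := glip m _ _ bw xw; rewrite gb (rhoC pc w b x); lra.
have gconv m x y z : x <> w -> y <> w -> z <> w -> rho w x y + rho w y z = rho w x z ->
    g m y * rho w x z <= g m x * rho w y z + g m z * rho w x y.
  move=> xw yw zw xyz; rewrite /g; case: pselect => [gd|_] /=; last by rewrite !mul0r addr0.
  have [_ [_ [q1 _]]] := hq m gd.
  have := rho_ptolemy pc q1 yw xw zw; rewrite -xyz !(rhoC pc w (q m).1) (rhoC pc w y x); nra.
have hconv m x y z : x <> w -> y <> w -> z <> w -> rho w x y + rho w y z = rho w x z ->
    h m y * rho w x z <= h m x * rho w y z + h m z * rho w x y.
  move=> xw yw zw xyz; rewrite /h; case: pselect => [gd|_] /=; last by rewrite !mul0r addr0.
  have [_ [_ [_ [q2 _]]]] := hq m gd.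
  have := rho_ptolemy pc q2 yw xw zw; rewrite -xyz !(rhoC pc w (q m).2) (rhoC pc w y x); nra.
(* [g m x + h m x] is the excess of [x] over the distance between the two ends; it is small at the
   net point near [x], and moving to [x] costs at most twice their distance. *)
have hA' x : x <> w -> h m x @[m --> U] --> - A x.
  move=> xw; have [xi hxi] := approx x; have cxm := cvgF _ _ hxi.
  have c1 : (m.+1%:R^-1 + 2 * rho w x (F m (xi m))) @[m --> U] --> (0 : R).
    rewrite [X in _ --> X](_ : _ = 0 + 2 * rho w x x); last by rewrite (rhoxx pc) mulr0 addr0.
    apply: cvgD; first exact: (@ultra_harmonic R U (pc_cofinite pc)).
    apply: cvgM; first exact: cvg_cst.
    by apply: (cvg_rho pc) => //; apply: cvg_dl_cst pc _.
  have c2 : (g m x + h m x) @[m --> U] --> (0 : R).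
    apply: (@ultra_squeeze0 _ _ UU _ _ _ c1); apply: filterS good => m /= gm.
    rewrite /g /h; case: pselect => //= gd.
    have [_ [_ [q1 [q2 [h5 _]]]]] := hq m gd.
    have [fw h6] := h5 _ (hxi m).1.
    have t1 := rho_tri pc xw fw q1; have t2 := rho_tri pc xw fw q2.
    have t3 := rho_tri pc q1 xw q2; rewrite (rhoC pc w _ x) in t3.
    by move: (m.+1%:R^-1) h6 => ee h6; rewrite ger0_norm; lra.
  rewrite -[X in _ --> X]sub0r.
  rewrite (_ : (fun m => h m x) = (fun m => g m x + h m x) \- (fun m => g m x)).
    exact: cvgB c2 (hA x xw).
  by apply/funext => m /=; rewrite addrC addKr.
exists A; split.
  move=> x y xw yw; apply: (ultra_cvg_le UU (cvgB (hA x xw) (hA y yw)) (@cvg_cst _ (rho w x y) _ U _)).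
  by apply: filterS filterT => m _ /=; apply: glip.
have cst c : (fun _ : nat => c : R) @ U --> c by exact: cvg_cst.
split; last first.
  apply/eqP; rewrite eq_le; apply/andP; split.
    apply: (ultra_cvg_le UU (cvgB (hA a aw) (hA b bw)) (cst (rho w a b))).
    by apply: filterS filterT => m _ /=; apply: glip.
  (* [lo] is the separation known for the net points [am m] and [bm m], less the cost of moving to
     [a] and [b]. *)
  pose lo m := rho w (am m) (bm m) - m.+1%:R^-1 - rho w a (am m) - rho w b (bm m).
  have clo : lo m @[m --> U] --> rho w a b.
    rewrite [X in _ --> X](_ : _ = rho w a b - 0 - rho w a a - rho w b b); last by rewrite !(rhoxx pc) !subr0.
    apply: cvgB; last by apply: (cvg_rho pc) => //; apply: cvg_dl_cst pc _.
    apply: cvgB; last by apply: (cvg_rho pc) => //; apply: cvg_dl_cst pc _.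
    apply: cvgB; last exact: (@ultra_harmonic R U (pc_cofinite pc)).
    by apply: (cvg_rho pc) => //; apply: cvg_dl_cst pc _.
  suff hh : U [set m | lo m <= g m a - g m b].
    exact: (ultra_cvg_le UU clo (cvgB (hA a aw) (hA b bw)) hh).
  apply: filterS good => m /= gm; rewrite /lo /g; case: pselect => //= gd.
  have [h1 [h2 [q1 [q2 [h5 h6]]]]] := hq m gd.
  have t1 := rho_tri pc h1 aw q1; rewrite (rhoC pc w (am m) a) in t1.
  have t2 := rho_tri pc bw h2 q1.
  by move: (m.+1%:R^-1) h6 => ee h6; lra.
move=> x y z xw yw zw xyz; apply/eqP; rewrite eq_le; apply/andP; split.
  apply: (ultra_cvg_le UU (cvgM (hA y yw) (cst (rho w x z)))
    (cvgD (cvgM (hA x xw) (cst (rho w y z))) (cvgM (hA z zw) (cst (rho w x y))))).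
  by apply: filterS filterT => m _ /=; apply: gconv.
have : - A y * rho w x z <= - A x * rho w y z + - A z * rho w x y.
  apply: (ultra_cvg_le UU (cvgM (hA' y yw) (cst (rho w x z)))
    (cvgD (cvgM (hA' x xw) (cst (rho w y z))) (cvgM (hA' z zw) (cst (rho w x y))))).
  by apply: filterS filterT => m _ /=; apply: hconv.
lra.
Qed.

End AffineFunctions.

(** * Day's criterion for Euclidean norms *)

Section PlaneNorm.
Variables (R : realType) (U : set_system nat).
Hypothesis UU : UltraFilter U.
Hypothesis Uoo : \oo `<=` U.
Let PF : ProperFilter U. Proof. exact: (@ultra_proper _ _ UU). Qed.
#[local] Existing Instance PF.

Record day_norm (n : R -> R -> R) : Prop := DayNorm {
  dn_ge0 : forall x y, 0 <= n x y;
  dn_hom : forall c x y, n (c * x) (c * y) = `|c| * n x y;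
  dn_tri : forall x y x' y', n (x + x') (y + y') <= n x y + n x' y';
  dn_def : forall x y, n x y = 0 -> x = 0 /\ y = 0;
  dn_day : forall x y x' y',
    4 * (n x y * n x' y') <= n (x + x') (y + y') ^+ 2 + n (x - x') (y - y') ^+ 2 }.

(** The ellipse where the form is at most [1] lies inside the unit ball of [n]. A smaller
    determinant [a * c - b ^+ 2] means a larger ellipse, so the dominating form of least determinant
    is the inscribed ellipse of greatest area. *)
Definition dominates (n : R -> R -> R) (a b c : R) : Prop :=
  forall x y, n x y ^+ 2 <= a * x ^+ 2 + 2 * b * (x * y) + c * y ^+ 2.

Lemma bounded_cvg3 (x : nat -> R * R * R) (B : R) :
  (forall k, `|(x k).1.1| <= B /\ `|(x k).1.2| <= B /\ `|(x k).2| <= B) ->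
  exists a b c : R, (x k).1.1 @[k --> U] --> a /\ (x k).1.2 @[k --> U] --> b /\ (x k).2 @[k --> U] --> c.
Proof.
move=> h; have [a ha] := @ultra_bounded_cvg _ _ UU (fun k => (x k).1.1) B (fun k => (h k).1).
have [b hb] := @ultra_bounded_cvg _ _ UU (fun k => (x k).1.2) B (fun k => (h k).2.1).
by have [c hc] := @ultra_bounded_cvg _ _ UU (fun k => (x k).2) B (fun k => (h k).2.2); exists a, b, c.
Qed.

Lemma cvg_sqr (x : nat -> R) (a : R) : x k @[k --> U] --> a -> x k ^+ 2 @[k --> U] --> a ^+ 2.
Proof. by move=> h; rewrite expr2; under eq_fun do rewrite expr2; exact: cvgM. Qed.

Lemma cvg_cstR (c : R) : c @[k --> U] --> c.
Proof. exact: cvg_cst. Qed.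
Arguments cvg_cstR : clear implicits.

Lemma ultra_le (x y : nat -> R) (a b : R) : x k @[k --> U] --> a -> y k @[k --> U] --> b ->
  (forall k, x k <= y k) -> a <= b.
Proof. by move=> xa yb h; apply: (ultra_cvg_le UU xa yb); apply: filterS filterT => k _; exact: h. Qed.

Lemma unit_bound (x y : R) : x ^+ 2 + y ^+ 2 = 1 -> `|x| <= 1 /\ `|y| <= 1.
Proof.
move=> h; rewrite !ler_norml.
have := sqr_ge0 x; have := sqr_ge0 y => h1 h2.
by split; apply/andP; split; nra.
Qed.

Lemma unit_cvg (x y : nat -> R) (a b : R) : x k @[k --> U] --> a -> y k @[k --> U] --> b ->
  (forall k, x k ^+ 2 + y k ^+ 2 = 1) -> a ^+ 2 + b ^+ 2 = 1.
Proof.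
move=> xa yb h; apply: (@ultra_cvg_unique _ _ UU (fun k => x k ^+ 2 + y k ^+ 2)).
  exact: cvgD (cvg_sqr xa) (cvg_sqr yb).
by under eq_fun do rewrite h; exact: cvg_cst.
Qed.

Section Norm.
Variable n : R -> R -> R.
Hypothesis dn : day_norm n.

Lemma dn_lip x y x' y' : `|n x y - n x' y'| <= `|x - x'| * n 1 0 + `|y - y'| * n 0 1.
Proof.
have main a b a' b' : n a b - n a' b' <= `|a - a'| * n 1 0 + `|b - b'| * n 0 1.
  have h1 := dn_tri dn (a - a') (b - b') a' b'; rewrite !subrK in h1.
  have h2 := dn_tri dn ((a - a') * 1) ((a - a') * 0) ((b - b') * 0) ((b - b') * 1).
  rewrite !mulr0 !mulr1 addr0 add0r in h2.
  have h3 := dn_hom dn (a - a') 1 0; have h4 := dn_hom dn (b - b') 0 1.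
  rewrite !mulr0 !mulr1 in h3 h4; rewrite h3 h4 in h2; lra.
rewrite ler_norml; have := main x y x' y'; have := main x' y' x y.
rewrite (distrC x' x) (distrC y' y); lra.
Qed.

Lemma cvg_dn (x y : nat -> R) (a b : R) : x k @[k --> U] --> a -> y k @[k --> U] --> b ->
  n (x k) (y k) @[k --> U] --> n a b.
Proof.
move=> xa yb; apply/(@subr_cvg0 _ _ _ U _).
apply: (@ultra_squeeze0 _ _ UU _ (fun k => `|x k - a| * n 1 0 + `|y k - b| * n 0 1)).
  by apply: filterS filterT => k _; exact: dn_lip.
rewrite [X in _ --> X](_ : _ = 0 * n 1 0 + 0 * n 0 1); last by rewrite !mul0r addr0.
have h (z : nat -> R) (c : R) : z k @[k --> U] --> c -> `|z k - c| @[k --> U] --> (0 : R).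
  move=> zc; rewrite -(normr0 R); apply: cvg_norm; rewrite -(subrr c).
  by apply: cvgB; [|exact: cvg_cst].
by apply: cvgD; (apply: cvgM; [exact: h|exact: cvg_cst]).
Qed.

Lemma unit_scale (P : R -> R -> Prop) x y : (x <> 0 \/ y <> 0) ->
  (forall c, 0 < c -> P (c * x) (c * y)) ->
  exists x' y', x' ^+ 2 + y' ^+ 2 = 1 /\ P x' y'.
Proof.
move=> xy h; pose r := Num.sqrt (x ^+ 2 + y ^+ 2).
have r2 : 0 < x ^+ 2 + y ^+ 2.
  have hx := sqr_ge0 x; have hy := sqr_ge0 y.
  rewrite lt_neqAle addr_ge0 // andbT eq_sym paddr_eq0 //.
  by apply/negP => /andP[]; rewrite !sqrf_eq0 => /eqP ? /eqP ?; case: xy.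
have r0 : 0 < r by rewrite sqrtr_gt0.
exists (r^-1 * x), (r^-1 * y); split; last by apply: h; rewrite invr_gt0.
rewrite !exprMn -mulrDr exprVn /r sqr_sqrtr ?(ltW r2) // mulVf //.
by rewrite gt_eqF.
Qed.

Lemma dn_lower : exists2 c, 0 < c & forall x y, c * (x ^+ 2 + y ^+ 2) <= n x y ^+ 2.
Proof.
apply: contrapT => H.
have /choice[p hp] : forall k : nat, exists p : R * R, p.1 ^+ 2 + p.2 ^+ 2 = 1 /\ n p.1 p.2 ^+ 2 <= k.+1%:R^-1.
  move=> k; apply: contrapT => Hk; apply: H; exists k.+1%:R^-1; first by rewrite invr_gt0 ltr0n.
  move=> x y; rewrite leNgt; apply/negP => lt.
  have [||x' [y' [e l]]] := @unit_scale (fun a b => n a b ^+ 2 < k.+1%:R^-1 * (a ^+ 2 + b ^+ 2)) x y.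
  - apply: contrapT => /not_orP[/contrapT x0 /contrapT y0]; move: lt.
    by rewrite x0 y0 expr0n addr0 mulr0 ltNge sqr_ge0.
  - move=> c c0; rewrite (dn_hom dn) [(`|_| * _) ^+ 2]exprMn real_normK ?num_real //.
    have c2 : 0 < c ^+ 2 by rewrite exprn_gt0.
    by move: lt; move: (k.+1%:R^-1) => e; rewrite -(ltr_pM2l c2); lra.
  by apply: Hk; exists (x', y'); rewrite /= e mulr1 in l *; split; [|exact: ltW].
have [|a [b [c [ha [hb _]]]]] := @bounded_cvg3 (fun k => ((p k).1, (p k).2, 0)) 1.
  by move=> k /=; have [? ?] := unit_bound (hp k).1; rewrite normr0.
rewrite /= in ha hb.
have e1 : a ^+ 2 + b ^+ 2 = 1 := unit_cvg ha hb (fun k => (hp k).1).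
have e2 : n a b ^+ 2 <= 0.
  by apply: (ultra_le (cvg_sqr (cvg_dn ha hb)) (@ultra_harmonic R U Uoo)) => k; exact: (hp k).2.
have : n a b = 0 by apply/eqP; rewrite -sqrf_eq0 eq_le e2 sqr_ge0.
by move=> /(dn_def dn)[a0 b0]; move: e1; rewrite a0 b0 expr0n addr0 => /eqP; rewrite eq_sym oner_eq0.
Qed.

Lemma psd_det (a b c : R) : (forall x y, 0 <= a * x ^+ 2 + 2 * b * (x * y) + c * y ^+ 2) ->
  0 <= a /\ 0 <= c /\ b ^+ 2 <= a * c.
Proof.
move=> h; have a0 : 0 <= a by have := h 1 0; rewrite expr0n expr1n !mulr0 !addr0 mulr1.
have c0 : 0 <= c by have := h 0 1; rewrite expr0n expr1n !mulr0 mul0r !mulr0 !add0r mulr1.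
split=> //; split=> //.
have [a1|a1] := eqVneq a 0; last first.
  have ap : 0 < a by rewrite lt_neqAle eq_sym a1.
  have := h (- b) a.
  rewrite (_ : _ + _ = a * (a * c - b ^+ 2)); last by ring.
  by rewrite pmulr_rge0 // subr_ge0.
suff -> : b = 0 by rewrite expr0n mulr_ge0.
apply/eqP; apply: contrapT => /negP b0.
(* With [a = 0] the form is affine in [x], and this argument gives it the value [-1]. *)
have := h (- (c + 1) / (2 * b)) 1; rewrite a1 (_ : _ + _ = -1); last by field.
by rewrite oppr_ge0 ler10.
Qed.

Lemma min_dominating : exists a b c, dominates n a b c /\ 0 < a * c - b ^+ 2 /\ 0 < a /\
  forall a' b' c', dominates n a' b' c' -> a * c - b ^+ 2 <= a' * c' - b' ^+ 2.
Proof.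
have [c0 c00 low] := dn_lower.
(* The form minus [c0 * (x ^+ 2 + y ^+ 2)] is still nonnegative; its determinant inequality bounds
   [a + c] in terms of the determinant of the form. *)
have det a b c : dominates n a b c -> 0 < a /\ 0 < c /\ b ^+ 2 <= a * c /\ c0 * (a + c) <= a * c - b ^+ 2 + c0 ^+ 2.
  move=> h; have [|h1 [h2 h3]] := @psd_det (a - c0) b (c - c0).
    move=> x y; have := h x y; have := low x y; nra.
  by have := sqr_ge0 b; do !split; nra.
pose E := [set m | exists a b c, dominates n a b c /\ m = a * c - b ^+ 2].
have domE : exists a b c, dominates n a b c.
  (* From [n x y <= |x| * n 1 0 + |y| * n 0 1] and [(p + q) ^+ 2 <= 2 * p ^+ 2 + 2 * q ^+ 2]. *)
  exists (2 * n 1 0 ^+ 2), 0, (2 * n 0 1 ^+ 2) => x y.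
  have h := dn_lip x y 0 0; have := dn_hom dn 0 0 0; rewrite !mul0r normr0 mul0r => n0.
  rewrite n0 !subr0 ger0_norm ?(dn_ge0 dn) // in h.
  have := dn_ge0 dn x y => n1.
  have h' : n x y ^+ 2 <= (`|x| * n 1 0 + `|y| * n 0 1) ^+ 2.
    by rewrite ler_sqr // nnegrE ?addr_ge0 ?mulr_ge0 ?(dn_ge0 dn).
  have := sqr_ge0 (`|x| * n 1 0 - `|y| * n 0 1).
  rewrite -(real_normK (num_real x)) -(real_normK (num_real y)); nra.
have Einf : has_inf E.
  split; first by have [a [b [c h]]] := domE; exists (a * c - b ^+ 2), a, b, c.
  by exists 0 => m [a [b [c [h ->]]]]; have [_ [_ []]] := det _ _ _ h; lra.
have /choice[p hp] : forall k : nat, exists p : R * R * R, dominates n p.1.1 p.1.2 p.2 /\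
    p.1.1 * p.2 - p.1.2 ^+ 2 <= inf E + k.+1%:R^-1.
  move=> k; have e0 : 0 < k.+1%:R^-1 :> R by rewrite invr_gt0 ltr0n.
  have [m [a [b [c [h ->]]]] lt] := inf_adherent e0 Einf.
  by exists (a, b, c); split=> //; exact: ltW.
(* [inf E + 1] bounds the determinants along the minimizing sequence, and [det] turns this into a
   bound on the coefficients. *)
pose M := (inf E + 1 + c0 ^+ 2) / c0 + 1.
have [|a [b [c [ha [hb hc]]]]] := @bounded_cvg3 p M.
  move=> k; have [dk lk] := hp k; have [h1 [h2 [h3 h4]]] := det _ _ _ dk.
  have k1 : k.+1%:R^-1 <= 1 :> R by rewrite invf_le1 ?ltr0n // ler1n.
  move: (k.+1%:R^-1) lk k1 => e lk k1.
  have h5 : (p k).1.1 + (p k).2 <= M - 1.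
    by rewrite /M addrK ler_pdivlMr // mulrC; lra.
  have h6 : 0 < M by lra.
  have h7 : `|(p k).1.2| <= M.
    rewrite -ler_sqr ?nnegrE ?(ltW h6) // real_normK ?num_real //; apply: le_trans h3 _.
    have := sqr_ge0 ((p k).1.1 - (p k).2); have := sqr_ge0 M.
    have : ((p k).1.1 + (p k).2) ^+ 2 <= M ^+ 2 by rewrite ler_sqr ?nnegrE; lra.
    lra.
  by rewrite (gtr0_norm h1) (gtr0_norm h2); split; [|split=> //]; lra.
have dom : dominates n a b c.
  move=> x y; pose f k := (p k).1.1 * x ^+ 2 + 2 * (p k).1.2 * (x * y) + (p k).2 * y ^+ 2.
  have cf : f k @[k --> U] --> a * x ^+ 2 + 2 * b * (x * y) + c * y ^+ 2.
    apply: cvgD; last by apply: cvgM => //; exact: cvg_cst.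
    apply: cvgD; first by apply: cvgM => //; exact: cvg_cst.
    by apply: cvgM; [apply: cvgM => //|]; exact: cvg_cst.
  by apply: (ultra_le (cvg_cstR (n x y ^+ 2)) cf) => k; exact: (hp k).1.
have [a0 [c1 _]] := det _ _ _ dom.
have inf_le a' b' c' : dominates n a' b' c' -> inf E <= a' * c' - b' ^+ 2.
  by move=> h; apply: ge_inf; [exact: Einf.2|exists a', b', c'].
have le_inf : a * c - b ^+ 2 <= inf E.
  rewrite -[leRHS]addr0; apply: (ultra_le (cvgB (cvgM ha hc) (cvg_sqr hb))
    (cvgD (cvg_cstR (inf E)) (@ultra_harmonic R U Uoo))) => k; exact: (hp k).2.
exists a, b, c; split=> //; split.
  have [x y|h1 [h2 h3]] := @psd_det (a - c0) b (c - c0); last by nra.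
  by have := dom x y; have := low x y; nra.
by split=> // a' b' c' /inf_le; lra.
Qed.

End Norm.

Section Contact.
Variable n : R -> R -> R.
Hypothesis dn : day_norm n.
Hypothesis n_le : dominates n 1 0 1.
Hypothesis n_min : forall a b c, dominates n a b c -> 1 <= a * c - b ^+ 2.

Definition contact (x y : R) : Prop := n x y ^+ 2 = x ^+ 2 + y ^+ 2.

Lemma n_le1 x y : n x y ^+ 2 <= x ^+ 2 + y ^+ 2.
Proof. by have := n_le x y; rewrite mulr0 mul0r addr0 !mul1r. Qed.

Lemma contact_scale c x y : contact x y -> contact (c * x) (c * y).
Proof. by rewrite /contact (dn_hom dn) !exprMn => ->; rewrite real_normK ?num_real // mulrDr. Qed.

Lemma contact_unscale c x y : c != 0 -> contact (c * x) (c * y) -> contact x y.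
Proof. by move=> c0 /(contact_scale c^-1); rewrite !mulKf. Qed.

(** The squared norms of sum and difference add up to at least [4] by Day's inequality and to at
    most [4] by domination, so neither can be smaller than its bound. *)
Lemma contact_add x y x' y' : x ^+ 2 + y ^+ 2 = 1 -> x' ^+ 2 + y' ^+ 2 = 1 ->
  contact x y -> contact x' y' -> contact (x + x') (y + y').
Proof.
rewrite /contact => u u' c c'; rewrite u in c; rewrite u' in c'.
have n1 a b : n a b ^+ 2 = 1 -> n a b = 1.
  by move=> h; apply/eqP; rewrite -(eqrXn2 (n := 2)) ?(dn_ge0 dn) // h expr1n.
have := dn_day dn x y x' y'; rewrite (n1 _ _ c) (n1 _ _ c').
have := n_le1 (x + x') (y + y'); have := n_le1 (x - x') (y - y'); lra.
Qed.

(* The form [X^2 + Y^2 + e (X^2 - 2 Y^2)] has smaller determinant, hence fails to dominate. *)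
Lemma contact_transverse (al be : R) : al ^+ 2 + be ^+ 2 = 1 ->
  exists x y, x ^+ 2 + y ^+ 2 = 1 /\ contact x y /\
    (al * x + be * y) ^+ 2 <= 2 * (al * y - be * x) ^+ 2.
Proof.
move=> ab.
have /choice[p hp] : forall k : nat, exists p : R * R, p.1 ^+ 2 + p.2 ^+ 2 = 1 /\
    (al * p.1 + be * p.2) ^+ 2 <= 2 * (al * p.2 - be * p.1) ^+ 2 /\ 1 - 2 * k.+1%:R^-1 <= n p.1 p.2 ^+ 2.
  move=> k; set e : R := k.+1%:R^-1.
  have e0 : 0 < e by rewrite invr_gt0 ltr0n.
  apply: contrapT => Hk.
  have : dominates n (1 + e * (al ^+ 2 - 2 * be ^+ 2)) (3 * e * (al * be)) (1 + e * (be ^+ 2 - 2 * al ^+ 2)).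
    move=> x y; rewrite leNgt; apply/negP => lt.
    have [||x' [y' [u l]]] := @unit_scale (fun x y => (1 + e * (al ^+ 2 - 2 * be ^+ 2)) * x ^+ 2 +
       2 * (3 * e * (al * be)) * (x * y) + (1 + e * (be ^+ 2 - 2 * al ^+ 2)) * y ^+ 2 < n x y ^+ 2) x y.
    - apply: contrapT => /not_orP[/contrapT x0 /contrapT y0]; move: lt.
      rewrite x0 y0; have := dn_hom dn 0 0 0; rewrite !mul0r normr0 mul0r => ->.
      by rewrite expr0n !mulr0 !addr0 ltxx.
    - move=> c c0; rewrite (dn_hom dn) [(`|_| * _) ^+ 2]exprMn real_normK ?num_real //.
      have c2 : 0 < c ^+ 2 by rewrite exprn_gt0.
      by have := lt; rewrite -(ltr_pM2l c2); lra.
    have l' : 1 + e * ((al * x' + be * y') ^+ 2 - 2 * (al * y' - be * x') ^+ 2) < n x' y' ^+ 2.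
      apply: le_lt_trans l; rewrite -{1}u le_eqVlt; apply/orP; left; apply/eqP; ring.
    have := n_le1 x' y'; rewrite u => l1.
    apply: Hk; exists (x', y'); split=> //=; split.
      have : e * ((al * x' + be * y') ^+ 2 - 2 * (al * y' - be * x') ^+ 2) < 0 by lra.
      by rewrite pmulr_rlt0 //; lra.
    have h : (al * y' - be * x') ^+ 2 <= 1.
      have := sqr_ge0 (al * x' + be * y').
      have : (al * x' + be * y') ^+ 2 + (al * y' - be * x') ^+ 2 = (al ^+ 2 + be ^+ 2) * (x' ^+ 2 + y' ^+ 2) by ring.
      by rewrite ab u; lra.
    have := sqr_ge0 (al * x' + be * y'); nra.
  move=> /n_min.
  rewrite (_ : _ - _ = 1 - e * (al ^+ 2 + be ^+ 2) - 2 * e ^+ 2 * (al ^+ 2 + be ^+ 2) ^+ 2); last by ring.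
  by rewrite ab; nra.
have [|a [b [c [ha [hb _]]]]] := @bounded_cvg3 (fun k => ((p k).1, (p k).2, 0)) 1.
  by move=> k /=; have [? ?] := unit_bound (hp k).1; rewrite normr0.
rewrite /= in ha hb; exists a, b.
have e1 : a ^+ 2 + b ^+ 2 = 1 := unit_cvg ha hb (fun k => (hp k).1).
split=> //; split.
  rewrite /contact; apply/eqP; rewrite eq_le n_le1 e1 /=.
  rewrite -[leLHS]subr0 -(mulr0 2); apply: (ultra_le
    (cvgB (cvg_cstR 1) (cvgM (cvg_cstR 2) (@ultra_harmonic R U Uoo))) (cvg_sqr (cvg_dn dn ha hb))).
  by move=> k; exact: (hp k).2.2.
have ca := cvg_cstR al; have cb := cvg_cstR be.
apply: (ultra_le (cvg_sqr (cvgD (cvgM ca ha) (cvgM cb hb)))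
  (cvgM (cvg_cstR 2) (cvg_sqr (cvgB (cvgM ca hb) (cvgM cb ha))))).
by move=> k; exact: (hp k).2.1.
Qed.

(* Among the contact pairs enclosing a direction, one with maximal scalar product is degenerate,
   since otherwise its bisector does better. *)
Lemma contact_unit p q : p ^+ 2 + q ^+ 2 = 1 -> contact p q.
Proof.
move=> pq.
pose good (u : R * R * (R * R)) := [/\ u.1.1 ^+ 2 + u.1.2 ^+ 2 = 1 /\ u.2.1 ^+ 2 + u.2.2 ^+ 2 = 1,
  contact u.1.1 u.1.2, contact u.2.1 u.2.2,
  0 <= u.1.1 * q - u.1.2 * p & 0 <= p * u.2.2 - q * u.2.1].
pose sc (u : R * R * (R * R)) := u.1.1 * u.2.1 + u.1.2 * u.2.2.
have sc1 u : good u -> sc u <= 1.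
  case=> [[h1 h2] _ _ _ _]; have := sqr_ge0 (u.1.1 - u.2.1); have := sqr_ge0 (u.1.2 - u.2.2).
  rewrite /sc; nra.
have [a1 [b1 [u1 [c1 _]]]] := @contact_transverse 1 0 ltac:(by rewrite expr1n expr0n addr0).
have [a2 [b2 [u2 [c2 t2]]]] := contact_transverse u1.
have cN x y : contact x y -> contact (- x) (- y) by move=> /(contact_scale (-1)); rewrite !mulN1r.
(* The second contact vector is transverse to the first, so with suitable signs the two enclose
   [(p, q)] without being opposite. *)
have [w1 [g1 sc1']] : exists w, good w /\ -1 < sc w.
  have tr : (a1 * a2 + b1 * b2) ^+ 2 < 1.
    have : (a1 * a2 + b1 * b2) ^+ 2 + (a1 * b2 - b1 * a2) ^+ 2 = (a1 ^+ 2 + b1 ^+ 2) * (a2 ^+ 2 + b2 ^+ 2) by ring.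
    by rewrite u1 u2; lra.
  have s1 : exists x y, [/\ x ^+ 2 + y ^+ 2 = 1, contact x y, 0 <= x * q - y * p & x * a2 + y * b2 = a1 * a2 + b1 * b2 \/ x * a2 + y * b2 = - (a1 * a2 + b1 * b2)].
    have [h|h] := lerP 0 (a1 * q - b1 * p); first by exists a1, b1; split=> //; left.
    by exists (- a1), (- b1); rewrite !sqrrN; split; [|exact: cN|lra|right; ring].
  have [x [y [xu xc x0 xs]]] := s1.
  have ts : (x * a2 + y * b2) ^+ 2 < 1 by case: xs => ->; rewrite ?sqrrN.
  have [h|h] := lerP 0 (p * b2 - q * a2).
    exists (x, y, (a2, b2)); split; first by split.
    by rewrite /sc /=; nra.
  exists (x, y, (- a2, - b2)); split; first by split=> //=; [rewrite !sqrrN|exact: cN|lra].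
  by rewrite /sc /=; nra.
pose E := [set s | exists2 u, good u & s = sc u].
have Esup : has_sup E.
  split; first by exists (sc w1), w1.
  by exists 1 => s [u gu ->]; exact: sc1.
have /choice[u hu] : forall k : nat, exists u, good u /\ sup E - k.+1%:R^-1 <= sc u.
  move=> k; have e0 : 0 < k.+1%:R^-1 :> R by rewrite invr_gt0 ltr0n.
  by have [s [u gu ->] lt] := sup_adherent e0 Esup; exists u; split=> //; exact: ltW.
have [|a [b [c [ha [hb hc]]]]] := @bounded_cvg3 (fun k => ((u k).1.1, (u k).1.2, (u k).2.1)) 1.
  by move=> k /=; have [[[h1 h2] _ _ _ _] _] := hu k; have [? ?] := unit_bound h1; have [? ?] := unit_bound h2.
have [|d [_ [_ [hd _]]]] := @bounded_cvg3 (fun k => ((u k).2.2, 0, 0)) 1.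
  by move=> k /=; have [[[h1 h2] _ _ _ _] _] := hu k; have [? ?] := unit_bound h2; rewrite normr0.
rewrite /= in ha hb hc hd.
have unitlim (x y : nat -> R) (x0 y0 : R) : x k @[k --> U] --> x0 -> y k @[k --> U] --> y0 ->
   (forall k, x k ^+ 2 + y k ^+ 2 = 1 /\ contact (x k) (y k)) -> x0 ^+ 2 + y0 ^+ 2 = 1 /\ contact x0 y0.
  move=> cx cy h.
  have e1 : x0 ^+ 2 + y0 ^+ 2 = 1 := unit_cvg cx cy (fun k => (h k).1).
  split=> //; rewrite /contact e1; apply: (ultra_cvg_unique UU (cvg_sqr (cvg_dn dn cx cy))).
  by under eq_fun do rewrite (h _).2 (h _).1; exact: cvg_cst.
have [uab cab] := unitlim _ _ _ _ ha hb (fun k => let: conj (And5 (conj h1 h2) h3 h4 _ _) _ := hu k in conj h1 h3).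
have [ucd ccd] := unitlim _ _ _ _ hc hd (fun k => let: conj (And5 (conj h1 h2) h3 h4 _ _) _ := hu k in conj h2 h4).
have cp := cvg_cstR p; have cq := cvg_cstR q.
have s1 : 0 <= a * q - b * p.
  by apply: (ultra_le (cvg_cstR 0) (cvgB (cvgM ha cq) (cvgM hb cp))) => k; have [[_ _ _ h _] _] := hu k.
have s2 : 0 <= p * d - q * c.
  by apply: (ultra_le (cvg_cstR 0) (cvgB (cvgM cp hd) (cvgM cq hc))) => k; have [[_ _ _ _ h] _] := hu k.
have supE : sup E <= a * c + b * d.
  rewrite -[leLHS]subr0; apply: (ultra_le (cvgB (cvg_cstR (sup E)) (@ultra_harmonic R U Uoo))
    (cvgD (cvgM ha hc) (cvgM hb hd))) => k; exact: (hu k).2.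
have supge v : good v -> sc v <= sup E by move=> gv; apply: ub_le_sup; [exact: Esup.2|exists v].
set s := a * c + b * d in supE.
have sm1 : -1 < s by have := supge _ g1; lra.
have [s_eq|s_ne] := eqVneq s 1.
  (* If the two unit vectors coincide, then enclosing [(p, q)] forces them to be parallel to it. *)
  have ac : (a - c) ^+ 2 + (b - d) ^+ 2 = 0.
    rewrite (_ : _ + _ = (a ^+ 2 + b ^+ 2) + (c ^+ 2 + d ^+ 2) - 2 * s); last by rewrite /s; ring.
    by rewrite uab ucd s_eq; lra.
  move/eqP: ac; rewrite paddr_eq0 ?sqr_ge0 // !sqrf_eq0 !subr_eq0 => /andP[/eqP e1 /eqP e2].
  rewrite -e1 -e2 in s2.
  have z : a * q - b * p = 0 by lra.
  have E1 : p = (a * p + b * q) * a.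
    have : p = p * (a ^+ 2 + b ^+ 2) by rewrite uab mulr1.
    have : (a * q - b * p) * b = 0 by rewrite z mul0r.
    lra.
  have E2 : q = (a * p + b * q) * b.
    have : q = q * (a ^+ 2 + b ^+ 2) by rewrite uab mulr1.
    have : (a * q - b * p) * a = 0 by rewrite z mul0r.
    lra.
  by have := contact_scale (a * p + b * q) cab; rewrite -E1 -E2.
have s1' : s < 1 by rewrite lt_neqAle s_ne /=; apply: (sc1 (a, b, (c, d))); split.
(* [r] is the length of the sum of the two vectors, so [(mx, my)] is their unit bisector. *)
pose r := Num.sqrt (2 + 2 * s).
have r2 : r ^+ 2 = 2 + 2 * s by rewrite sqr_sqrtr //; lra.
have r0 : 0 < r by rewrite sqrtr_gt0; lra.
have rn : r != 0 by rewrite gt_eqF.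
pose mx := r^-1 * (a + c); pose my := r^-1 * (b + d).
have um : mx ^+ 2 + my ^+ 2 = 1.
  rewrite /mx /my !exprMn -mulrDr exprVn r2.
  rewrite [(a + c) ^+ 2 + _](_ : _ = (a ^+ 2 + b ^+ 2) + (c ^+ 2 + d ^+ 2) + 2 * s); last by rewrite /s; ring.
  rewrite uab ucd mulVf //; apply/eqP; lra.
have cm : contact mx my by apply: contact_scale; exact: contact_add.
(* The bisector has scalar product [(1 + s) / r], the square root of [(1 + s) / 2], with either
   vector. *)
have bet : s < r^-1 * (1 + s).
  rewrite mulrC ltr_pdivlMr //.
  have [s0|s0] := lerP s 0.
    have : s * r <= 0 by rewrite pmulr_lle0.
    lra.
  have sr0 : 0 <= s * r by rewrite mulr_ge0 ?ltW.
  have sp : 0 <= 1 + s by lra.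
  rewrite -ltr_sqr ?nnegrE // exprMn r2.
  have : s ^+ 2 * (1 + s) < 1 * (1 + s) by rewrite ltr_pM2r; nra.
  nra.
have [h|h] := lerP 0 (mx * q - my * p).
  have : sc (mx, my, (c, d)) <= sup E by apply: supge; split.
  rewrite /sc /=; have -> : mx * c + my * d = r^-1 * (s + (c ^+ 2 + d ^+ 2)) by rewrite /mx /my /s; ring.
  by rewrite ucd [s + 1]addrC; lra.
have : sc (a, b, (mx, my)) <= sup E by apply: supge; split=> //=; lra.
rewrite /sc /=; have -> : a * mx + b * my = r^-1 * ((a ^+ 2 + b ^+ 2) + s) by rewrite /mx /my /s; ring.
by rewrite uab; lra.
Qed.

Lemma contact_all x y : contact x y.
Proof.
have [h|] := pselect (x <> 0 \/ y <> 0); last first.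
  move=> /not_orP[/contrapT -> /contrapT ->]; rewrite /contact.
  by have := dn_hom dn 0 0 0; rewrite !mul0r normr0 mul0r => ->; rewrite expr0n addr0.
pose P a b := exists2 c, c != 0 & a = c * x /\ b = c * y.
have [|x' [y' [u [c c0 [ex ey]]]]] := @unit_scale P x y h.
  by move=> c c0; exists c; rewrite ?gt_eqF.
by apply: (contact_unscale c0); rewrite -ex -ey; exact: contact_unit.
Qed.

End Contact.

Lemma day_quadratic (n : R -> R -> R) : day_norm n ->
  exists a b c, forall x y, n x y ^+ 2 = a * x ^+ 2 + 2 * b * (x * y) + c * y ^+ 2.
Proof.
move=> dn; have [a [b [c [dom [det0 [a0 mn]]]]]] := min_dominating dn.
exists a, b, c => x y.
set D := a * c - b ^+ 2 in det0 mn.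
pose al := Num.sqrt a; pose ga := Num.sqrt (D / a).
have al2 : al ^+ 2 = a by rewrite sqr_sqrtr // ltW.
have ga2 : ga ^+ 2 = D / a by rewrite sqr_sqrtr // divr_ge0 // ltW.
have al0 : 0 < al by rewrite sqrtr_gt0.
have ga0 : 0 < ga by rewrite sqrtr_gt0 divr_gt0.
have an : al != 0 by rewrite gt_eqF.
have gn : ga != 0 by rewrite gt_eqF.
(* [s = al * (x + b y / a)], [t = ga * y] are orthonormal coordinates for the minimal form. *)
pose X s t := s / al - b / a * (t / ga); pose Y (t : R) := t / ga.
pose m s t := n (X s t) (Y t).
have dm : day_norm m.
  split.
  - by move=> *; exact: dn_ge0 dn _ _.
  - move=> k s t; rewrite /m -(dn_hom dn); congr n; rewrite /X /Y; ring.
  - move=> s t s' t'; rewrite /m; apply: le_trans (dn_tri dn _ _ _ _); rewrite le_eqVlt; apply/orP; left.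
    by apply/eqP; congr n; rewrite /X /Y; ring.
  - move=> s t /(dn_def dn)[]; rewrite /X /Y => h1 /eqP; rewrite mulf_eq0 invr_eq0 (negbTE gn) orbF => /eqP t0.
    by move: h1; rewrite t0 mul0r mulr0 subr0 => /eqP; rewrite mulf_eq0 invr_eq0 (negbTE an) orbF => /eqP.
  - move=> s t s' t'; have := dn_day dn (X s t) (Y t) (X s' t') (Y t').
    rewrite /m; congr (_ <= n _ _ ^+ 2 + n _ _ ^+ 2); rewrite /X /Y; ring.
have q0 s t : a * X s t ^+ 2 + 2 * b * (X s t * Y t) + c * Y t ^+ 2 = s ^+ 2 + t ^+ 2.
  have -> : c = (D + b ^+ 2) / a by rewrite /D; field; rewrite gt_eqF.
  have -> : t ^+ 2 = Y t ^+ 2 * (D / a) by rewrite -ga2 -exprMn /Y divfK.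
  have -> : s ^+ 2 = (X s t + b / a * Y t) ^+ 2 * a.
    by rewrite /X /Y subrK expr_div_n al2 divfK // gt_eqF.
  by field; rewrite gt_eqF.
have md : dominates m 1 0 1.
  by move=> s t; rewrite mulr0 mul0r addr0 !mul1r -q0; exact: dom.
have mm a' b' c' : dominates m a' b' c' -> 1 <= a' * c' - b' ^+ 2.
  move=> h.
  (* The form pulled back to the old coordinates dominates [n], and its determinant is multiplied by
     [al ^+ 2 * ga ^+ 2 = D]. *)
  have : dominates n (a' * al ^+ 2) (a' * al ^+ 2 * (b / a) + b' * (al * ga))
      (a' * (al * (b / a)) ^+ 2 + 2 * b' * (al * (b / a)) * ga + c' * ga ^+ 2).
    move=> x' y'; have := h (al * (x' + b / a * y')) (ga * y').
    rewrite /m; have -> : X (al * (x' + b / a * y')) (ga * y') = x' by rewrite /X; field; rewrite an gn gt_eqF.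
    have -> : Y (ga * y') = y' by rewrite /Y mulrC mulKf.
    by move=> /le_trans; apply; rewrite le_eqVlt; apply/orP; left; apply/eqP; ring.
  move=> /mn; rewrite (_ : _ - _ ^+ 2 = al ^+ 2 * ga ^+ 2 * (a' * c' - b' ^+ 2)); last by ring.
  by rewrite al2 ga2 [a * _]mulrC divfK ?gt_eqF // -[leLHS]mulr1 ler_pM2l.
have := contact_all dm md mm (al * (x + b / a * y)) (ga * y).
rewrite /contact /m -q0.
have -> : X (al * (x + b / a * y)) (ga * y) = x by rewrite /X; field; rewrite an gn gt_eqF.
by have -> : Y (ga * y) = y by rewrite /Y mulrC mulKf.
Qed.

End PlaneNorm.

(** * From planes to row vectors: polarization and Gram-Schmidt *)

Section RowNorm.
Variables (R : realType) (U : set_system nat).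
Hypothesis UU : UltraFilter U.
Hypothesis Uoo : \oo `<=` U.

Definition nrm2 (k : nat) (c : 'rV[R]_k) : R := \sum_(i < k) c ord0 i ^+ 2.

Record row_norm (k : nat) (N : 'rV[R]_k -> R) : Prop := RowNorm {
  rn_ge0 : forall u, 0 <= N u;
  rn_hom : forall c u, N (c *: u) = `|c| * N u;
  rn_tri : forall u v, N (u + v) <= N u + N v;
  rn_def : forall u, N u = 0 -> u = 0 }.

Definition day_ineq (k : nat) (N : 'rV[R]_k -> R) : Prop :=
  forall u v, 4 * (N u * N v) <= N (u + v) ^+ 2 + N (u - v) ^+ 2.

Lemma plane_quadratic k (N : 'rV[R]_k -> R) : row_norm N -> day_ineq N -> forall u v,
  exists b, forall s t, N (s *: u + t *: v) ^+ 2 = s ^+ 2 * N u ^+ 2 + 2 * b * (s * t) + t ^+ 2 * N v ^+ 2.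
Proof.
move=> rn dy u v.
have hom2 c w : N (c *: w) ^+ 2 = c ^+ 2 * N w ^+ 2.
  by rewrite (rn_hom rn) exprMn real_normK ?num_real.
have [[l ul]|indep] := pselect (exists l, u = l *: v).
  exists (l * N v ^+ 2) => s t.
  by rewrite ul scalerA -scalerDl !hom2; ring.
have [v0|v0] := pselect (v = 0).
  have N0 : N 0 ^+ 2 = 0 by have := hom2 0 u; rewrite scale0r expr0n mul0r.
  by exists 0 => s t; rewrite v0 scaler0 addr0 hom2 N0; ring.
pose n s t := N (s *: u + t *: v).
have dn : day_norm n.
  split.
  - by move=> *; exact: rn_ge0 rn _.
  - by move=> c x y; rewrite /n -(rn_hom rn) scalerDr !scalerA.
  - move=> x y x' y'; apply: le_trans (rn_tri rn _ _).
    by rewrite /n !scalerDl addrACA.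
  - move=> x y /(rn_def rn) h.
    have x0 : x = 0.
      apply: contrapT => /eqP x0; apply: indep; exists (- (y / x)).
      apply: (scalerI x0); rewrite scalerA mulrN mulrC divfK // scaleNr.
      by apply/eqP; rewrite -addr_eq0 h.
    split=> //; apply: contrapT => /eqP y0; apply: v0.
    by move: h; rewrite x0 scale0r add0r => /eqP; rewrite scaler_eq0 (negbTE y0) => /eqP.
  - move=> x y x' y'; have := dy (x *: u + y *: v) (x' *: u + y' *: v).
    have -> : (x *: u + y *: v) + (x' *: u + y' *: v) = (x + x') *: u + (y + y') *: v.
      by rewrite !scalerDl addrACA.
    have -> // : (x *: u + y *: v) - (x' *: u + y' *: v) = (x - x') *: u + (y - y') *: v.
    by rewrite !scalerBl opprD addrACA.
have [a [b [c h]]] := day_quadratic UU Uoo dn.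
exists b => s t; have := h s t; rewrite /n => ->.
have -> : N u = n 1 0 by rewrite /n scale1r scale0r addr0.
have -> : N v = n 0 1 by rewrite /n scale1r scale0r add0r.
by rewrite !h; ring.
Qed.

Section Polar.
Variables (k : nat) (N : 'rV[R]_k -> R).
Hypotheses (rn : row_norm N) (dy : day_ineq N).

Definition polar (u v : 'rV[R]_k) : R := (N (u + v) ^+ 2 - N u ^+ 2 - N v ^+ 2) / 2.

Lemma parallelogram u v : N (u + v) ^+ 2 + N (u - v) ^+ 2 = 2 * N u ^+ 2 + 2 * N v ^+ 2.
Proof.
have [b h] := plane_quadratic rn dy u v.
have := h 1 1; have := h 1 (-1); rewrite !scale1r scaleN1r => -> ->; ring.
Qed.

(** The Jordan-von Neumann computation: a linear combination of four parallelogram identities. *)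
Lemma polarD u v w : polar (u + v) w = polar u w + polar v w.
Proof.
have h1 := parallelogram (u + w) v; have h2 := parallelogram u (w - v).
have h3 := parallelogram (u + v) w; have h4 := parallelogram w v.
have e1 : u + (w - v) = u + w - v by rewrite addrA.
have e2 : u - (w - v) = u + v - w by rewrite opprB addrA.
rewrite [u + w + v]addrAC in h1; rewrite e1 e2 in h2; rewrite [w + v]addrC in h4.
rewrite /polar; lra.
Qed.

(** [N ^+ 2] is already a quadratic form on each plane, so real scalars are handled without the
    classical passage through rational ones. *)
Lemma polarZ c u v : polar (c *: u) v = c * polar u v.
Proof.
have [b h] := plane_quadratic rn dy u v; rewrite /polar.
have := h c 1; have := h 1 1; rewrite !scale1r => -> ->.
by rewrite (rn_hom rn) exprMn real_normK ?num_real //; field.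
Qed.

Lemma polarC u v : polar u v = polar v u.
Proof. by rewrite /polar [v + u]addrC; ring. Qed.

Lemma polar_expand c u v : N (c *: u + v) ^+ 2 = c ^+ 2 * N u ^+ 2 + 2 * c * polar u v + N v ^+ 2.
Proof.
have [b h] := plane_quadratic rn dy u v; rewrite /polar.
have := h c 1; have := h 1 1; by rewrite !scale1r => -> ->; field.
Qed.

End Polar.

Lemma nrm2_row_mx k (a : 'rV[R]_1) (c : 'rV[R]_k) : nrm2 (row_mx a c : 'rV_(1 + k)) = a ord0 ord0 ^+ 2 + nrm2 c.
Proof.
rewrite /nrm2 big_split_ord big_ord1; congr (_ + _); first by rewrite row_mxEl.
by apply: eq_bigr => i _; rewrite row_mxEr.
Qed.

Lemma row_norm_comp k l (N : 'rV[R]_l -> R) (f : 'rV[R]_k -> 'rV[R]_l) :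
  (forall c u v, f (c *: u + v) = c *: f u + f v) -> (forall u, f u = 0 -> u = 0) ->
  row_norm N -> day_ineq N -> row_norm (N \o f) /\ day_ineq (N \o f).
Proof.
move=> lin inj rn dy.
have fD u v : f (u + v) = f u + f v by rewrite -[u]scale1r lin !scale1r.
have f0 : f 0 = 0 by have := fD 0 0; rewrite addr0 => /(congr1 (fun x => x - f 0)); rewrite subrr addrK.
have fZ c u : f (c *: u) = c *: f u by rewrite -[c *: u]addr0 lin f0 addr0.
have fB u v : f (u - v) = f u - f v by rewrite fD -scaleN1r fZ scaleN1r.
split; last by move=> u v; rewrite /= fD fB; exact: dy.
split=> /=.
- by move=> u; exact: rn_ge0 rn _.
- by move=> c u; rewrite fZ; exact: rn_hom rn _ _.
- by move=> u v; rewrite fD; exact: rn_tri rn _ _.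
- by move=> u /(rn_def rn)/inj.
Qed.

(** Gram-Schmidt by induction: [h c] is [j c] minus its polar projection to [e], hence [N (a *: e +
    j c) ^+ 2 = g * (a + L c / g) ^+ 2 + N (h c) ^+ 2], and the induction hypothesis applies to
    [N \o h]. *)
Lemma euclidean_norm k (N : 'rV[R]_k -> R) : row_norm N -> day_ineq N ->
  exists f g : 'rV[R]_k -> 'rV[R]_k, (forall c u v, f (c *: u + v) = c *: f u + f v) /\
    cancel f g /\ cancel g f /\ forall u, N u ^+ 2 = nrm2 (f u).
Proof.
elim: k N => [|k IH] N rn dy.
  exists id, id; split=> //; split=> //; split=> // u.
  rewrite (thinmx0 u) /nrm2 big_ord0.
  by rewrite -(scale0r (0 : 'rV[R]_0)) (rn_hom rn) normr0 mul0r expr0n.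
rewrite -[k.+1]/(1 + k)%N in N rn dy *.
pose e : 'rV[R]_(1 + k) := row_mx (1%:M) 0.
pose j (c : 'rV[R]_k) : 'rV[R]_(1 + k) := row_mx 0 c.
have jlin s u v : j (s *: u + v) = s *: j u + j v.
  by rewrite /j scale_row_mx add_row_mx scaler0 addr0.
pose L c := polar N e (j c).
have Llin s u v : L (s *: u + v) = s * L u + L v.
  by rewrite /L jlin polarC (polarD rn dy) (polarZ rn dy) !(polarC N _ e).
pose g := N e ^+ 2.
have g0 : 0 < g.
  rewrite exprn_gt0 // lt_neqAle (rn_ge0 rn) andbT eq_sym; apply/eqP => /(rn_def rn) h.
  have := congr1 (fun m : 'rV[R]_(1 + k) => lsubmx m ord0 ord0) h.
  rewrite row_mxKl !mxE eqxx; exact/eqP/oner_neq0.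
have gn : g != 0 by rewrite gt_eqF.
pose h (c : 'rV[R]_k) := - (L c / g) *: e + j c.
have hlin s u v : h (s *: u + v) = s *: h u + h v.
  rewrite /h jlin Llin scalerDr scalerA addrACA -scalerDl; congr (_ *: _ + _); ring.
have rh c : rsubmx (h c) = c.
  by rewrite /h scale_row_mx add_row_mx row_mxKr scaler0 add0r.
have hinj c : h c = 0 -> c = 0.
  by move=> hc; rewrite -[c]rh hc; apply/matrixP => x y; rewrite !mxE.
have [rn' dy'] := row_norm_comp hlin hinj rn dy.
have [f [f' [flin [ff' [f'f fN]]]]] := IH _ rn' dy'.
pose sg := Num.sqrt g.
have sg2 : sg ^+ 2 = g by rewrite sqr_sqrtr // ltW.
have sgn : sg != 0 by rewrite sqrtr_eq0 -ltNge.
pose F (c : 'rV[R]_(1 + k)) : 'rV[R]_(1 + k) :=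
  row_mx ((sg * (lsubmx c ord0 ord0 + L (rsubmx c) / g))%:M) (f (rsubmx c)).
pose G (c : 'rV[R]_(1 + k)) : 'rV[R]_(1 + k) :=
  row_mx ((lsubmx c ord0 ord0 / sg - L (f' (rsubmx c)) / g)%:M) (f' (rsubmx c)).
have s11 (a : 'rV[R]_1) : (a ord0 ord0)%:M = a.
  by apply/matrixP => x y; rewrite !ord1 !mxE eqxx mulr1n.
exists F, G; split; [|split; [|split]].
- move=> s u v; rewrite /F !linearP /= flin Llin scale_row_mx add_row_mx; congr row_mx.
  by apply/matrixP => x y; rewrite !ord1 !mxE eqxx !mulr1n; ring.
- move=> c; rewrite /F /G !row_mxKr !row_mxKl ff' mxE eqxx mulr1n.
  rewrite -[RHS]hsubmxK; congr row_mx; rewrite -[RHS]s11; congr _%:M.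
  by rewrite mulrC mulKf // addrK.
- move=> c; rewrite /F /G !row_mxKr !row_mxKl f'f mxE eqxx mulr1n.
  rewrite -[RHS]hsubmxK; congr row_mx; rewrite -[RHS]s11; congr _%:M.
  by rewrite subrK mulrC divfK.
- move=> c; rewrite [F c]/F nrm2_row_mx -fN /= mxE eqxx mulr1n exprMn sg2.
  set a := lsubmx c ord0 ord0; set r := rsubmx c.
  have -> : c = (a *: e + j r : 'rV[R]_(1 + k)).
    rewrite /e /j scale_row_mx add_row_mx scaler0 add0r addr0 -[LHS]hsubmxK; congr row_mx.
    by rewrite scalemx1 s11.
  rewrite /h !(polar_expand rn dy) -/(L r) -/g; field.
  exact: gn.
Qed.

End RowNorm.

(** * Closed sets with rays *)

Section RayClosed.
Variables (R : realType) (k : nat) (N : 'rV[R]_k -> R) (S : 'rV[R]_k -> Prop).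
Hypothesis rn : row_norm N.

Definition norm_closed : Prop :=
  forall c, (forall e, 0 < e -> exists2 c', S c' & N (c - c') < e) -> S c.

Definition ray_closed : Prop := forall c c', S c -> S c' -> c <> c' ->
  (forall t, 0 <= t -> S (c + t *: (c' - c))) \/ (forall t, 0 <= t -> S (c - t *: (c' - c))).

Hypotheses (Scl : norm_closed) (Sray : ray_closed).

Definition cone_in (s : R) (e c : 'rV[R]_k) : Prop := forall t, 0 <= t -> S (e + (s * t) *: (c - e)).

Lemma rn0 : N 0 = 0.
Proof. by rewrite -(scale0r (0 : 'rV[R]_k)) (rn_hom rn) normr0 mul0r. Qed.

Lemma rnN u : N (- u) = N u.
Proof. by rewrite -scaleN1r (rn_hom rn) normrN normr1 mul1r. Qed.

Lemma rnC u v : N (u - v) = N (v - u).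
Proof. by rewrite -rnN opprB. Qed.

Lemma rn_triB u v x : N (u - v) <= N (u - x) + N (x - v).
Proof. by have := rn_tri rn (u - x) (x - v); rewrite addrA subrK. Qed.

Lemma rn_gt0 u : u <> 0 -> 0 < N u.
Proof.
by move=> u0; rewrite lt_neqAle (rn_ge0 rn) andbT eq_sym; apply/eqP => /(rn_def rn).
Qed.

Lemma norm_open c : ~ S c -> exists2 e, 0 < e & forall c', N (c' - c) < e -> ~ S c'.
Proof.
move=> nS; apply: contrapT => H; apply/nS/Scl => e e0; apply: contrapT => H'.
by apply: H; exists e => // c' lt Sc'; apply: H'; exists c'; rewrite // rnC.
Qed.

Lemma cone_in_or e c : S e -> S c -> cone_in 1 e c \/ cone_in (-1) e c.
Proof.
move=> Se Sc; have [->|/nesym ec] := pselect (c = e).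
  by left=> t _; rewrite subrr scaler0 addr0.
case: (Sray Se Sc ec) => h; [left|right] => t t0; first by rewrite mul1r; exact: h.
by rewrite mulN1r scaleNr; exact: h.
Qed.

(** If some ray from [e] through a point of the ball leaves [S], then by closedness so do those
    through nearby points; there the opposite rays must lie in [S]. *)
Lemma cone_split (H : 'rV[R]_k -> Prop) e c r : S e -> H c -> 0 < r ->
  (forall x, H x -> N (x - c) < r -> S x) ->
  exists s c1 r1, (s = 1 \/ s = -1) /\ H c1 /\ 0 < r1 /\
    forall x, H x -> N (x - c1) < r1 -> cone_in s e x.
Proof.
move=> Se Hc r0 hS.
have [h1|h1] := pselect (forall x, H x -> N (x - c) < r -> cone_in 1 e x).
  by exists 1, c, r; split; [left|].
exists (-1).
have [c1 [Hc1 [cc1 n1]]] : exists c1, H c1 /\ N (c1 - c) < r /\ ~ cone_in 1 e c1.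
  apply: contrapT => h2; apply: h1 => x Hx xr; apply: contrapT => nx.
  by apply: h2; exists x.
have [t1 t10 nt1] : exists2 t, 0 <= t & ~ S (e + (1 * t) *: (c1 - e)).
  by apply: contrapT => h; apply: n1 => t t0; apply: contrapT => h'; apply: h; exists t.
rewrite mul1r in nt1; have [ep ep0 hep] := norm_open nt1.
(* The second bound moves the point at parameter [t1] by less than [ep]. *)
exists c1, (Num.min (r - N (c1 - c)) (ep / (t1 + 1))).
split; first by right.
split=> //; split.
  by rewrite lt_min subr_gt0 cc1 divr_gt0 //; lra.
move=> x Hx; rewrite lt_min => /andP[x1 x2].
have Sx : S x by apply: hS => //; have := rn_triB x c c1; lra.
case: (cone_in_or Se Sx) => // /(_ t1 t10); rewrite mul1r => Sx'; exfalso.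
apply: (hep _ _ Sx').
rewrite opprD addrACA subrr add0r -scalerBr opprB addrA subrK (rn_hom rn) ger0_norm //.
have h : 0 < t1 + 1 by lra.
move: x2; rewrite ltr_pdivlMr // => x2; have := rn_ge0 rn (x - c1); nra.
Qed.

(* Every point of [S] is a limit of interior points, namely those of a cone over a ball. *)
Lemma ray_closed_all c r : 0 < r -> (forall x, N (x - c) < r -> S x) ->
  forall u v, S u -> (forall t, 0 <= t -> S (u + t *: v)) \/ (forall t, 0 <= t -> S (u - t *: v)).
Proof.
move=> r0 hS u v Su.
have [v0|v0] := pselect (v = 0).
  by left=> t _; rewrite v0 scaler0 addr0.
have [s [y [r1 [s1 [_ [r10 hy]]]]]] := @cone_split (fun=> True) u c r Su I r0 (fun x _ => hS x).
have ss : s * s = 1 by case: s1 => ->; rewrite ?mulrNN mulr1.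
have ns : `|s| = 1 by case: s1 => ->; rewrite ?normrN normr1.
pose p t := u + (s * t) *: (y - u).
(* Scaling by [s * t] about [u] maps the ball around [y] onto the ball of radius [t * r1] around
   [p t]. *)
have intp t z : 0 < t -> N (z - p t) < t * r1 -> S z.
  move=> t0 hz; have tn : t != 0 by rewrite gt_eqF.
  have e1 : z = u + (s * t) *: (u + (s / t) *: (z - u) - u).
    rewrite [u + (s / t) *: _]addrC addrK scalerA.
    have -> : s * t * (s / t) = s * s by field.
    by rewrite ss scale1r addrC subrK.
  rewrite e1; apply: (hy _ I _ t (ltW t0)).
  have -> : u + (s / t) *: (z - u) - y = (s / t) *: (z - p t).
    have -> : z - p t = (z - u) - (s * t) *: (y - u) by rewrite /p opprD addrA.
    rewrite [RHS]scalerBr scalerA.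
    have -> : s / t * (s * t) = s * s by field.
    by rewrite ss scale1r opprB addrA [u + _]addrC.
  by rewrite (rn_hom rn) normrM ns mul1r normfV gtr0_norm // mulrC ltr_pdivrMr // mulrC.
have rayp t : 0 < t -> (forall x, 0 <= x -> S (p t + x *: v)) \/ (forall x, 0 <= x -> S (p t - x *: v)).
  move=> t0; have Nv := rn_gt0 v0.
  pose tau := t * r1 / (2 * N v).
  have tau0 : 0 < tau by rewrite divr_gt0 ?mulr_gt0.
  have Sp : S (p t) by apply: (intp t) => //; rewrite subrr rn0 mulr_gt0.
  have Sq : S (p t + tau *: v).
    apply: (intp t) => //; rewrite [_ + tau *: v]addrC addrK (rn_hom rn) gtr0_norm //.
    rewrite /tau; have -> : t * r1 / (2 * N v) * N v = t * r1 / 2 by field; rewrite gt_eqF.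
    have tr : 0 < t * r1 by exact: mulr_gt0.
    lra.
  have ne : p t <> p t + tau *: v.
    move=> /(congr1 (fun z => z - p t)); rewrite subrr addrAC subrr add0r => /esym/eqP.
    by rewrite scaler_eq0 gt_eqF //= => /eqP.
  have sc x : x *: v = (x / tau) *: (p t + tau *: v - p t).
    by rewrite [p t + _]addrC addrK scalerA divfK // gt_eqF.
  by case: (Sray Sp Sq ne) => h; [left|right] => x x0; rewrite (sc x); apply: h; rewrite divr_ge0 // ltW.
apply: contrapT => /not_orP[n1 n2].
have neg s' : ~ (forall t, 0 <= t -> S (u + (s' * t) *: v)) -> exists2 t, 0 <= t & ~ S (u + (s' * t) *: v).
  by move=> h; apply: contrapT => h'; apply: h => t t0; apply: contrapT => h2; apply: h'; exists t.
have [t1 t10 nt1] : exists2 t, 0 <= t & ~ S (u + t *: v).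
  by apply: contrapT => h; apply: n1 => t t0; apply: contrapT => h'; apply: h; exists t.
have [t2 t20 nt2] : exists2 t, 0 <= t & ~ S (u - t *: v).
  by apply: contrapT => h; apply: n2 => t t0; apply: contrapT => h'; apply: h; exists t.
have [e1 e10 he1] := norm_open nt1; have [e2 e20 he2] := norm_open nt2.
have M0 : 0 < N (y - u) + 1 by have := rn_ge0 rn (y - u); lra.
(* For this [t] the point [p t] is so close to [u] that the failures at [t1] and [t2] persist there,
   against [rayp]. *)
pose t := Num.min e1 e2 / (N (y - u) + 1).
have t0 : 0 < t by rewrite divr_gt0 // lt_min e10.
have close : N (p t - u) < Num.min e1 e2.
  rewrite /p addrC addKr (rn_hom rn) normrM ns mul1r gtr0_norm //.
  have : 0 < Num.min e1 e2 by rewrite lt_min e10.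
  have := rn_ge0 rn (y - u).
  have : t * (N (y - u) + 1) = Num.min e1 e2 by rewrite divfK // gt_eqF.
  nra.
move: close; rewrite lt_min => /andP[cl1 cl2].
case: (rayp t t0) => [/(_ t1 t10)|/(_ t2 t20)].
  by apply: he1; have -> : p t + t1 *: v - (u + t1 *: v) = p t - u by rewrite opprD addrACA subrr addr0.
by apply: he2; have -> : p t - t2 *: v - (u - t2 *: v) = p t - u by rewrite opprB addrA subrK.
Qed.

Hypothesis coord_bound : exists C : R, forall (i : 'I_k) (c : 'rV[R]_k), `|c ord0 i| <= C * N c.
Hypotheses (S0 : S 0) (Se : forall i, S (delta_mx ord0 i)).

(** Induction on the dimension: over a ball of [S] in the span of the first [j] basis vectors, the
    cone with apex the next basis vector, or the opposite cone, contains a ball in one dimension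
    more. *)
Lemma interior_exists : exists c r, 0 < r /\ forall x, N (x - c) < r -> S x.
Proof.
have [C0 hC0] := coord_bound.
pose C := `|C0| + 1.
have C1 : 0 < C by rewrite /C; have := normr_ge0 C0; lra.
have hC (i : 'I_k) (c : 'rV[R]_k) : `|c ord0 i| <= C * N c.
  apply: le_trans (hC0 i c) _; apply: ler_wpM2r; first exact: rn_ge0 rn _.
  by rewrite /C; have := ler_norm C0; lra.
pose H (j : nat) (c : 'rV[R]_k) := forall i : 'I_k, (j <= i)%N -> c ord0 i = 0.
suff : forall j, (j <= k)%N -> exists c r, H j c /\ 0 < r /\ forall x, H j x -> N (x - c) < r -> S x.
  move=> /(_ k (leqnn _))[c [r [_ [r0 h]]]]; exists c, r; split=> // x; apply: h => i.
  by rewrite leqNgt ltn_ord.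
elim=> [|j IH] jk.
  exists 0, 1; split; first by move=> i _; rewrite mxE.
  split=> // x Hx _; suff -> : x = 0 by [].
  by apply/rowP => i; rewrite mxE Hx.
have [c0 [r0 [Hc0 [r00 hS]]]] := IH (ltnW jk).
pose e : 'rV[R]_k := delta_mx ord0 (Ordinal jk).
have [s [c [r [s1 [Hc [r1 hc]]]]]] := cone_split (Se (Ordinal jk)) Hc0 r00 hS.
rewrite -/e in hc.
have ss : s * s = 1 by case: s1 => ->; rewrite ?mulrNN mulr1.
have ns : `|s| = 1 by case: s1 => ->; rewrite ?normrN normr1.
have ej : e ord0 (Ordinal jk) = 1 by rewrite mxE !eqxx.
have ei (i : 'I_k) : (j < i)%N -> e ord0 i = 0.
  by move=> ji; rewrite mxE eqxx /=; case: eqP => // ij; move: ji; rewrite ij ltnn.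
have lin (a b d : 'rV[R]_k) (x : R) (i : 'I_k) :
    (a + x *: (b - d)) ord0 i = a ord0 i + x * (b ord0 i - d ord0 i) by rewrite !mxE.
pose M := N (c - e).
have M0 : 0 <= M := rn_ge0 rn _.
(* The first bound keeps the cone parameter [t] of [z] within [1/4] of [1/2]; the second keeps the
   base point [x] within [r] of [c]. *)
pose rr := Num.min ((4 * C)^-1) (r / (4 * (1 + C * M) + 1)).
have CM : 0 <= C * M by rewrite mulr_ge0 // ltW.
have den0 : 0 < 4 * (1 + C * M) + 1 by lra.
have rr0 : 0 < rr by rewrite lt_min invr_gt0 mulr_gt0 //= divr_gt0.
exists (e + (s / 2) *: (c - e)), rr; split.
  by move=> i ji; rewrite lin (Hc i (ltnW ji)) ei // subrr mulr0 addr0.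
split=> // z Hz; rewrite lt_min => /andP[z1 z2].
set z0 := e + _ in z1 z2.
(* The cone parameter is read off from coordinate [J], which is [1] at the apex [e] and [0] on the
   base. *)
pose J := Ordinal jk; pose t := s * (1 - z ord0 J).
have z0J : z0 ord0 J = 1 - s / 2.
  by rewrite /z0 lin (Hc J (leqnn _)) ej; ring.
have th : `|t - 2^-1| <= C * N (z - z0).
  have -> : t - 2^-1 = - (s * ((z - z0) ord0 J)).
    rewrite [(z - z0) _ _]mxE [(- z0) _ _]mxE z0J /t.
    have -> : - (s * (z ord0 J - (1 - s / 2))) = s * (1 - z ord0 J) - (s * s) / 2 by field.
    by rewrite ss div1r.
  by rewrite normrN normrM ns mul1r.
have CN : C * N (z - z0) < 4^-1.
  have -> : 4^-1 = C * (4 * C)^-1 by field; rewrite gt_eqF.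
  by rewrite ltr_pM2l.
have t4 : 4^-1 <= t by move: th; rewrite ler_norml; lra.
have t0 : 0 < t by lra.
have tn : t != 0 by rewrite gt_eqF.
pose x := e + (s / t) *: (z - e).
have zE : z = e + (s * t) *: (x - e).
  rewrite /x [e + (s / t) *: _]addrC addrK scalerA.
  have -> : s * t * (s / t) = s * s by field.
  by rewrite ss scale1r addrC subrK.
have Hx : H j x.
  move=> i; rewrite leq_eqVlt => /orP[/eqP ji|ji].
    have -> : i = J by apply: val_inj.
    rewrite /x lin ej.
    have -> : z ord0 J - 1 = - (s * t) by rewrite /t mulrA ss mul1r opprB.
    have -> : s / t * - (s * t) = - (s * s) by field.
    by rewrite ss addrN.
  by rewrite /x lin !ei // Hz // subrr mulr0 addr0.
rewrite zE; apply: hc (ltW t0) => //.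
have -> : x - c = (s / t) *: ((z - z0) - (s * (t - 2^-1)) *: (c - e)).
  rewrite scalerBr scalerA.
  have -> : s / t * (s * (t - 2^-1)) = s * s * (1 - (2 * t)^-1) by field.
  rewrite ss mul1r scalerBl scale1r /z0 opprD addrA scalerBr scalerA.
  have -> : s / t * (s / 2) = s * s * (2 * t)^-1 by field.
  rewrite ss mul1r opprB addrA subrK /x addrAC opprB.
  by rewrite [RHS]addrC addrAC.
rewrite (rn_hom rn) normrM ns mul1r normfV (gtr0_norm t0) mulrC ltr_pdivrMr //.
apply: le_lt_trans (rn_tri rn _ _) _; rewrite rnN (rn_hom rn) normrM ns mul1r -/M.
move: z2; rewrite ltr_pdivlMr // => z2.
have := ler_wpM2r M0 th; have Nz := rn_ge0 rn (z - z0).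
have : 4^-1 * r <= t * r by rewrite ler_pM2r.
nra.
Qed.

End RayClosed.

(** * Coordinates at a generic point *)

Section Frames.
Variables (R : realType) (X : Type) (dl : X -> X -> R) (U : set_system nat).
Hypothesis pc : ptolemy_compact U dl.
Hypothesis hr : has_rays dl.
Let UU : UltraFilter U. Proof. exact: pc_ultra pc. Qed.
Let PF : ProperFilter U. Proof. exact: (@ultra_proper _ _ UU). Qed.
#[local] Existing Instance PF.
Notation rho := (rho dl).

(** The ray is chosen before [B], so all affine functions are linear along it at once and its image
    in coordinates is a straight ray. The parameter is scaled so that [v], if met, is at [1]. *)
Lemma btw_affine_ray w u v : u <> w -> v <> w -> u <> v -> exists g : R -> X, exists s : R,
  (s = 1 \/ s = -1) /\ forall t, 0 <= t -> g t <> w /\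
    forall B, btw_affine dl w B -> B (g t) = B u + s * t * (B v - B u).
Proof.
move=> uw vw uv; have [g [g0 [gw [gd galt]]]] := hr uw vw uv.
have d0 : 0 < rho w v u by apply: (rho_gt0 pc) => //; apply: nesym.
set d := rho w v u in galt d0.
have ru t : 0 <= t -> rho w u (g t) = t.
  by move=> t0; rewrite -g0 gd // sub0r normrN ger0_norm.
have dn : d != 0 by rewrite gt_eqF.
exists (fun t => g (t * d)); case: galt => [ga|ga].
  exists (-1); split; [by right|] => t t0.
  have td : 0 <= t * d by rewrite mulr_ge0 // ltW.
  split; [exact: gw|] => B hB.
  have /(hB v u _ vw uw (gw _ td)) : rho w v u + rho w u (g (t * d)) = rho w v (g (t * d)).
    by rewrite ru // ga.
  rewrite ru // ga // -/d => h; apply: (mulIf dn); lra.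
exists 1; split; [by left|] => t t0.
have td : 0 <= t * d by rewrite mulr_ge0 // ltW.
split; [exact: gw|] => B hB; rewrite mul1r.
have rv s : 0 <= s -> rho w v (g s) = `|d - s| by move=> s0; rewrite -gd ?ga // ltW.
have duv : rho w u v = d by rewrite (rhoC pc).
have [t1|t1] := lerP t 1.
  have tdd : t * d <= d by rewrite -[leRHS]mul1r ler_wpM2r // ltW.
  have rgv : rho w (g (t * d)) v = d - t * d by rewrite (rhoC pc) rv // ger0_norm // subr_ge0.
  have /(hB u _ v uw (gw _ td) vw) : rho w u (g (t * d)) + rho w (g (t * d)) v = rho w u v.
    by rewrite ru // rgv duv addrC subrK.
  rewrite ru // rgv duv => h; apply: (mulIf dn); lra.
have tdd : d <= t * d by rewrite -[leLHS]mul1r; apply: ler_wpM2r; apply: ltW.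
have rvg : rho w v (g (t * d)) = t * d - d by rewrite rv // ler0_norm ?opprB // subr_le0.
have /(hB u v _ uw vw (gw _ td)) : rho w u v + rho w v (g (t * d)) = rho w u (g (t * d)).
  by rewrite ru // rvg duv addrC subrK.
rewrite ru // rvg duv => h; apply: (mulIf dn); lra.
Qed.

Variable w : X.
Hypothesis sep : forall a b, a <> w -> b <> w ->
  exists A, nonexp dl w A /\ btw_affine dl w A /\ A a - A b = rho w a b.

(** The Lipschitz constant is free, so that these functions form a vector space. *)
Definition affine (A : X -> R) : Prop :=
  (exists2 C : R, 0 <= C & forall x y, x <> w -> y <> w -> A x - A y <= C * rho w x y) /\ btw_affine dl w A.

Lemma affine_nonexp A : nonexp dl w A -> btw_affine dl w A -> affine A.
Proof. by move=> h ?; split=> //; exists 1 => // x y xw yw; rewrite mul1r; exact: h. Qed.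

Lemma affine_comb c A B : affine A -> affine B -> affine (fun x => c * A x + B x).
Proof.
move=> [[C C0 hC] bA] [[D D0 hD] bB]; split.
  exists (`|c| * C + D); first by rewrite addr_ge0 ?mulr_ge0.
  move=> x y xw yw; have h1 := hC x y xw yw; have h2 := hD x y xw yw; have h3 := hC y x yw xw.
  rewrite (rhoC pc w y x) in h3.
  move: (rho w x y) h1 h2 h3 => r h1 h2 h3.
  have h4 : `|A x - A y| <= C * r by rewrite ler_norml; lra.
  have h5 : c * (A x - A y) <= `|c| * (C * r).
    by apply: le_trans (ler_norm _) _; rewrite normrM ler_wpM2l.
  lra.
move=> x y z xw yw zw h; have e1 := bA _ _ _ xw yw zw h; have e2 := bB _ _ _ xw yw zw h.
by transitivity (c * (A y * rho w x z) + B y * rho w x z); [ring|rewrite e1 e2; ring].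
Qed.

Lemma affine_zero : affine (fun=> 0).
Proof. by split; [exists 0 => // *; rewrite mul0r subrr|move=> *; rewrite !mul0r addr0]. Qed.

Lemma affine_lip A : affine A -> exists2 C : R, 0 < C & forall x y, x <> w -> y <> w -> `|A x - A y| <= C * rho w x y.
Proof.
move=> [[C C0 hC] _]; exists (C + 1) => [|x y xw yw]; first by lra.
have h1 := hC x y xw yw; have h2 := hC y x yw xw; rewrite (rhoC pc w y x) in h2.
have := rho_ge0 pc w x y; move: (rho w x y) h1 h2 => r h1 h2 r0; rewrite ler_norml; lra.
Qed.

Lemma affine_sum k (c : 'I_k -> R) (A : 'I_k -> X -> R) B : affine B -> (forall i, affine (A i)) ->
  affine (fun x => B x - \sum_(i < k) c i * A i x).
Proof.
elim: k c A => [|k IH] c A hB hA.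
  by rewrite (_ : (fun x => _) = B) //; apply/funext => x; rewrite big_ord0 subr0.
have := affine_comb (- c ord_max) (hA ord_max) (IH (fun i => c (widen_ord (leqnSn k) i)) _ hB (fun i => hA (widen_ord (leqnSn k) i))).
congr affine; apply/funext => x; rewrite big_ord_recr /=; ring.
Qed.

Variable u0 : X.
Hypothesis u0w : u0 <> w.

Section OneFrame.
Variables (k : nat) (u : 'I_k -> X) (A : 'I_k -> X -> R).

(** The points [u i], seen from [u0], are biorthogonal to the functions [A i]; the size of a frame
    thus measures linear independence. *)
Definition frame : Prop := (forall i, u i <> w) /\ (forall i, affine (A i)) /\
  forall i j, A i (u j) - A i u0 = (i == j)%:R.

Hypothesis fr : frame.

Definition residue (B : X -> R) (x : X) : R := B x - \sum_(i < k) (B (u i) - B u0) * A i x.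

(* The points whose position relative to [u0] is determined by the coordinates [A i]. *)
Definition slice (x : X) : Prop := x <> w /\ forall B, affine B -> residue B x = residue B u0.

Definition coords (x : X) : 'rV[R]_k := \row_i (A i x - A i u0).

(** The linear form that agrees with [B - B u0] at the frame points; [slice_ev] extends this to the
    slice. *)
Definition ev (B : X -> R) (c : 'rV[R]_k) : R := \sum_(i < k) (B (u i) - B u0) * c ord0 i.

(** A dual norm, with the nonexpansive affine functions as the dual unit ball, so that coordinate
    differences have norm [rho w]. *)
Definition fnorm (c : 'rV[R]_k) : R :=
  sup [set r | exists2 B, nonexp dl w B /\ btw_affine dl w B & r = `|ev B c|].

Lemma ev_lin B s c c' : ev B (s *: c + c') = s * ev B c + ev B c'.
Proof. by rewrite /ev mulr_sumr -big_split; apply: eq_bigr => i _ /=; rewrite !mxE; ring. Qed.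

Lemma affine_residue B : affine B -> affine (residue B).
Proof. by move=> hB; apply: affine_sum => //; exact: fr.2.1. Qed.

Lemma slice_ev x B : slice x -> affine B -> B x - B u0 = ev B (coords x).
Proof.
move=> [_ h] /h; rewrite /residue /ev => /eqP; rewrite subr_eq => /eqP ->.
rewrite addrAC [B u0 - _ - _]addrAC subrr add0r addrC -sumrB.
by apply: eq_bigr => i _; rewrite mxE mulrBr.
Qed.

Lemma slice_ev2 x y B : slice x -> slice y -> affine B -> B x - B y = ev B (coords x - coords y).
Proof.
move=> sx sy hB; have -> : coords x - coords y = -1 *: coords y + coords x by rewrite scaleN1r addrC.
rewrite ev_lin -!slice_ev //; ring.
Qed.

Lemma slice_u0 : slice u0. Proof. by []. Qed.

Lemma coords_u0 : coords u0 = 0.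
Proof. by apply/rowP => i; rewrite !mxE subrr. Qed.

Lemma slice_u j : slice (u j).
Proof.
split=> [|B hB]; first exact: fr.1.
rewrite /residue; apply/eqP; rewrite subr_eq addrAC -addrA -sumrB.
rewrite (bigD1 j) //= big1 => [|i ij]; last first.
  by rewrite -mulrBr fr.2.2 (negbTE ij) mulr0.
by rewrite -mulrBr fr.2.2 eqxx mulr1 addr0 addrC subrK.
Qed.

Lemma coords_u j : coords (u j) = delta_mx ord0 j.
Proof. by apply/rowP => i; rewrite !mxE fr.2.2 eqxx. Qed.

Lemma nonexp_abs B x y : nonexp dl w B -> x <> w -> y <> w -> `|B x - B y| <= rho w x y.
Proof.
move=> h xw yw; have := h x y xw yw; have := h y x yw xw.
by rewrite (rhoC pc w y x) ler_norml; lra.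
Qed.

Lemma fnorm_sup c : has_sup [set r | exists2 B, nonexp dl w B /\ btw_affine dl w B & r = `|ev B c|].
Proof.
split.
  have [B [h1 [h2 _]]] := sep u0w u0w.
  by exists `|ev B c|, B.
exists (\sum_(i < k) rho w (u i) u0 * `|c ord0 i|) => r [B [h1 h2] ->].
apply: le_trans (ler_norm_sum _ _ _) _; apply: ler_sum => i _.
by rewrite normrM ler_wpM2r // nonexp_abs //; exact: fr.1.
Qed.

Lemma fnorm_ge B c : nonexp dl w B -> btw_affine dl w B -> `|ev B c| <= fnorm c.
Proof. by move=> h1 h2; apply: ub_le_sup; [exact: (fnorm_sup c).2|exists B]. Qed.

Lemma fnorm_le c M : (forall B, nonexp dl w B -> btw_affine dl w B -> `|ev B c| <= M) -> fnorm c <= M.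
Proof. by move=> h; apply: ge_sup; [exact: (fnorm_sup c).1|move=> r [B [h1 h2] ->]; exact: h]. Qed.

Lemma affine_ev_le B : affine B -> exists2 C : R, 0 < C & forall c, `|ev B c| <= C * fnorm c.
Proof.
move=> hB; have [C C0 hC] := affine_lip hB; exists C => // c.
have bB' : affine (fun x => C^-1 * B x + 0) := affine_comb C^-1 hB affine_zero.
have nB' : nonexp dl w (fun x => C^-1 * B x + 0).
  move=> x y xw yw; rewrite !addr0 -mulrBr mulrC ler_pdivrMr // mulrC.
  exact: le_trans (ler_norm _) (hC _ _ xw yw).
have := fnorm_ge c nB' bB'.2.
have -> : ev (fun x => C^-1 * B x + 0) c = C^-1 * ev B c.
  by rewrite /ev mulr_sumr; apply: eq_bigr => i _; rewrite !addr0; ring.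
by rewrite normrM normfV (gtr0_norm C0) mulrC ler_pdivrMr // mulrC.
Qed.

Lemma coords_bound : exists C : R, forall (i : 'I_k) (c : 'rV[R]_k), `|c ord0 i| <= C * fnorm c.
Proof.
have evA i c : ev (A i) c = c ord0 i.
  rewrite /ev (bigD1 i) //= big1 => [|j ij]; last by rewrite fr.2.2 eq_sym (negbTE ij) mul0r.
  by rewrite fr.2.2 eqxx mul1r addr0.
have /choice[C hC] : forall i, exists C : R, 0 < C /\ forall c, `|ev (A i) c| <= C * fnorm c.
  by move=> i; have [C ? ?] := affine_ev_le (fr.2.1 i); exists C.
exists (\sum_i C i) => i c; rewrite -evA; apply: le_trans ((hC i).2 c) _.
have f0 : 0 <= fnorm c.
  have [B [h1 [h2 _]]] := sep u0w u0w.
  exact: le_trans (normr_ge0 _) (fnorm_ge c h1 h2).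
rewrite ler_wpM2r // (bigD1 i) //= lerDl sumr_ge0 // => j _.
by rewrite ltW; case: (hC j).
Qed.

Lemma fnorm_row_norm : row_norm fnorm.
Proof.
have ge0 c : 0 <= fnorm c.
  have [B [h1 [h2 _]]] := sep u0w u0w.
  exact: le_trans (normr_ge0 _) (fnorm_ge c h1 h2).
have evZ B s c : ev B (s *: c) = s * ev B c.
  have e0 : ev B 0 = 0 by rewrite /ev big1 // => i _; rewrite mxE mulr0.
  by rewrite -[s *: c]addr0 ev_lin e0 addr0.
have half s c : fnorm (s *: c) <= `|s| * fnorm c.
  by apply: fnorm_le => B h1 h2; rewrite evZ normrM ler_wpM2l // fnorm_ge.
split=> //.
- move=> s c; apply/eqP; rewrite eq_le half /=.
  have [->|sn] := eqVneq s 0; first by rewrite normr0 mul0r.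
  have := half s^-1 (s *: c); rewrite scalerA mulVf // scale1r normfV mulrC.
  by rewrite ler_pdivlMr ?normr_gt0 // mulrC.
- move=> c c'; apply: fnorm_le => B h1 h2.
  rewrite -[c]scale1r ev_lin mul1r scale1r; apply: le_trans (ler_normD _ _) _.
  by apply: lerD; apply: fnorm_ge.
- move=> c c0; apply/rowP => i; rewrite mxE; apply/eqP; rewrite -normr_eq0.
  by have [C /(_ i c)] := coords_bound; rewrite c0 mulr0 => h; rewrite eq_le h normr_ge0.
Qed.

(** Nonexpansive functions give one inequality; the function provided by [sep] attains the
    distance. *)
Lemma fnorm_coords x y : slice x -> slice y -> fnorm (coords x - coords y) = rho w x y.
Proof.
move=> sx sy; apply/eqP; rewrite eq_le; apply/andP; split.
  apply: fnorm_le => B h1 h2; rewrite -slice_ev2 //; last exact: affine_nonexp.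
  by apply: nonexp_abs => //; [case: sx|case: sy].
have [B [h1 [h2 <-]]] := sep sx.1 sy.1.
rewrite (slice_ev2 sx sy (affine_nonexp h1 h2)).
exact: le_trans (ler_norm _) (fnorm_ge _ h1 h2).
Qed.

Definition slice_image (c : 'rV[R]_k) : Prop := exists2 x, slice x & coords x = c.

(* A sequence that stays at bounded [rho w]-distance cannot approach [w]. *)
Lemma bounded_limit (x : nat -> X) M y : (forall m, x m <> w) -> (forall m, rho w u0 (x m) <= M) ->
  dl (x m) y @[m --> U] --> (0 : R) -> y <> w.
Proof.
move=> xw xM xy yw; rewrite yw in xy.
have h : forall m, dl u0 (x m) <= M * dl u0 w * dl (x m) w.
  move=> m; rewrite (rhoE pc u0w (xw m)) -mulrA ler_wpM2r //.
  by rewrite mulr_ge0 ?(dl_ge0 pc).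
have : dl u0 w <= M * dl u0 w * 0.
  apply: (ultra_cvg_le UU (cvg_dl pc (cvg_dl_cst pc u0) xy) (cvgM (@cvg_cst _ (M * dl u0 w) _ U _) xy)).
  by apply: filterS filterT => m _; exact: h.
by rewrite mulr0 leNgt (dl_gt0 pc).
Qed.

Lemma slice_image_closed : norm_closed fnorm slice_image.
Proof.
move=> c hc; have rn := fnorm_row_norm.
have /choice[x hx] : forall m : nat, exists x, slice x /\ fnorm (c - coords x) < m.+1%:R^-1.
  move=> m; have e0 : 0 < m.+1%:R^-1 :> R by rewrite invr_gt0 ltr0n.
  by have [c' [x sx <-] lt] := hc _ e0; exists x.
have [y xy] := pc_limit pc x.
have yw : y <> w.
  apply: (@bounded_limit x (fnorm c + 1)) => // m; first by case: (hx m) => [[]].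
  have [sx lt] := hx m.
  rewrite (rhoC pc) -(fnorm_coords sx slice_u0) coords_u0 subr0.
  have -> : coords (x m) = c - (c - coords (x m)) by rewrite opprB addrC subrK.
  apply: le_trans (rn_tri rn _ _) _; rewrite (rnN rn) lerD2l; apply: le_trans (ltW lt) _.
  by rewrite invf_le1 ?ltr0n // ler1n.
have cr : rho w y (x m) @[m --> U] --> (0 : R).
  by rewrite -(rhoxx pc w y); apply: (cvg_rho pc) => //; apply: cvg_dl_cst pc _.
have sy : slice y.
  split=> // B hB; have [C C0 hC] := affine_lip (affine_residue hB).
  apply/eqP; rewrite -subr_eq0 -normr_eq0 eq_le normr_ge0 andbT.
  rewrite -(mulr0 C); apply: (ultra_cvg_le UU (@cvg_cst _ `|residue B y - residue B u0| _ U _)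
    (cvgM (@cvg_cst _ C _ U _) cr)).
  apply: filterS filterT => m _ /=; have [[xw hm] _] := hx m.
  by rewrite -(hm B hB); exact: hC.
exists y => //; apply/eqP; rewrite -subr_eq0; apply/eqP/(rn_def rn)/eqP; rewrite eq_le (rn_ge0 rn) andbT.
have -> : (0 : R) = 0 + 0 by rewrite addr0.
apply: (ultra_cvg_le UU (@cvg_cst _ (fnorm (coords y - c)) _ U _) (cvgD cr (@ultra_harmonic R U (pc_cofinite pc)))).
apply: filterS filterT => m _ /=; have [sx lt] := hx m.
apply: le_trans (rn_triB rn _ _ (coords (x m))) _.
by rewrite (fnorm_coords sy sx) lerD2l (rnC rn) ltW.
Qed.

(** Residues are affine and agree at [x] and [y], hence are constant along the ray, which therefore
    stays in the slice. *)
Lemma slice_image_ray : ray_closed slice_image.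
Proof.
move=> c c' [x sx <-] [y sy <-] ne.
have xy : x <> y by move=> e; apply: ne; rewrite e.
have [g [s [s1 hg]]] := btw_affine_ray sx.1 sy.1 xy.
have key t : 0 <= t -> slice_image (coords x + (s * t) *: (coords y - coords x)).
  move=> t0; have [gw hgt] := hg t t0; exists (g t).
    split=> // B hB; have hr' := affine_residue hB.
    by rewrite (hgt _ hr'.2) (sy.2 B hB) (sx.2 B hB) subrr mulr0 addr0.
  apply/rowP => i; rewrite !mxE (hgt _ (fr.2.1 i).2).
  by ring.
case: s1 key => -> key; [left|right] => t t0; have := key t t0; first by rewrite mul1r.
by rewrite mulN1r scaleNr.
Qed.

Lemma slice_interior : exists c r, 0 < r /\ forall x, fnorm (x - c) < r -> slice_image x.
Proof.
apply: (interior_exists fnorm_row_norm slice_image_closed slice_image_ray coords_bound).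
  by exists u0; [exact: slice_u0|exact: coords_u0].
by move=> i; exists (u i); [exact: slice_u|exact: coords_u].
Qed.

Lemma fnorm_day : day_ineq fnorm.
Proof.
move=> c c'; have rn := fnorm_row_norm; have [z [r [r0 hz]]] := slice_interior.
pose M := fnorm c + fnorm c' + 1.
have c0 := rn_ge0 rn c; have c'0 := rn_ge0 rn c'.
have M0 : 0 < M by rewrite /M; lra.
(* Shrinks the parallelogram with diagonals along [c] and [c'] so that it fits in the ball around
   [z]. *)
pose t := r / M; have t0 : 0 < t by rewrite divr_gt0.
have tM : t * M = r by rewrite divfK // gt_eqF.
have inS s d : (s = 1 \/ s = -1) -> 0 <= fnorm d < M -> slice_image (z + (s * t) *: d).
  move=> s1 /andP[d0 dM]; apply: hz; rewrite addrC addKr (rn_hom rn) normrM (gtr0_norm t0).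
  have -> : `|s| = 1 by case: s1 => ->; rewrite ?normrN normr1.
  by rewrite mul1r -tM ltr_pM2l.
have cM : 0 <= fnorm c < M by rewrite c0 /M /=; lra.
have c'M : 0 <= fnorm c' < M by rewrite c'0 /M /=; lra.
have [x sx ex] := inS 1 c (or_introl erefl) cM; have [x' sx' ex'] := inS (-1) c (or_intror erefl) cM.
have [y sy ey] := inS 1 c' (or_introl erefl) c'M; have [y' sy' ey'] := inS (-1) c' (or_intror erefl) c'M.
have := rho_ptolemy pc sx.1 sx'.1 sy.1 sy'.1.
rewrite -!fnorm_coords // ex ex' ey ey' !mul1r !mulN1r.
have d2 (a b : 'rV[R]_k) (p q : R) : z + p *: a - (z + q *: b) = p *: a - q *: b.
  by rewrite opprD addrACA subrr add0r.
have t20 : 0 < 2 * t by lra.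
have dbl (a : 'rV[R]_k) : t *: a - (- t) *: a = (2 * t) *: a by rewrite -scalerBl; congr (_ *: _); ring.
have F5 : t *: c - (- t) *: c' = t *: (c + c') by rewrite scaleNr opprK scalerDr.
have F6 : (- t) *: c - t *: c' = (- t) *: (c + c') by rewrite scalerDr !scaleNr.
rewrite !d2 !dbl F5 F6 -!scalerBr !(rn_hom rn) normrN (gtr0_norm t0) (gtr0_norm t20) => h.
have tt : 0 < t ^+ 2 by rewrite exprn_gt0.
rewrite -(ler_pM2l tt); nra.
Qed.

End OneFrame.

End Frames.

(** * Euclidean representations *)

Section Euclid.
Variables (R : realType) (k : nat).
Implicit Types u v c : 'rV[R]_k.

Definition dot u v : R := \sum_(i < k) u ord0 i * v ord0 i.
Definition enorm u : R := Num.sqrt (nrm2 u).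

Lemma nrm2_ge0 u : 0 <= nrm2 u.
Proof. by apply: sumr_ge0 => i _; exact: sqr_ge0. Qed.

Lemma enorm2 u : enorm u ^+ 2 = nrm2 u.
Proof. by rewrite sqr_sqrtr // nrm2_ge0. Qed.

Lemma enorm_ge0 u : 0 <= enorm u. Proof. exact: sqrtr_ge0. Qed.

Lemma nrm2_eq0 u : nrm2 u = 0 -> u = 0.
Proof.
move=> /eqP; rewrite psumr_eq0 => [/allP h|i _]; last exact: sqr_ge0.
apply/rowP => i; rewrite mxE; apply/eqP; rewrite -sqrf_eq0.
by have := h i; rewrite mem_index_enum => /(_ isT).
Qed.

Lemma nrm2_gt0 u : u <> 0 -> 0 < nrm2 u.
Proof.
by move=> u0; rewrite lt_neqAle nrm2_ge0 andbT eq_sym; apply/eqP => /nrm2_eq0.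
Qed.

Lemma nrm2_0 : nrm2 (0 : 'rV[R]_k) = 0.
Proof. by rewrite /nrm2 big1 // => i _; rewrite mxE expr0n. Qed.

Lemma nrm2_dim0 (l : nat) (u : 'rV[R]_l) : l = 0%N -> nrm2 u = 0.
Proof. by case: l u => // u _; rewrite /nrm2 big_ord0. Qed.

Lemma nrm2Z s u : nrm2 (s *: u) = s ^+ 2 * nrm2 u.
Proof. by rewrite /nrm2 mulr_sumr; apply: eq_bigr => i _; rewrite mxE exprMn. Qed.

Lemma dotZl s u v : dot (s *: u) v = s * dot u v.
Proof. by rewrite /dot mulr_sumr; apply: eq_bigr => i _; rewrite mxE mulrA. Qed.

Lemma dotC u v : dot u v = dot v u.
Proof. by apply: eq_bigr => i _; rewrite mulrC. Qed.

Lemma dotZr s u v : dot u (s *: v) = s * dot u v.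
Proof. by rewrite dotC dotZl dotC. Qed.

Lemma dotDl u v c : dot (u + v) c = dot u c + dot v c.
Proof. by rewrite /dot -big_split; apply: eq_bigr => i _ /=; rewrite mxE mulrDl. Qed.

Lemma dotNl u c : dot (- u) c = - dot u c.
Proof. by rewrite -scaleN1r dotZl mulN1r. Qed.

Lemma dotBl u v c : dot (u - v) c = dot u c - dot v c.
Proof. by rewrite dotDl dotNl. Qed.

Lemma dot_nrm2 u : dot u u = nrm2 u.
Proof. by apply: eq_bigr => i _; rewrite expr2. Qed.

Lemma nrm2D u v : nrm2 (u + v) = nrm2 u + 2 * dot u v + nrm2 v.
Proof.
rewrite -!dot_nrm2 dotDl !(dotC _ (u + v)) !dotDl (dotC v u); ring.
Qed.

Lemma nrm2N u : nrm2 (- u) = nrm2 u.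
Proof. by rewrite -scaleN1r nrm2Z sqrrN expr1n mul1r. Qed.

Lemma dotNr u v : dot u (- v) = - dot u v.
Proof. by rewrite dotC dotNl dotC. Qed.

Lemma nrm2B u v : nrm2 (u - v) = nrm2 u - 2 * dot u v + nrm2 v.
Proof. by rewrite nrm2D nrm2N dotNr; ring. Qed.

Lemma cauchy_schwarz u v : dot u v <= enorm u * enorm v.
Proof.
have [->|v0] := pselect (v = 0).
  by rewrite -(scale0r (0 : 'rV[R]_k)) dotZr mul0r mulr_ge0 ?enorm_ge0.
have nv := nrm2_gt0 v0.
have : 0 <= nrm2 (nrm2 v *: u - dot u v *: v) := nrm2_ge0 _.
rewrite nrm2B !nrm2Z dotZl dotZr.
rewrite (_ : _ + _ = nrm2 v * (nrm2 v * nrm2 u - dot u v ^+ 2)); last by ring.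
rewrite pmulr_rge0 // subr_ge0 -!enorm2 => h.
apply: le_trans (ler_norm _) _.
rewrite -ler_sqr ?nnegrE ?mulr_ge0 ?enorm_ge0 // real_normK ?num_real //.
by apply: le_trans h _; rewrite exprMn mulrC.
Qed.

Lemma enorm_row_norm : row_norm enorm.
Proof.
split.
- exact: enorm_ge0.
- by move=> c u; rewrite /enorm nrm2Z sqrtrM ?sqr_ge0 // sqrtr_sqr.
- move=> u v; rewrite -ler_sqr ?nnegrE ?addr_ge0 ?enorm_ge0 // enorm2 nrm2D -!enorm2.
  have := cauchy_schwarz u v; lra.
- by move=> u u0; apply: nrm2_eq0; rewrite -enorm2 u0 expr0n.
Qed.

(** Strict convexity: equality gives [dot p q = enorm p * enorm q], so [enorm q *: p - enorm p *: q]
    has norm zero. *)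
Lemma enorm_strict a b c : enorm (a - b) + enorm (b - c) = enorm (a - c) ->
  enorm (a - c) *: b = enorm (b - c) *: a + enorm (a - b) *: c.
Proof.
set p := a - b; set q := b - c; have -> : a - c = p + q by rewrite /p /q addrA subrK.
move=> h; have h2 : dot p q = enorm p * enorm q.
  have : enorm (p + q) ^+ 2 = (enorm p + enorm q) ^+ 2 by rewrite h.
  by rewrite enorm2 nrm2D -!enorm2; lra.
have : enorm q *: p - enorm p *: q = 0.
  apply: nrm2_eq0; rewrite nrm2B !nrm2Z dotZl dotZr h2 -!enorm2; ring.
rewrite -h => e; apply/rowP => i; move/(congr1 (fun m : 'rV[R]_k => m ord0 i)): e.
by move: (enorm p) (enorm q) => np nq; rewrite !mxE; lra.
Qed.

Lemma dot_delta i j : dot (delta_mx ord0 i) (delta_mx ord0 j) = (i == j)%:R.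
Proof.
rewrite /dot (bigD1 i) //= big1 => [|l li]; last by rewrite mxE eqxx (negbTE li) mul0r.
by rewrite !mxE !eqxx mul1r addr0.
Qed.

End Euclid.

Section EuclideanRepresentation.
Variables (R : realType) (X : Type) (dl : X -> X -> R) (U : set_system nat).
Hypothesis pc : ptolemy_compact U dl.
Hypothesis hr : has_rays dl.
Let UU : UltraFilter U. Proof. exact: pc_ultra pc. Qed.
Let PF : ProperFilter U. Proof. exact: (@ultra_proper _ _ UU). Qed.
#[local] Existing Instance PF.
Notation rho := (rho dl).

Definition image_off (k : nat) (w : X) (Psi : X -> 'rV[R]_k) (c : 'rV[R]_k) : Prop :=
  exists2 x, x <> w & Psi x = c.

Record erep (k : nat) (w : X) (Psi : X -> 'rV[R]_k) : Prop := Erep {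
  er_iso : forall x y, x <> w -> y <> w -> rho w x y = enorm (Psi x - Psi y);
  er_int : exists c r, 0 < r /\ forall x, enorm (x - c) < r -> image_off w Psi x }.

(** The residue of [B] is constant on the frame, so after normalization it is dual to the new point
    [x]; the old functions are corrected by multiples of it. *)
Lemma frame_extend w u0 k u A B x : u0 <> w -> @frame R X dl w u0 k u A -> affine dl w B -> x <> w ->
  residue u0 u A B x <> residue u0 u A B u0 -> exists u' A', @frame R X dl w u0 k.+1 u' A'.
Proof.
move=> u0w fr hB xw ne.
pose D := residue u0 u A B x - residue u0 u A B u0.
have D0 : D != 0 by rewrite subr_eq0; apply/eqP.
pose Bh y := D^-1 * residue u0 u A B y + 0.
have hBh : affine dl w Bh by apply: (affine_comb pc _ (affine_residue pc fr hB) (affine_zero dl w)).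
have Bhu j : Bh (u j) - Bh u0 = 0.
  by rewrite /Bh !addr0 (slice_u fr j).2 // subrr.
have Bhx : Bh x - Bh u0 = 1 by rewrite /Bh !addr0 -mulrBr mulVf.
exists (fun i => if unlift ord_max i is Some j then u j else x).
exists (fun i => if unlift ord_max i is Some j then fun y => - (A j x - A j u0) * Bh y + A j y else Bh).
have [fw [fA fu]] := fr; split; [|split].
- by move=> i; case: unliftP => [j|] _.
- by move=> i; case: unliftP => [j|] _ //; exact: (affine_comb pc _ hBh (fA j)).
- move=> i j; case: (unliftP ord_max i) => [i' ->|->]; case: (unliftP ord_max j) => [j' ->|->].
  + by rewrite (inj_eq lift_inj) -fu /= (_ : Bh (u j') = Bh u0); [ring|have := Bhu j'; lra].
  + by rewrite [_ == ord_max]eq_sym (negbTE (neq_lift _ _)) /= (_ : Bh x = Bh u0 + 1); [ring|have := Bhx; lra].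
  + by rewrite (negbTE (neq_lift _ _)) Bhu.
  + by rewrite eqxx Bhx.
Qed.

(** From [u0] the image contains a unit step, of one sign or the other, in each of [k] orthonormal
    directions. Their endpoints are [c * c]-separated for [dl], with [c] independent of [k], so a
    finite net bounds [k]. *)
Lemma frame_bound w u0 : u0 <> w ->
  (forall a b, a <> w -> b <> w -> exists A, nonexp dl w A /\ btw_affine dl w A /\ A a - A b = rho w a b) ->
  exists n, forall k u A, @frame R X dl w u0 k u A -> (k <= n)%N.
Proof.
move=> u0w sep.
pose D := dl u0 w; have D0 : 0 < D := dl_gt0 pc u0w.
(* For a point [x i] with [rho w u0 (x i) = 1], the triangle inequality reads
   [D <= (D + 1) * dl (x i) w]. *)
pose c := D / (1 + D); have c0 : 0 < c by rewrite divr_gt0 // addr_gt0 // ltr01.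
have c20 : 0 < c * c := mulr_gt0 c0 c0.
have cc0 : 0 < c * c / 2 by rewrite divr_gt0.
have [n [f hf]] := pc_net pc cc0; exists n => k u A fr.
have rn := fnorm_row_norm pc sep u0w fr.
have [F [G [Flin [FG [GF FN]]]]] := euclidean_norm UU (pc_cofinite pc) rn (fnorm_day pc hr sep u0w fr).
pose N := fnorm dl w u0 u.
have [z [r [r0 hz]]] := slice_interior pc hr sep u0w fr.
have S0 : slice_image dl w u0 u A 0 by exists u0; [exact: slice_u0|exact: coords_u0].
have NF c1 c2 : N (c1 - c2) ^+ 2 = nrm2 (F c1 - F c2).
  by rewrite /N FN; congr nrm2; rewrite [c1 - c2]addrC -scaleN1r Flin scaleN1r addrC.
have F0 : F 0 = 0.
  by apply: nrm2_eq0; rewrite -FN (rn0 rn) expr0n.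
have /choice[x hx] : forall i : 'I_k, exists x, slice dl w u0 u A x /\ (F (coords u0 A x) = delta_mx ord0 i \/ F (coords u0 A x) = - delta_mx ord0 i).
  move=> i.
  have FNe : F (- G (delta_mx ord0 i)) = - delta_mx ord0 i.
    by rewrite -[- G _]addr0 -scaleN1r Flin GF F0 addr0 scaleN1r.
  have := ray_closed_all rn (slice_image_closed pc sep u0w fr) (slice_image_ray pc hr fr) r0 hz (G (delta_mx ord0 i)) S0.
  case=> /(_ 1 ler01) [x sx]; rewrite scale1r add0r => ex; exists x; split=> //.
    by left; rewrite ex GF.
  by right; rewrite ex.
have rho2 i j : i != j -> rho w (x i) (x j) ^+ 2 = 2.
  move=> ij; have [si ei] := hx i; have [sj ej] := hx j.
  rewrite -(fnorm_coords pc sep u0w fr si sj) -/N NF nrm2B.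
  have nd l : nrm2 (delta_mx ord0 l : 'rV[R]_k) = 1 by rewrite -dot_nrm2 dot_delta eqxx.
  by case: ei => ->; case: ej => ->; rewrite ?nrm2N ?dotNl ?dotNr !nd dot_delta (negbTE ij) mulr0n ?oppr0 ?mulr0 ?subr0; ring.
have su : slice dl w u0 u A u0 by exact: slice_u0.
have rho1 i : rho w u0 (x i) = 1.
  have [si ei] := hx i.
  apply/eqP; rewrite -(eqrXn2 (n := 2)) ?(rho_ge0 pc) // expr1n.
  rewrite -(fnorm_coords pc sep u0w fr su si) -/N NF coords_u0 F0 sub0r nrm2N.
  by case: ei => ->; rewrite ?nrm2N -dot_nrm2 dot_delta eqxx.
have xc i : c <= dl (x i) w.
  have xw := (hx i).1.1; have := pc_tri pc u0 (x i) w.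
  rewrite (rhoE pc u0w xw) rho1 mul1r -/D => h.
  by rewrite ler_pdivrMr; lra.
have sepx i j : i != j -> c * c <= dl (x i) (x j).
  move=> ij; have xi := (hx i).1.1; have xj := (hx j).1.1.
  rewrite (rhoE pc xi xj).
  have h1 : 1 <= rho w (x i) (x j).
    by rewrite -ler_sqr ?nnegrE ?(rho_ge0 pc) // expr1n rho2 // ler1n.
  rewrite -[leLHS]mul1r; apply: ler_pM => //; first by rewrite mulr_ge0 // ltW.
  by apply: ler_pM => //; exact: ltW.
have /choice[idx hidx] : forall i, exists m : 'I_n, dl (x i) (f m) < c * c / 2.
  by move=> i; have [m mn h] := hf (x i); exists (Ordinal mn).
have inj : injective idx.
  move=> i j ij; apply/eqP; apply: contraT => ne; have := sepx i j ne.
  have := pc_tri pc (x i) (f (idx i)) (x j); have := hidx i; have := hidx j.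
  by rewrite -ij (pc_sym pc (x j)); lra.
by have := leq_card _ inj; rewrite !card_ord.
Qed.

(** A frame of maximal size cannot be extended, so every residue is constant and the slice is all of
    [X] except [w]. *)
Lemma erep_exists : exists k w (Psi : X -> 'rV[R]_k), (0 < k)%N /\ erep w Psi.
Proof.
have [w sep] := affine_functions_exist pc hr.
have [u0 [u0w _]] := third_point pc w w.
have [n hn] := frame_bound u0w sep.
pose P k := `[< exists u A, @frame R X dl w u0 k u A >].
have P0 : exists k, P k.
  by exists 0; apply/asboolP; exists (fun=> u0), (fun=> fun=> 0); split=> [[]//|]; split=> [] [].
have Pn k : P k -> (k <= n)%N by move=> /asboolP[u [A h]]; exact: hn h.
case: (ex_maxnP P0 Pn) => k /asboolP[u [A fr]] kmax.
have all_slice x : x <> w -> slice dl w u0 u A x.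
  move=> xw; split=> // B hB; apply: contrapT => ne.
  have [u' [A' fr']] := frame_extend u0w fr hB xw ne.
  have /kmax : P k.+1 by apply/asboolP; exists u', A'.
  by rewrite ltnn.
have rn := fnorm_row_norm pc sep u0w fr.
have [F [G [Flin [FG [GF FN]]]]] := euclidean_norm UU (pc_cofinite pc) rn (fnorm_day pc hr sep u0w fr).
pose N := fnorm dl w u0 u.
have NF c1 c2 : N (c1 - c2) = enorm (F c1 - F c2).
  apply/eqP; rewrite -(eqrXn2 (n := 2)) ?(rn_ge0 rn) ?enorm_ge0 // enorm2 FN; apply/eqP; congr nrm2.
  by rewrite [c1 - c2]addrC -scaleN1r Flin scaleN1r addrC.
have iso x y : x <> w -> y <> w -> rho w x y = enorm (F (coords u0 A x) - F (coords u0 A y)).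
  by move=> xw yw; rewrite -NF /N (fnorm_coords pc sep u0w fr) //; exact: all_slice.
exists k, w, (fun x => F (coords u0 A x)); split; last split=> //.
  have [b [bw bu]] := third_point pc w u0.
  have := rho_gt0 pc bw u0w bu; rewrite iso // /enorm lt0n => h; apply/eqP => k0.
  by move: h; rewrite nrm2_dim0 // sqrtr0 ltxx.
have [z [r [r0 hz]]] := slice_interior pc hr sep u0w fr.
exists (F z), r; split=> // y hy.
have /hz [x sx ex] : fnorm dl w u0 u (G y - z) < r by rewrite -/N NF GF.
by exists x; [case: sx|rewrite ex GF].
Qed.

End EuclideanRepresentation.

(** * Inversions and the shape of the image *)

Section Inversion.
Variables (R : realType) (k : nat).
Implicit Types a b c : 'rV[R]_k.

Definition inv c : 'rV[R]_k := (nrm2 c)^-1 *: c.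

Lemma nrm2_inv c : nrm2 (inv c) = (nrm2 c)^-1.
Proof.
have [->|c0] := pselect (c = 0); first by rewrite /inv scaler0 nrm2_0 invr0.
by rewrite nrm2Z expr2 -mulrA mulVf ?mulr1 // gt_eqF ?nrm2_gt0.
Qed.

Lemma invK : involutive inv.
Proof.
move=> c; rewrite {1}/inv nrm2_inv invrK /inv scalerA.
have [->|c0] := pselect (c = 0); first by rewrite scaler0.
by rewrite mulfV ?scale1r // gt_eqF ?nrm2_gt0.
Qed.

Lemma invZ (s : R) c : inv (s *: c) = s^-1 *: inv c.
Proof.
have [->|s0] := eqVneq s 0; first by rewrite invr0 !scale0r /inv scaler0.
rewrite /inv nrm2Z !scalerA; congr (_ *: _).
have [->|c0] := eqVneq (nrm2 c) 0; first by rewrite mulr0 invr0 mul0r mulr0.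
by field; rewrite s0 c0.
Qed.

Lemma inv_eq0 c : inv c = 0 -> c = 0.
Proof. by move=> /(congr1 inv); rewrite invK /inv scaler0. Qed.

Lemma enorm_inv c : enorm (inv c) = (enorm c)^-1.
Proof. by rewrite /enorm nrm2_inv sqrtrV // nrm2_ge0. Qed.

Lemma enorm_gt0 c : c <> 0 -> 0 < enorm c.
Proof. exact: (rn_gt0 (enorm_row_norm R k)). Qed.

Lemma enorm_invB a b : a <> 0 -> b <> 0 -> enorm (inv a - inv b) = enorm (a - b) / (enorm a * enorm b).
Proof.
move=> a0 b0; have na := nrm2_gt0 a0; have nb := nrm2_gt0 b0.
rewrite /enorm -sqrtrM ?nrm2_ge0 // -sqrtrV ?mulr_ge0 ?nrm2_ge0 // -sqrtrM ?nrm2_ge0 //.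
congr Num.sqrt; rewrite !nrm2B !nrm2_inv /inv dotZl dotZr.
by field; rewrite !gt_eqF.
Qed.

End Inversion.

(** * Convexity of the complement and half-spaces *)

Section Classification.
Variables (R : realType) (X : Type) (dl : X -> X -> R) (U : set_system nat).
Hypothesis pc : ptolemy_compact U dl.
Hypothesis hr : has_rays dl.
Let UU : UltraFilter U. Proof. exact: pc_ultra pc. Qed.
Let PF : ProperFilter U. Proof. exact: (@ultra_proper _ _ UU). Qed.
#[local] Existing Instance PF.
Notation rho := (rho dl).
Variable k : nat.

Section OneRepresentation.
Variables (w : X) (Psi : X -> 'rV[R]_k).
Hypothesis er : erep dl w Psi.
Notation S := (image_off w Psi).
Let rn : row_norm (@enorm R k) := enorm_row_norm R k.

Lemma erep_affine i : btw_affine dl w (fun x => Psi x ord0 i).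
Proof.
move=> x y z xw yw zw; rewrite !(er_iso er) // => h.
have /(congr1 (fun m : 'rV[R]_k => m ord0 i)) := enorm_strict h.
by move: (enorm _) (enorm _) (enorm _) => n1 n2 n3; rewrite !mxE => e; lra.
Qed.

Lemma erep_ray : ray_closed S.
Proof.
move=> c c' [x xw <-] [y yw <-] ne.
have xy : x <> y by move=> e; apply: ne; rewrite e.
have [g [s [s1 hg]]] := btw_affine_ray pc hr xw yw xy.
have key t : 0 <= t -> S (Psi x + (s * t) *: (Psi y - Psi x)).
  move=> t0; have [gw hgt] := hg t t0; exists (g t) => //.
  by apply/rowP => i; rewrite !mxE (hgt _ (erep_affine i)); ring.
case: s1 key => -> key; [left|right] => t t0; have := key t t0; first by rewrite mul1r.
by rewrite mulN1r scaleNr.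
Qed.

Lemma erep_limit (x : nat -> X) c : (forall m, x m <> w) ->
  (forall m, enorm (c - Psi (x m)) <= 1) ->
  exists2 y, y <> w & enorm (Psi y - Psi (x m)) @[m --> U] --> (0 : R).
Proof.
move=> xw h.
have [y xy] := pc_limit pc x.
have [u0 [u0w _]] := third_point pc w w.
have yw : y <> w.
  apply: (@bounded_limit _ _ _ _ pc w u0 u0w x (enorm (Psi u0 - c) + 1)) => // m.
  rewrite (er_iso er) //; apply: le_trans (rn_triB rn _ _ c) _.
  by rewrite lerD2l.
exists y => //.
have : rho w y (x m) @[m --> U] --> (0 : R).
  by rewrite -(rhoxx pc w y); apply: (cvg_rho pc) => //; apply: cvg_dl_cst pc _.
by under eq_fun do rewrite (er_iso er) //.
Qed.

Lemma erep_closed : norm_closed (@enorm R k) S.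
Proof.
move=> c hc.
have /choice[x hx] : forall m : nat, exists x, x <> w /\ enorm (c - Psi x) < m.+1%:R^-1.
  move=> m; have e0 : 0 < m.+1%:R^-1 :> R by rewrite invr_gt0 ltr0n.
  by have [c' [x sx <-] lt] := hc _ e0; exists x.
have [m|m|y yw cy] := @erep_limit x c; first by case: (hx m).
  by apply: le_trans (ltW (hx m).2) _; rewrite invf_le1 ?ltr0n // ler1n.
exists y => //; apply/eqP; rewrite -subr_eq0; apply/eqP/(rn_def rn)/eqP; rewrite eq_le (rn_ge0 rn) andbT.
have -> : (0 : R) = 0 + 0 by rewrite addr0.
apply: (ultra_cvg_le UU (@cvg_cst _ (enorm (Psi y - c)) _ U _) (cvgD cy (@ultra_harmonic R U (pc_cofinite pc)))).
apply: filterS filterT => m _ /=; have [_ lt] := hx m.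
apply: le_trans (rn_triB rn _ _ (Psi (x m))) _.
by rewrite lerD2l (rnC rn) ltW.
Qed.

Lemma erep_ray_all u v : S u -> (forall t, 0 <= t -> S (u + t *: v)) \/ (forall t, 0 <= t -> S (u - t *: v)).
Proof. by have [c [r [r0 h]]] := er_int er; apply: (ray_closed_all rn erep_closed erep_ray r0 h). Qed.

(** A ray of the image from a point of the segment, along or against [b - a], would run into [b] or
    [a]. *)
Lemma erep_compl_convex a b t : ~ S a -> ~ S b -> 0 <= t <= 1 -> ~ S (a + t *: (b - a)).
Proof.
move=> na nb /andP[t0 t1] Sm.
case: (erep_ray_all (b - a) Sm) => h.
  apply: nb; have := h (1 - t); rewrite subr_ge0 => /(_ t1).
  by have -> : a + t *: (b - a) + (1 - t) *: (b - a) = b by apply/rowP => i; rewrite !mxE; ring.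
by apply: na; have := h t t0; rewrite addrK.
Qed.

Lemma erep_nearest o : exists2 z, S z & forall c, S c -> enorm (z - o) <= enorm (c - o).
Proof.
pose E := [set r | exists2 c, S c & r = enorm (c - o)].
have [u0 [u0w _]] := third_point pc w w.
have Einf : has_inf E.
  split; first by exists (enorm (Psi u0 - o)), (Psi u0) => //; exists u0.
  by exists 0 => r [c _ ->]; exact: enorm_ge0.
have inf_le c : S c -> inf E <= enorm (c - o).
  by move=> Sc; apply: ge_inf; [exact: Einf.2|exists c].
have /choice[x hx] : forall m : nat, exists x, x <> w /\ enorm (Psi x - o) <= inf E + m.+1%:R^-1.
  move=> m; have e0 : 0 < m.+1%:R^-1 :> R by rewrite invr_gt0 ltr0n.
  have [_ [_ [x xw <-] ->] lt] := inf_adherent e0 Einf.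
  by exists x; split=> //; exact: ltW.
have [y yw cy] : exists2 y, y <> w & enorm (Psi y - Psi (x m)) @[m --> U] --> (0 : R).
  pose B := inf E + 1.
  have B0 : 0 <= inf E by apply: lb_le_inf; [exact: Einf.1|move=> r [c _ ->]; exact: enorm_ge0].
  have [y xy] := pc_limit pc x.
  have yw : y <> w.
    apply: (@bounded_limit _ _ _ _ pc w u0 u0w x (enorm (Psi u0 - o) + B)) => // m; first by case: (hx m).
    have [xw h] := hx m; rewrite (er_iso er) //; apply: le_trans (rn_triB rn _ _ o) _.
    rewrite lerD2l (rnC rn); apply: le_trans h _.
    by rewrite /B lerD2l invf_le1 ?ltr0n // ler1n.
  exists y => //.
  have : rho w y (x m) @[m --> U] --> (0 : R).
    by rewrite -(rhoxx pc w y); apply: (cvg_rho pc) => //; apply: cvg_dl_cst pc _.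
  by under eq_fun do rewrite (er_iso er yw (hx _).1).
exists (Psi y); first by exists y.
move=> c /inf_le; apply: le_trans.
have -> : inf E = 0 + (inf E + 0) by rewrite addr0 add0r.
apply: (ultra_cvg_le UU (@cvg_cst _ (enorm (Psi y - o)) _ U _)
  (cvgD cy (cvgD (@cvg_cst _ (inf E) _ U _) (@ultra_harmonic R U (pc_cofinite pc))))).
apply: filterS filterT => m _ /=.
by apply: le_trans (rn_triB rn _ _ (Psi (x m))) _; rewrite lerD2l; case: (hx m).
Qed.

Variable x0 : X.
Hypothesis x0w : x0 <> w.

(** Euclidean inversion at [Psi x0]: [w] becomes the origin and [x0] goes to infinity. The factor
    comes from [rho_change]; the value at [x0] is junk. *)
Definition invrep (x : X) : 'rV[R]_k :=
  if pselect (x = w) then 0 else (dl w x0 ^+ 2)^-1 *: inv (Psi x - Psi x0).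

Lemma Psi_neq x y : x <> w -> y <> w -> x <> y -> Psi x - Psi y <> 0.
Proof.
move=> xw yw xy h; have := rho_gt0 pc xw yw xy.
by rewrite (er_iso er) // h (rn0 rn) ltxx.
Qed.

Lemma invrep_image c : c <> 0 -> image_off x0 invrep c <-> S (Psi x0 + inv (dl w x0 ^+ 2 *: c)).
Proof.
move=> c0; have kap : dl w x0 ^+ 2 != 0 by rewrite expf_neq0 //; exact: (dl_neq0 pc (nesym x0w)).
split=> [[x xx0]|[x xw Px]].
  rewrite /invrep; case: pselect => [_ /esym //|xw <-] /=.
  by rewrite scalerA mulfV // scale1r invK addrC subrK; exists x.
have PxB : Psi x - Psi x0 = inv (dl w x0 ^+ 2 *: c) by rewrite Px addrC addKr.
exists x.
  move=> xx0; move: PxB; rewrite xx0 subrr => /esym/inv_eq0/eqP.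
  by rewrite scaler_eq0 (negbTE kap) => /eqP.
by rewrite /invrep; case: pselect => //= ?; rewrite PxB invK scalerA mulVf // scale1r.
Qed.

Lemma invrep_erep : (0 < k)%N -> erep dl x0 invrep.
Proof.
move=> k0; have wx0 := nesym x0w.
set kap := dl w x0 ^+ 2.
have kap0 : 0 < kap by rewrite exprn_gt0 // (dl_gt0 pc).
split.
  have infx x : x <> x0 -> x <> w -> rho x0 x w = enorm (invrep x - 0).
    move=> xx0 xw; rewrite (rho_change_infty pc) // /invrep; case: pselect => //= ?.
    by rewrite subr0 (rn_hom rn) gtr0_norm ?invr_gt0 // enorm_inv -(er_iso er) // invfM.
  have iw : invrep w = 0 by rewrite /invrep; case: pselect.
  move=> x y xx0 yx0.
  have [xw|xw] := pselect (x = w).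
    have [yw|yw] := pselect (y = w); first by rewrite xw yw (rhoxx pc) subrr (rn0 rn).
    by rewrite xw (rhoC pc) infx // iw (rnC rn).
  have [yw|yw] := pselect (y = w); first by rewrite yw infx // iw.
  rewrite (rho_change pc wx0) // /invrep; case: pselect => //= ?; case: pselect => //= ?.
  rewrite -scalerBr (rn_hom rn) gtr0_norm ?invr_gt0 // enorm_invB; try exact: Psi_neq.
  rewrite opprB addrA subrK -!(er_iso er) //.
  by rewrite invfM mulrCA.
have [c [r [r0 hc]]] := er_int er.
(* The inversion is centred at [Psi x0], so a ball with another centre is needed. *)
have [c1 [r1 [r10 [ne hc1]]]] : exists c1 r1, 0 < r1 /\ c1 <> Psi x0 /\ forall x, enorm (x - c1) < r1 -> S x.
  have [cx|cx] := pselect (c = Psi x0); last by exists c, r.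
  pose d : 'rV[R]_k := delta_mx ord0 (Ordinal k0).
  have nd : enorm d = 1 by rewrite /enorm -dot_nrm2 dot_delta eqxx sqrtr1.
  exists (c + (r / 2) *: d), (r / 2); split; first by rewrite divr_gt0.
  split.
    rewrite cx => /(congr1 (fun z => enorm (z - Psi x0))); rewrite subrr addrAC subrr add0r (rn0 rn) (rn_hom rn) nd mulr1.
    by rewrite gtr0_norm ?divr_gt0 //; lra.
  move=> x hx; apply: hc; have := rn_triB rn x c (c + (r / 2) *: d).
  rewrite [c + _ - c]addrAC subrr add0r (rn_hom rn) nd mulr1 gtr0_norm ?divr_gt0 //; lra.
pose d := c1 - Psi x0.
have d0 : d <> 0 by move=> h; apply: ne; apply/eqP; rewrite -subr_eq0 -/d h.
pose c' := kap^-1 *: inv d.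
have c'0 : c' <> 0.
  by move=> /eqP; rewrite scaler_eq0 invr_eq0 gt_eqF //= => /eqP/inv_eq0.
have nc' := enorm_gt0 c'0.
(* The first bound keeps [z] away from [0]; with it, the second keeps the inverted point within [r1]
   of [c1]. *)
pose r' := Num.min (enorm c' / 2) (kap * enorm c' ^+ 2 * r1 / 4).
have r'0 : 0 < r'.
  rewrite lt_min divr_gt0 //= divr_gt0 // mulr_gt0 // mulr_gt0 // exprn_gt0 //.
exists c', r'; split=> // z; rewrite lt_min => /andP[z1 z2].
have nz : enorm c' / 2 < enorm z.
  by have := rn_triB rn c' 0 z; rewrite !subr0 (rnC rn); lra.
have z0 : z <> 0 by move=> h; move: nz; rewrite h (rn0 rn); lra.
apply/(invrep_image z0)/hc1; rewrite -/kap.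
have kz : kap *: z <> 0 by move=> /eqP; rewrite scaler_eq0 gt_eqF //= => /eqP.
have kc' : kap *: c' <> 0 by move=> /eqP; rewrite scaler_eq0 gt_eqF //= => /eqP.
have -> : Psi x0 + inv (kap *: z) - c1 = inv (kap *: z) - inv (kap *: c').
  have -> : inv (kap *: c') = d by rewrite /c' scalerA mulfV ?gt_eqF // scale1r invK.
  by rewrite /d opprB addrA [Psi x0 + _]addrC.
have zz0 := enorm_gt0 z0.
rewrite enorm_invB // -scalerBr (rn_hom rn kap (z - c')) (rn_hom rn kap z) (rn_hom rn kap c') (gtr0_norm kap0).
rewrite (ltr_pdivrMr _ _ (mulr_gt0 (mulr_gt0 kap0 zz0) (mulr_gt0 kap0 nc'))).
have : kap * enorm (z - c') < kap * (kap * enorm c' ^+ 2 * r1 / 4) by rewrite ltr_pM2l.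
move=> /lt_trans; apply.
have pos : 0 < r1 * (kap * kap) * enorm c' := mulr_gt0 (mulr_gt0 r10 (mulr_gt0 kap0 kap0)) nc'.
have : r1 * (kap * kap) * enorm c' * (enorm c' / 2) < r1 * (kap * kap) * enorm c' * enorm z by rewrite ltr_pM2l.
have : 0 < r1 * (kap * kap) * enorm c' * enorm c' by rewrite mulr_gt0.
lra.
Qed.

End OneRepresentation.

(* Convexity of the complement seen from [u], where [0] is a limit of complement points. *)
Lemma unbounded_compl_convex w (Psi : X -> 'rV[R]_k) q : (0 < k)%N -> erep dl w Psi ->
  (forall s, 1 <= s -> ~ image_off w Psi (s *: q)) -> q <> 0 ->
  forall u v s, image_off w Psi u -> image_off w Psi v -> 0 < s < 1 -> image_off w Psi (u + s *: (v - u)).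
Proof.
move=> k0 er hq q0 u v s Su Sv /andP[s0 s1]; apply: contrapT => no.
have rn := enorm_row_norm R k.
have [xu xuw Pu] := Su.
have er' := invrep_erep er xuw k0.
set kap := dl w xu ^+ 2.
have kap0 : 0 < kap := exprn_gt0 2 (dl_gt0 pc (nesym xuw)).
have kapn : kap != 0 by rewrite gt_eqF.
have sn : s != 0 by rewrite gt_eqF.
have uv : v - u <> 0.
  by move=> h; apply: no; rewrite h scaler0 addr0.
pose S' := image_off xu (invrep w Psi xu).
have im c : c <> 0 -> S' c <-> image_off w Psi (u + inv (kap *: c)) by rewrite -Pu; exact: invrep_image.
clearbody kap.
pose v' := kap^-1 *: inv (v - u).
have v'0 : v' <> 0.
  by move=> /eqP; rewrite scaler_eq0 invr_eq0 (negbTE kapn) => /eqP/inv_eq0.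
have Sv' : S' v'.
  by apply/(im _ v'0); rewrite /v' scalerA mulfV // scale1r invK addrC subrK.
(* Under the inversion at [u], [o'] corresponds to [u + s *: (v - u)] and [v'] to [v]. *)
pose o' := s^-1 *: v'.
have o'0 : o' <> 0 by move=> /eqP; rewrite scaler_eq0 invr_eq0 (negbTE sn) => /eqP.
have no' : ~ S' o'.
  have nuv : nrm2 (v - u) != 0 by rewrite gt_eqF // nrm2_gt0.
  have e : kap *: o' = s^-1 *: inv (v - u).
    by rewrite /o' /v' !scalerA; congr (_ *: _); field; rewrite kapn sn nuv.
  by move=> /(im _ o'0); rewrite e invZ invK invrK.
have [e e0 he] := norm_open rn (erep_closed er') no'.
have nq := enorm_gt0 q0.
(* A complement point [t *: q] at distance more than [M] from [u] is inverted to a point [y] with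
   [(1 - s) / s * enorm y < e]. *)
pose M := (1 - s) / s * (kap^-1 / e).
have s10 : 0 < 1 - s by rewrite subr_gt0.
have M0 : 0 < M by rewrite mulr_gt0 ?divr_gt0 ?invr_gt0.
pose t := (M + enorm u + 1) / enorm q + 1.
have un := rn_ge0 rn u.
have t1 : 1 <= t.
  by rewrite /t lerDr divr_ge0 ?ltW //; lra.
have tq : M < enorm (t *: q - u).
  have h := rn_triB rn (t *: q) 0 u; rewrite !subr0 (rn_hom rn) ger0_norm ?(le_trans ler01) // in h.
  have : t * enorm q = M + enorm u + 1 + enorm q by rewrite /t mulrDl divfK ?gt_eqF // mul1r.
  lra.
have tqu : t *: q - u <> 0 by move=> h; move: tq; rewrite h (rn0 rn); lra.
pose y := kap^-1 *: inv (t *: q - u).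
have y0 : y <> 0.
  by move=> /eqP; rewrite scaler_eq0 invr_eq0 (negbTE kapn) => /eqP/inv_eq0.
have ny : ~ S' y.
  move=> /(im _ y0); rewrite /y scalerA mulfV // scale1r invK addrC subrK.
  exact: hq.
(* [a] solves [v' = y + s *: (a - y)] and is close to [o'], so convexity of the complement would
   exclude [v']. *)
pose a := o' - ((1 - s) / s) *: y.
have na : ~ S' a.
  apply: he; rewrite /a addrAC subrr add0r (rnN rn) (rn_hom rn) gtr0_norm ?divr_gt0 //.
  rewrite /y (rn_hom rn) gtr0_norm ?invr_gt0 // enorm_inv.
  have p : 0 < enorm (t *: q - u) := enorm_gt0 tqu.
  rewrite mulrA ltr_pdivrMr //.
  have -> : (1 - s) / s / kap = e * M by rewrite /M; field; rewrite sn kapn gt_eqF.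
  by rewrite ltr_pM2l.
have := erep_compl_convex er' ny na (t := s).
rewrite (ltW s0) (ltW s1) => /(_ isT); apply.
have comb (p p' : 'rV[R]_k) : p + s *: (s^-1 *: p' - ((1 - s) / s) *: p - p) = p'.
  by apply/rowP => i; rewrite !mxE; field.
by rewrite comb.
Qed.

(** At the point [z] nearest to [q], convexity of the image puts it in a half-space. If a point [c']
    of the open half-space were missing, so would be its reflection [2 *: z - c'], and convexity of
    the complement would exclude the midpoint [z]. *)
Lemma halfspace w (Psi : X -> 'rV[R]_k) q : erep dl w Psi -> ~ image_off w Psi q ->
  (forall u v s, image_off w Psi u -> image_off w Psi v -> 0 < s < 1 -> image_off w Psi (u + s *: (v - u))) ->
  exists z nu, nu <> 0 /\ forall c, image_off w Psi c <-> 0 <= dot (c - z) nu.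
Proof.
move=> er nq conv; have rn := enorm_row_norm R k.
have [z Sz hz] := erep_nearest er q.
exists z, (z - q).
have nu0 : z - q <> 0 by move=> h; apply: nq; rewrite -(subrK q z) h add0r in Sz.
have np := nrm2_gt0 nu0.
split=> //.
have imp c : image_off w Psi c -> 0 <= dot (c - z) (z - q).
  move=> Sc; rewrite leNgt; apply/negP => neg.
  have key s : 0 < s < 1 -> 0 <= 2 * dot (c - z) (z - q) + s * nrm2 (c - z).
    move=> /andP[s0 s1]; have := hz _ (conv _ _ s Sz Sc _); rewrite s0 s1 => /(_ isT).
    rewrite addrAC -ler_sqr ?nnegrE ?enorm_ge0 // !enorm2.
    rewrite (nrm2D (z - q) (s *: (c - z))) nrm2Z dotZr [dot (z - q) _]dotC => h.
    rewrite -(pmulr_rge0 _ s0); lra.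
  set b := nrm2 (c - z) in key; set a := dot _ _ in neg key.
  have b0 : 0 <= b := nrm2_ge0 _.
  (* With this [s] the term [s * b] is at most [- a], so that [2 * a + s * b <= a < 0]. *)
  pose s := - a / (b - a + 1).
  have den : 0 < b - a + 1 by lra.
  have := key s; rewrite /s ltr_pdivlMr // ltr_pdivrMr // mul0r mul1r.
  have -> : (0 < - a) && (- a < b - a + 1) by lra.
  move=> /(_ isT).
  have : - a / (b - a + 1) * b <= - a.
    by rewrite mulrAC ler_pdivrMr //; nra.
  lra.
move=> c; split; first exact: imp.
have pos c' : 0 < dot (c' - z) (z - q) -> image_off w Psi c'.
  move=> h; apply: contrapT => nc.
  have n2 : ~ image_off w Psi (2 *: z - c').
    move=> /imp; have -> : 2 *: z - c' - z = - (c' - z).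
      by rewrite scaler_nat mulr2n opprB addrAC addrK.
    by rewrite dotNl; lra.
  have := erep_compl_convex er nc n2 (t := 2^-1); rewrite invr_ge0 ler0n invf_le1 // ler1n => /(_ isT); apply.
  rewrite scalerBr scalerBr scalerA mulVf // scale1r.
  have -> : c' + (z - 2^-1 *: c' - 2^-1 *: c') = z => //.
  by apply/rowP => i; rewrite !mxE; field.
rewrite le_eqVlt => /orP[/eqP h0|]; last exact: pos.
apply: (erep_closed er) => e e0.
have nn := enorm_gt0 nu0.
exists (c + (e / (2 * enorm (z - q))) *: (z - q)).
  apply: pos; rewrite addrAC dotDl -h0 add0r dotZl dot_nrm2 mulr_gt0 // divr_gt0 // mulr_gt0 //.
rewrite opprD addNKr (rnN rn) (rn_hom rn) gtr0_norm ?divr_gt0 ?mulr_gt0 //.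
have -> : e / (2 * enorm (z - q)) * enorm (z - q) = e / 2 by field; rewrite gt_eqF.
lra.
Qed.

End Classification.

Lemma classification (R : realType) (X : Type) (dl : X -> X -> R) (U : set_system nat) :
  ptolemy_compact U dl -> has_rays dl ->
  exists k w (Psi : X -> 'rV[R]_k), (0 < k)%N /\ erep dl w Psi /\
    ((forall c, image_off w Psi c) \/
     exists z nu, nu <> 0 /\ forall c, image_off w Psi c <-> 0 <= dot (c - z) nu).
Proof.
move=> pc hr; have [k [w [Psi [k0 er]]]] := erep_exists pc hr.
have rn := enorm_row_norm R k.
have [all|] := pselect (forall c, image_off w Psi c); first by exists k, w, Psi; split=> //; split=> //; left.
move=> /existsNP[o no].
have [z Sz hz] := erep_nearest pc er o.
have oz : o - z <> 0 by move=> h; apply: no; rewrite -(subrK z o) h add0r.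
have [x0 x0w Pz] := Sz.
(* The segment from the nearest point [z] to [o] leaves the image at once; inversion at [z] turns it
   into the multiples [s *: q] with [1 <= s]. *)
have seg t : 0 < t -> t <= 1 -> ~ image_off w Psi (z + t *: (o - z)).
  move=> t0 t1 /hz.
  have -> : z + t *: (o - z) - o = (1 - t) *: (z - o).
    by apply/rowP => i; rewrite !mxE; ring.
  rewrite (rn_hom rn) ger0_norm ?subr_ge0 //.
  have : 0 < enorm (z - o) by rewrite (rnC rn); exact: enorm_gt0.
  nra.
have er' := invrep_erep pc er x0w k0.
set kap := dl w x0 ^+ 2.
have kapn : kap != 0 by rewrite expf_neq0 //; exact: (dl_neq0 pc (nesym x0w)).
pose q := kap^-1 *: inv (o - z).
have q0 : q <> 0.
  by move=> /eqP; rewrite scaler_eq0 invr_eq0 (negbTE kapn) => /eqP/inv_eq0.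
have hq s : 1 <= s -> ~ image_off x0 (invrep dl w Psi x0) (s *: q).
  move=> s1; have s0 : 0 < s by lra.
  have sq0 : s *: q <> 0 by move=> /eqP; rewrite scaler_eq0 gt_eqF //= => /eqP.
  have e : kap *: (s *: q) = s *: inv (o - z).
    by rewrite scalerA mulrC -scalerA /q [kap *: (kap^-1 *: _)]scalerA mulfV // scale1r.
  move=> /(invrep_image pc Psi x0w sq0); rewrite Pz -/kap e invZ invK.
  by apply: seg; rewrite ?invr_gt0 // invf_le1.
exists k, x0, (invrep dl w Psi x0); split=> //; split=> //; right.
apply: (halfspace pc hr er' (q := q)); first by rewrite -(scale1r q); exact: hq.
exact: (unbounded_compl_convex pc hr k0 er' hq q0).
Qed.

(** * Stereographic projection *)

Section Stereographic.
Variables (R : realType) (k : nat).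
Implicit Types c : 'rV[R]_k.

Definition cons_row (a : R) c : 'rV[R]_k.+1 := \row_i if unlift ord0 i is Some j then c ord0 j else a.
Definition tail_row (u : 'rV[R]_k.+1) : 'rV[R]_k := \row_j u ord0 (lift ord0 j).

Lemma cons_row0 a c : cons_row a c ord0 ord0 = a.
Proof. by rewrite mxE unlift_none. Qed.

Lemma cons_rowS a c j : cons_row a c ord0 (lift ord0 j) = c ord0 j.
Proof. by rewrite mxE liftK. Qed.

Lemma cons_tail (u : 'rV[R]_k.+1) : cons_row (u ord0 ord0) (tail_row u) = u.
Proof. by apply/rowP => i; rewrite mxE; case: unliftP => [j|] -> //; rewrite mxE. Qed.

Lemma nrm2_cons a c : nrm2 (cons_row a c) = a ^+ 2 + nrm2 c.
Proof. by rewrite /nrm2 big_ord_recl cons_row0; congr (_ + _); apply: eq_bigr => j _; rewrite cons_rowS. Qed.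

Lemma cons_rowB a b c c' : cons_row a c - cons_row b c' = cons_row (a - b) (c - c').
Proof. by apply/rowP => i; rewrite !mxE; case: unliftP => [j|] _ //; rewrite !mxE. Qed.

Lemma euclE (u v : 'rV[R]_k.+1) : eucl u v = enorm (u - v).
Proof. by congr Num.sqrt; apply: eq_bigr => i _; rewrite !mxE. Qed.

(** The axis of projection is coordinate [ord0], so the last coordinate keeps its sign and the
    hemisphere corresponds to a half-space. *)
Definition stereo c : 'rV[R]_k.+1 :=
  cons_row ((nrm2 c - 1) / (nrm2 c + 1)) ((2 / (nrm2 c + 1)) *: c).
Definition pole : 'rV[R]_k.+1 := cons_row 1 0.

Lemma nrm2_stereo c : nrm2 (stereo c) = 1.
Proof.
have n0 := nrm2_ge0 c; rewrite nrm2_cons nrm2Z; field.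
by apply/eqP; lra.
Qed.

Lemma nrm2_pole : nrm2 pole = 1.
Proof. by rewrite nrm2_cons nrm2_0 addr0 expr1n. Qed.

Lemma eucl_stereo c c' : eucl (stereo c) (stereo c') =
  2 * enorm (c - c') / (Num.sqrt (1 + nrm2 c) * Num.sqrt (1 + nrm2 c')).
Proof.
have n0 := nrm2_ge0 c; have n'0 := nrm2_ge0 c'.
have p : 0 < 1 + nrm2 c by lra.
have p' : 0 < 1 + nrm2 c' by lra.
have s : 0 < Num.sqrt (1 + nrm2 c) by rewrite sqrtr_gt0.
have s' : 0 < Num.sqrt (1 + nrm2 c') by rewrite sqrtr_gt0.
have y0 : 0 <= 2 * enorm (c - c') / (Num.sqrt (1 + nrm2 c) * Num.sqrt (1 + nrm2 c')).
  by rewrite divr_ge0 // ?mulr_ge0 ?enorm_ge0 ?sqrtr_ge0.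
apply/eqP; rewrite euclE -(eqrXn2 (n := 2) _ (enorm_ge0 _) y0) //.
rewrite expr_div_n !exprMn !enorm2 !sqr_sqrtr ?(ltW p) ?(ltW p') //.
rewrite cons_rowB nrm2_cons !nrm2B !nrm2Z dotZl dotZr; apply/eqP; field.
by apply/andP; split; apply/eqP; lra.
Qed.

Lemma eucl_stereo_pole c : eucl (stereo c) pole = 2 / Num.sqrt (1 + nrm2 c).
Proof.
have n0 := nrm2_ge0 c.
have p : 0 < 1 + nrm2 c by lra.
have s : 0 < Num.sqrt (1 + nrm2 c) by rewrite sqrtr_gt0.
have y0 : 0 <= 2 / Num.sqrt (1 + nrm2 c) by rewrite divr_ge0 // ltW.
apply/eqP; rewrite euclE -(eqrXn2 (n := 2) _ (enorm_ge0 _) y0) //.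
rewrite expr_div_n !enorm2 !sqr_sqrtr ?(ltW p) //.
rewrite cons_rowB nrm2_cons subr0 nrm2Z; apply/eqP; field.
by apply/eqP; lra.
Qed.

Lemma sphere_stereo (u : 'rV[R]_k.+1) : nrm2 u = 1 -> u = pole \/ u = stereo ((1 - u ord0 ord0)^-1 *: tail_row u).
Proof.
rewrite -{1}[u]cons_tail nrm2_cons; set a := u ord0 ord0; set t := tail_row u => h.
have [a1|a1] := eqVneq a 1.
  left; rewrite -[u]cons_tail -/a -/t a1; congr cons_row.
  by apply: nrm2_eq0; move: h; rewrite a1; lra.
right; have d : 1 - a != 0 by rewrite subr_eq0 eq_sym.
have -> : u = cons_row a t by rewrite cons_tail.
have nt : nrm2 t = 1 - a ^+ 2 by lra.
have e : nrm2 ((1 - a)^-1 *: t) = (1 + a) / (1 - a) by rewrite nrm2Z nt; field.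
rewrite /stereo e scalerA; congr cons_row.
  have n1 : nrm2 ((1 - a)^-1 *: t) + 1 = 2 / (1 - a) by rewrite e; field.
  by rewrite -e n1 e; field.
have n1 : (1 + a) / (1 - a) + 1 = 2 / (1 - a) by field.
by rewrite n1 -[LHS]scale1r; congr (_ *: _); field.
Qed.

End Stereographic.

Section Householder.
Variables (R : realType) (k : nat).
Variable d : 'rV[R]_k.

(* For [d = 0] the quotient is [0] and [reflect] is the identity. *)
Definition reflect (v : 'rV[R]_k) : 'rV[R]_k := v - (2 * dot v d / nrm2 d) *: d.

Lemma reflectB u v : reflect (u - v) = reflect u - reflect v.
Proof. by rewrite /reflect dotBl; apply/rowP => i; rewrite !mxE; ring. Qed.

Lemma dot_reflect v : dot (reflect v) d = - dot v d.
Proof.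
rewrite /reflect dotBl dotZl dot_nrm2.
have [d0|d0] := eqVneq (nrm2 d) 0; last by rewrite divfK //; ring.
have -> : d = 0 by exact: nrm2_eq0.
by rewrite -(scale0r (0 : 'rV[R]_k)) dotZr; ring.
Qed.

Lemma reflectK : involutive reflect.
Proof.
move=> v; rewrite {1}/reflect dot_reflect /reflect.
by apply/rowP => i; rewrite !mxE; ring.
Qed.

Lemma enorm_reflect v : enorm (reflect v) = enorm v.
Proof.
congr Num.sqrt; have [d0|d0] := eqVneq (nrm2 d) 0.
  by rewrite /reflect d0 invr0 mulr0 scale0r subr0.
by rewrite /reflect nrm2B nrm2Z dotZr; field.
Qed.

End Householder.

(** The reflection exchanges the unit vectors [eta] and [e], which moves the normal of a half-space
    to the last basis vector. *)
Lemma dot_reflect_swap (R : realType) k (eta e v : 'rV[R]_k) : nrm2 eta = 1 -> nrm2 e = 1 ->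
  dot (reflect (eta - e) v) e = dot v eta.
Proof.
move=> n1 n2; have [d0|d0] := eqVneq (nrm2 (eta - e)) 0.
  have /eqP := nrm2_eq0 d0; rewrite subr_eq0 => /eqP ->.
  rewrite /reflect subrr nrm2_0 invr0 mulr0 scale0r subr0 //.
have h : nrm2 (eta - e) = 2 - 2 * dot eta e by rewrite nrm2B n1 n2; ring.
rewrite /reflect dotBl dotZl dotBl dot_nrm2 n2 (dotC v (eta - e)) dotBl (dotC eta v) (dotC e v).
rewrite h; field; by rewrite -h.
Qed.

Lemma sphere_or_hemisphere (R : realType) (X : Type) (dl : X -> X -> R) (U : set_system nat) :
  ptolemy_compact U dl -> has_rays dl ->
  exists (n : nat) (f : X -> 'rV[R]_n.+1) (mu : X -> R), injective f /\ (forall x, 0 < mu x) /\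
    (forall x y, eucl (f x) (f y) = mu x * mu y * dl x y) /\
    (f @` setT = @sphere R n \/ f @` setT = @hemisphere R n).
Proof.
move=> pc hr; have [k [w [Psi0 [k0 [er0 cl]]]]] := classification pc hr.
case: k k0 Psi0 er0 cl => // k _ Psi0 er0 cl.
have [Psi [iso cls]] : exists Psi : X -> 'rV[R]_k.+1,
    (forall x y, x <> w -> y <> w -> rho dl w x y = enorm (Psi x - Psi y)) /\
    ((forall c, image_off w Psi c) \/ forall c, image_off w Psi c <-> 0 <= c ord0 ord_max).
  case: cl => [all|[z [nu [nu0 hs]]]].
    by exists Psi0; split; [exact: er_iso er0|left].
  pose eta := (enorm nu)^-1 *: nu; pose e : 'rV[R]_k.+1 := delta_mx ord0 ord_max.
  have ne := enorm_gt0 nu0.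
  have n1 : nrm2 eta = 1 by rewrite nrm2Z -enorm2 -exprMn mulVf ?expr1n // gt_eqF.
  have n2 : nrm2 e = 1 by rewrite -dot_nrm2 dot_delta eqxx.
  have le (v : 'rV[R]_k.+1) : v ord0 ord_max = dot v e.
    rewrite /dot (bigD1 ord_max) //= big1 => [|i ie]; last by rewrite mxE eqxx (negbTE ie) mulr0.
    by rewrite mxE !eqxx mulr1 addr0.
  pose H := reflect (eta - e).
  have key v : 0 <= (H v) ord0 ord_max <-> 0 <= dot v nu.
    by rewrite le /H dot_reflect_swap // dotZr pmulr_rge0 // invr_gt0.
  exists (fun x => H (Psi0 x - z)); split.
    move=> x y xw yw; rewrite -reflectB enorm_reflect opprB addrA subrK.
    exact: er_iso er0 _ _ xw yw.
  right=> c; split=> [[x xw <-]|hc].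
    by apply/key/hs; exists x.
  have /hs [x xw ex] : 0 <= dot (H c + z - z) nu.
    by rewrite addrK; apply/key; rewrite /H reflectK.
  by exists x => //; rewrite ex addrK /H reflectK.
pose f x := if pselect (x = w) then pole R k.+1 else stereo (Psi x).
(* The factor [2] of the chordal distance is shared equally between the two points. *)
pose r2 : R := Num.sqrt 2.
have r2p : 0 < r2 by rewrite sqrtr_gt0.
have r22 : r2 * r2 = 2 by rewrite -expr2 sqr_sqrtr.
pose mu x := if pselect (x = w) then r2 else r2 / (Num.sqrt (1 + nrm2 (Psi x)) * dl x w).
have sp x : 0 < Num.sqrt (1 + nrm2 (Psi x)) by rewrite sqrtr_gt0; have := nrm2_ge0 (Psi x); lra.
have fw : f w = pole R k.+1 by rewrite /f; case: pselect.
have fE x : x <> w -> f x = stereo (Psi x) by rewrite /f; case: pselect.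
have muw : mu w = r2 by rewrite /mu; case: pselect.
have muE x : x <> w -> mu x = r2 / (Num.sqrt (1 + nrm2 (Psi x)) * dl x w) by rewrite /mu; case: pselect.
have mu0 x : 0 < mu x.
  have [->|xw] := pselect (x = w); first by rewrite muw.
  by rewrite muE // divr_gt0 // mulr_gt0 // (dl_gt0 pc).
have euclC (u v : 'rV[R]_k.+2) : eucl u v = eucl v u.
  by rewrite !euclE (rnC (enorm_row_norm R _)).
have main x y : eucl (f x) (f y) = mu x * mu y * dl x y.
  have infw z : z <> w -> eucl (f z) (f w) = mu z * mu w * dl z w.
    move=> zw; rewrite fE // fw eucl_stereo_pole muE // muw.
    rewrite -r22; field; rewrite (dl_neq0 pc zw) gt_eqF //.
  have [->|xw] := pselect (x = w); have [->|yw] := pselect (y = w).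
  - by rewrite euclE subrr (rn0 (enorm_row_norm R _)) (dlxx pc) mulr0.
  - by rewrite euclC infw // (pc_sym pc w y); ring.
  - exact: infw.
  rewrite !fE // eucl_stereo -iso // !muE // /rho -r22; field.
  by rewrite (dl_neq0 pc xw) (dl_neq0 pc yw) !gt_eqF.
have inj : injective f.
  move=> x y fxy; apply/(pc_eq0 pc); have := main x y.
  rewrite fxy euclE subrr (rn0 (enorm_row_norm R _)) => /esym/eqP.
  by rewrite mulf_eq0 (gt_eqF (mulr_gt0 (mu0 x) (mu0 y))) => /eqP.
have sphE (u : 'rV[R]_k.+2) : @sphere R k.+1 u <-> nrm2 u = 1 by [].
have fS x : nrm2 (f x) = 1.
  have [->|xw] := pselect (x = w); first by rewrite fw nrm2_pole.
  by rewrite fE // nrm2_stereo.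
have last_pole : (pole R k.+1) ord0 ord_max = 0.
  have -> : (ord_max : 'I_k.+2) = lift ord0 (ord_max : 'I_k.+1) by apply: val_inj.
  by rewrite cons_rowS mxE.
have last_stereo (c : 'rV[R]_k.+1) : (0 <= (stereo c) ord0 (ord_max : 'I_k.+2)) = (0 <= c ord0 (ord_max : 'I_k.+1)).
  have -> : (ord_max : 'I_k.+2) = lift ord0 (ord_max : 'I_k.+1) by apply: val_inj.
  rewrite cons_rowS mxE pmulr_rge0 // divr_gt0 //.
  by have := nrm2_ge0 c; lra.
exists k.+1, f, mu; split=> //; split=> //; split=> //.
case: cls => cls; [left|right]; apply/seteqP; split.
- by move=> u [x _ <-]; exact/sphE.
- move=> u /sphE/sphere_stereo[->|->]; first by exists w.
  by have [x xw <-] := cls ((1 - u ord0 ord0)^-1 *: tail_row u); exists x; rewrite ?fE.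
- move=> u [x _ <-]; split; first exact/sphE.
  have [->|xw] := pselect (x = w); first by rewrite fw last_pole.
  by rewrite fE // last_stereo; apply/cls; exists x.
- move=> u [/sphE/sphere_stereo[->|->]]; first by exists w.
  rewrite last_stereo => /cls[x xw <-]; exists x => //.
  by rewrite fE.
Qed.
(** The triangle inequality of the bounded metric when the remote point is an endpoint; in
    [ler_frac_add] it is the middle point. *)
Lemma ler_frac_inv (R : realType) (a p q : R) : 0 < p -> 0 < q -> p <= q + a -> q^-1 <= p^-1 + a / (p * q).
Proof.
move=> p0 q0 h; rewrite -(ler_pM2r (mulr_gt0 p0 q0)).
have -> : q^-1 * (p * q) = p by field; rewrite gt_eqF.
have -> // : (p^-1 + a / (p * q)) * (p * q) = q + a.
by field; rewrite !gt_eqF.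
Qed.

Lemma ler_frac_add (R : realType) (a p q : R) : 0 < p -> 0 < q -> a <= p + q -> a / (p * q) <= p^-1 + q^-1.
Proof.
move=> p0 q0 h; rewrite -(ler_pM2r (mulr_gt0 p0 q0)) divfK ?gt_eqF ?mulr_gt0 //.
have -> // : (p^-1 + q^-1) * (p * q) = p + q.
by field; rewrite !gt_eqF.
Qed.

(** * The bounded metric *)

Section BoundedMetric.
Variables (R : realType) (X : Type) (d : X -> X -> \bar R) (Om : set X).
Hypothesis em : ext_metric d Om.

Lemma dd_fin x y : ~ Om x -> ~ Om y -> d x y = (dd d Om x y)%:E.
Proof.
move=> nx ny; rewrite /dd !memNset // fineK //.
by case: em => _ [_ [h _]]; exact: h.
Qed.

Lemma dd_inl x y : Om x -> ~ Om y -> dd d Om x y = 1.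
Proof. by move=> nx ny; rewrite /dd mem_set // memNset. Qed.

Lemma dd_inr x y : ~ Om x -> Om y -> dd d Om x y = 1.
Proof. by move=> nx ny; rewrite /dd memNset // mem_set. Qed.

Lemma ddxx x : dd d Om x x = 0.
Proof.
have [ox|nx] := pselect (Om x); first by rewrite /dd mem_set.
have [_ [_ [_ [_ [h _]]]]] := em.
by apply: EFin_inj; rewrite -dd_fin // (h x x nx nx).2.
Qed.

Lemma Om_unique x y : Om x -> Om y -> x = y.
Proof. by case: em => h _; exact: h. Qed.

Lemma ddC x y : dd d Om x y = dd d Om y x.
Proof.
have [ox|nx] := pselect (Om x); have [oy|ny] := pselect (Om y).
- by rewrite (Om_unique ox oy).
- by rewrite (dd_inl ox ny) (dd_inr ny ox).
- by rewrite (dd_inr nx oy) (dd_inl oy nx).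
have [_ [_ [_ [h _]]]] := em.
by apply: EFin_inj; rewrite -!dd_fin // h.
Qed.

Lemma dd_ge0 x y : 0 <= dd d Om x y.
Proof.
rewrite /dd; case: ifP => _; case: ifP => _ //.
by apply: fine_ge0; case: em => _ [].
Qed.

Lemma dd_eq0 x y : dd d Om x y = 0 -> x = y.
Proof.
have [ox|nx] := pselect (Om x); have [oy|ny] := pselect (Om y).
- by move=> _; exact: Om_unique.
- by rewrite dd_inl // => /eqP; rewrite oner_eq0.
- by rewrite dd_inr // => /eqP; rewrite oner_eq0.
have [_ [_ [_ [_ [h _]]]]] := em.
by move=> h0; apply/(h _ _ nx ny); rewrite dd_fin // h0.
Qed.

Lemma dd_tri x y z : ~ Om x -> ~ Om y -> ~ Om z -> dd d Om x z <= dd d Om x y + dd d Om y z.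
Proof.
move=> nx ny nz; have [_ [_ [_ [_ [_ [h _]]]]]] := em.
by rewrite -lee_fin EFinD -!dd_fin //; exact: h.
Qed.

Variable o : X.
Hypothesis no : ~ Om o.

Definition weight (x : X) : R := if x \in Om then 1 else (1 + dd d Om o x)^-1.

(* The inversion of [X] at an ideal point at distance [1 + d o x] from [x]. *)
Definition bdist (x y : X) : R := weight x * weight y * dd d Om x y.

Lemma weight_Om x : Om x -> weight x = 1.
Proof. by move=> h; rewrite /weight mem_set. Qed.

Lemma weight_fin x : ~ Om x -> weight x = (1 + dd d Om o x)^-1.
Proof. by move=> h; rewrite /weight memNset. Qed.

Lemma weight_gt0 x : 0 < weight x.
Proof.
by rewrite /weight; case: ifP => // _; rewrite invr_gt0 ltr_pwDl // dd_ge0.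
Qed.

Lemma weight_le1 x : weight x <= 1.
Proof.
rewrite /weight; case: ifP => // _; have := dd_ge0 o x => h.
by rewrite invf_le1 ?lerDl // ltr_pwDl.
Qed.

Lemma bdistC x y : bdist x y = bdist y x.
Proof. by rewrite /bdist ddC (mulrC (weight x)). Qed.

Lemma bdist_ge0 x y : 0 <= bdist x y.
Proof. by rewrite mulr_ge0 ?dd_ge0 // mulr_ge0 // ltW // weight_gt0. Qed.

Lemma bdist_eq0 x y : bdist x y = 0 <-> x = y.
Proof.
split=> [/eqP|->]; last by rewrite /bdist ddxx mulr0.
by rewrite !mulf_eq0 !(gt_eqF (weight_gt0 _)) /= => /eqP/dd_eq0.
Qed.

Lemma bdist_fin x y : ~ Om x -> ~ Om y -> bdist x y = dd d Om x y / ((1 + dd d Om o x) * (1 + dd d Om o y)).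
Proof. by move=> nx ny; rewrite /bdist (weight_fin nx) (weight_fin ny) mulrC invfM. Qed.

Lemma bdist_Om x y : ~ Om x -> Om y -> bdist x y = (1 + dd d Om o x)^-1.
Proof. by move=> nx oy; rewrite /bdist (weight_fin nx) (weight_Om oy) (dd_inr nx oy) !mulr1. Qed.

Lemma one_dd_gt0 x : 0 < 1 + dd d Om o x.
Proof. by rewrite ltr_pwDl // dd_ge0. Qed.

Lemma bdist_le1 x y : bdist x y <= 1.
Proof.
have [ox|nx] := pselect (Om x); have [oy|ny] := pselect (Om y).
- by rewrite (Om_unique ox oy) (bdist_eq0 y y).2.
- by rewrite bdistC (bdist_Om ny ox) -(weight_fin ny) weight_le1.
- by rewrite (bdist_Om nx oy) -(weight_fin nx) weight_le1.
rewrite bdist_fin // ler_pdivrMr ?mulr_gt0 ?one_dd_gt0 // mul1r.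
have := dd_tri nx no ny; rewrite (ddC x o).
have := dd_ge0 o x; have := dd_ge0 o y; nra.
Qed.

Hypothesis pt : ptolemy d Om.

Lemma bdist_ptolemy x y z t :
  bdist x y * bdist z t <= bdist x z * bdist y t + bdist x t * bdist y z.
Proof.
have := pt x y z t; rewrite /bdist.
have p : 0 < weight x * weight y * weight z * weight t by rewrite !mulr_gt0 ?weight_gt0.
by rewrite -(ler_pM2l p); nra.
Qed.

(** For three finite points, after clearing denominators, this is the sum of the triangle inequality
    for [x], [y], [z] and the Ptolemy inequality for [x], [z], [y], [o]. *)
Lemma bdist_tri x y z : bdist x z <= bdist x y + bdist y z.
Proof.
have [ox|nx] := pselect (Om x); have [oy|ny] := pselect (Om y); have [oz|nz] := pselect (Om z).
- by rewrite (Om_unique ox oz) (bdist_eq0 z z).2 // addr_ge0 // bdist_ge0.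
- by rewrite (Om_unique ox oy) (bdist_eq0 y y).2 // add0r.
- by rewrite (Om_unique ox oz) (bdist_eq0 z z).2 // addr_ge0 // bdist_ge0.
- rewrite (bdistC x z) (bdistC x y) (bdist_Om nz ox) (bdist_Om ny ox) bdist_fin //.
  apply: ler_frac_inv; try exact: one_dd_gt0.
  by have := dd_tri no nz ny; rewrite (ddC z y); lra.
- by rewrite (Om_unique oy oz) (bdist_eq0 z z).2 // addr0.
- rewrite (bdistC y z) (bdist_Om nx oy) (bdist_Om nz oy) bdist_fin //.
  apply: ler_frac_add; try exact: one_dd_gt0.
  by have := dd_tri nx no nz; rewrite (ddC x o); lra.
- rewrite (bdist_Om nx oz) (bdist_Om ny oz) (bdistC x y) bdist_fin // [leRHS]addrC.
  apply: ler_frac_inv; try exact: one_dd_gt0.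
  by have := dd_tri no nx ny; rewrite (ddC y x); lra.
rewrite !bdist_fin //.
have hx := one_dd_gt0 x; have hy := one_dd_gt0 y; have hz := one_dd_gt0 z.
rewrite -(ler_pM2r (mulr_gt0 (mulr_gt0 hx hy) hz)).
have := pt x z y o; have := dd_tri nx ny nz.
rewrite (ddC z y) (ddC z o) (ddC y o) (ddC x o).
move: (dd d Om) hx hy hz => a hx hy hz h1 h2.
have -> : a x z / ((1 + a o x) * (1 + a o z)) * ((1 + a o x) * (1 + a o y) * (1 + a o z)) = a x z * (1 + a o y) by field; rewrite !gt_eqF.
have -> : (a x y / ((1 + a o x) * (1 + a o y)) + a y z / ((1 + a o y) * (1 + a o z))) * ((1 + a o x) * (1 + a o y) * (1 + a o z)) = a x y * (1 + a o z) + a y z * (1 + a o x) by field; rewrite !gt_eqF.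
by nra.
Qed.

Lemma bdist_ball_open a e : eopen d Om [set y | bdist a y < e].
Proof.
have [_ [_ [_ [_ [_ [_ [hinf _]]]]]]] := em.
move=> y /= ay; pose r := e - bdist a y; have r0 : 0 < r by rewrite subr_gt0.
have [oy|ny] := pselect (Om y).
  (* Points [z] with [dd d Om o z > r^-1] have [bdist]-distance [(1 + dd d Om o z)^-1 < r] from the
     remote point. *)
  exists o, r^-1; split=> //; right; rewrite /cball_compl; split=> /=.
    by rewrite (hinf o y no oy).1.
  move=> z /= nz; have [oz|nz'] := pselect (Om z); first by rewrite (Om_unique oz oy).
  have : r^-1 < dd d Om o z by move/negP: nz; rewrite dd_fin // lee_fin -ltNge.
  move=> h; apply: le_lt_trans (bdist_tri a y z) _; rewrite -ltrBrDl -/r bdistC bdist_Om //.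
  have hz := one_dd_gt0 z; rewrite invf_plt ?posrE //; lra.
exists y, r; split=> //; left; rewrite /oball; split=> /=.
  have [_ [_ [_ [_ [h0 _]]]]] := em.
  by rewrite (h0 y y ny ny).2 // lte_fin.
move=> z /=; have [oz|nz] := pselect (Om z); first by rewrite (hinf y z ny oz).1.
rewrite dd_fin // lte_fin => h; apply: le_lt_trans (bdist_tri a y z) _; rewrite -ltrBrDl -/r.
apply: le_lt_trans h; rewrite /bdist -[leRHS]mul1r ler_wpM2r ?dd_ge0 //.
by rewrite mulr_ile1 ?weight_le1 // ltW // weight_gt0.
Qed.

Hypothesis cpt : ecompact d Om.

Lemma finite_ball_cover (e : X -> R) : (forall x, 0 < e x) ->
  exists n (f : nat -> X), forall x, exists2 i, (i < n)%N & bdist (f i) x < e (f i).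
Proof.
move=> e0; pose B x := [set y | bdist x y < e x].
have [||F [FC /finite_seqP[s sE]] cov] := @cpt [set V | exists x, V = B x].
- by move=> V [x ->]; exact: bdist_ball_open.
- move=> x; exists (B x); first by exists x.
  by rewrite /B /= (bdist_eq0 x x).2.
have /choice[ctr hctr] : forall V : set X, exists x, F V -> V = B x.
  by move=> V; have [/FC[x ->]|nV] := pselect (F V); [exists x|exists o].
exists (size s), (fun i => ctr (nth set0 s i)) => x.
have [V FV Vx] := cov x; have Vs : V \in s by move: FV; rewrite sE.
exists (index V s); first by rewrite index_mem.
by rewrite nth_index //; move: Vx; rewrite {1}(hctr V FV).
Qed.

(** If a sequence had no limit along [U], each point would have a ball that the sequence avoids on a
    set of [U]; finitely many such balls cover [X], a contradiction. *)
Lemma bdist_ptolemy_compact (U : set_system nat) : UltraFilter U -> \oo `<=` U ->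
  (exists x y z : X, x <> y /\ y <> z /\ x <> z) -> ptolemy_compact U bdist.
Proof.
move=> UU Uoo three; have PF : ProperFilter U := ultra_proper.
split=> //.
- exact: bdist_eq0.
- exact: bdistC.
- exact: bdist_tri.
- exact: bdist_le1.
- exact: bdist_ptolemy.
- move=> e e0; have [n [f h]] := finite_ball_cover (fun _ : X => e0).
  by exists n, f => x; have [i lt hi] := h x; exists i; rewrite // bdistC.
move=> x; apply: contrapT => H.
have /choice[e he] : forall y, exists e : R, 0 < e /\ ~ U [set n | bdist (x n) y < e].
  move=> y; apply: contrapT => Hy; apply: H; exists y.
  apply/cvgrPdist_lt => e e0; apply: contrapT => He; apply: Hy; exists e; split=> // h.
  apply: He; apply: filterS h => n /= h.
  by rewrite sub0r normrN ger0_norm // bdist_ge0.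
have [n [f cov]] := finite_ball_cover (fun y => (he y).1).
have : U [set m | forall i, (i < n)%N -> ~ bdist (x m) (f i) < e (f i)].
  apply: ultra_all_lt => i _; have [h|//] := in_ultra_setVsetC [set m | bdist (x m) (f i) < e (f i)] UU.
  by have := (he (f i)).2.
move=> /filter_ex[m /= hm]; have [i lt hi] := cov (x m).
by apply: (hm i lt); rewrite bdistC.
Qed.

End BoundedMetric.

(** * Rays along segments and circles *)

Section PathRays.
Variables (R : realType) (X : Type) (U : set_system nat) (dl : X -> X -> R).
Hypothesis pc : ptolemy_compact U dl.

Variables (w u v : X) (c : R -> X).
Hypothesis uw : u <> w.
Hypothesis c_cont : forall s : R, 0 <= s <= 1 -> forall e : R, 0 < e ->
  exists2 eta : R, 0 < eta & forall q : R, 0 <= q <= 1 -> `|s - q| < eta -> dl (c s) (c q) < e.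
Hypotheses (c0 : c 0 = u) (c1 : c 1 = w).
Hypothesis cw : forall s : R, 0 <= s < 1 -> c s <> w.
Hypothesis c_add : forall s1 s2 : R, 0 < s1 -> s1 < s2 -> s2 < 1 ->
  rho dl w u (c s2) = rho dl w u (c s1) + rho dl w (c s1) (c s2).

Lemma cvg_path_dist (z : X) (b s : R) : b <= 1 -> 0 <= s <= b ->
  dl (c q) z @[q --> within `[0, b]%classic (nbhs s)] --> dl (c s) z.
Proof.
move=> b1 sb; apply/cvgrPdist_lt => e e0.
have [|eta eta0 h] := c_cont (s := s) _ e0; first by lra.
near=> q.
have qb : 0 <= q <= b.
  have : `[0, b]%classic q by near: q; exact: withinT.
  by rewrite /= in_itv.
have sq : `|s - q| < eta.
  by near: q; apply: cvg_within; exact: nbhsx_ballx.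
have := h q; rewrite sq => /(_ _ isT) hq; have {}hq : dl (c s) (c q) < e by apply: hq; lra.
have := pc_tri pc (c s) (c q) z; have := pc_tri pc (c q) (c s) z.
by rewrite (pc_sym pc (c q) (c s)) ltr_norml; lra.
Unshelve. all: by end_near. Qed.

Lemma path_unbounded (t : R) : exists2 b : R, 0 <= b < 1 & t <= rho dl w u (c b).
Proof.
have D0 := dl_gt0 pc uw; pose T := `|t| + 1; have T0 : 0 < T by rewrite /T; have := normr_ge0 t; lra.
(* The first bound keeps [dl u (c b)] above [dl u w / 2]; the second then lifts [rho dl w u (c b)]
   to at least [T]. *)
have e0 : 0 < Num.min (dl u w / 2) (2 * T)^-1 by rewrite lt_min divr_gt0 //= invr_gt0; lra.
have [|eta eta0 h] := c_cont (s := 1) _ e0; first by lra.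
pose b := Num.max 0 (1 - eta / 2); have b01 : 0 <= b < 1.
  by rewrite /b le_max lexx /= gt_max; lra.
exists b => //.
have : dl (c 1) (c b) < Num.min (dl u w / 2) (2 * T)^-1.
  apply: h; first by lra.
  have : 1 - eta / 2 <= b by rewrite /b le_max lexx orbT.
  by rewrite ger0_norm; lra.
rewrite c1 lt_min => /andP[h1 h2]; have y0 := dl_gt0 pc (cw b01).
rewrite (pc_sym pc w) in h1 h2.
have h3 : dl u w / 2 < dl u (c b) by have := pc_tri pc u (c b) w; lra.
apply: le_trans (_ : T <= _); first by rewrite /T; have := ler_norm t; lra.
rewrite /rho ler_pdivlMr ?mulr_gt0 //.
have h4 : dl (c b) w * (2 * T) < 1.
  by rewrite -ltr_pdivlMr ?mulr_gt0 // mul1r.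
by nra.
Qed.

Lemma path_ivt (t : R) : 0 <= t -> exists2 s : R, 0 <= s < 1 & rho dl w u (c s) = t.
Proof.
move=> t0; have [b b01 tb] := path_unbounded t; have [b0 b1] := andP b01.
have r0 : rho dl w u (c 0) = 0 by rewrite c0 (rhoxx pc).
have [|||s] := @IVT R (fun s => rho dl w u (c s)) 0 b t.
- by [].
- apply/subspace_continuousP => s /=; rewrite in_itv /= => sb.
  have sw : c s <> w by apply: cw; lra.
  rewrite /rho; apply: cvgM.
    under eq_fun do rewrite (pc_sym pc u); rewrite (pc_sym pc u).
    by apply: cvg_path_dist => //; exact: ltW.
  apply: cvgV; first by rewrite mulf_neq0 ?(dl_neq0 pc).
  apply: cvgM; first exact: cvg_cst.
  by apply: cvg_path_dist => //; exact: ltW.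
- by rewrite r0 ge_min t0 /= le_max tb orbT.
by rewrite in_itv /= => sb <-; exists s => //; lra.
Qed.

(** [rho dl w u (c s)] is continuous, starts at [0] and is unbounded, so the path can be
    reparametrized by it; additivity makes this parameter the arc length. *)
Lemma path_ray :
  ((forall s : R, 0 < s < 1 -> rho dl w v (c s) = rho dl w v u + rho dl w u (c s)) \/
   exists2 s : R, 0 <= s < 1 & c s = v) ->
  exists g : R -> X, g 0 = u /\ (forall t, 0 <= t -> g t <> w) /\
    (forall s t, 0 <= s -> 0 <= t -> rho dl w (g s) (g t) = `|s - t|) /\
    ((forall t, 0 <= t -> rho dl w v (g t) = rho dl w v u + t) \/ g (rho dl w v u) = v).
Proof.
move=> hv.
have add (s1 s2 : R) : 0 <= s1 -> s1 < s2 -> s2 < 1 ->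
    rho dl w u (c s2) = rho dl w u (c s1) + rho dl w (c s1) (c s2).
  rewrite le_eqVlt => /orP[/eqP <- _ _|]; last exact: c_add.
  by rewrite c0 (rhoxx pc) add0r.
have /choice[sg hsg] : forall t : R, exists s : R, 0 <= t -> 0 <= s < 1 /\ rho dl w u (c s) = t.
  move=> t; have [t0|t0] := leP 0 t; last by exists 0; lra.
  by have [s s01 hs] := path_ivt t0; exists s.
have dist (s t : R) : 0 <= s -> 0 <= t -> rho dl w (c (sg s)) (c (sg t)) = `|s - t|.
  move=> s0 t0; have [hs es] := hsg s s0; have [ht et] := hsg t t0.
  have [lt|lt|e] := ltgtP (sg s) (sg t).
  - have := add _ _ (proj1 (andP hs)) lt (proj2 (andP ht)); rewrite es et.
    have := rho_ge0 pc w (c (sg s)) (c (sg t)) => h1 h2.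
    by rewrite distrC ger0_norm; lra.
  - have := add _ _ (proj1 (andP ht)) lt (proj2 (andP hs)); rewrite es et (rhoC pc).
    have := rho_ge0 pc w (c (sg s)) (c (sg t)) => h1 h2.
    by rewrite ger0_norm; lra.
  - by rewrite e (rhoxx pc) -es -et e subrr normr0.
have gw (t : R) : 0 <= t -> c (sg t) <> w by move=> /hsg[h _]; exact: cw.
exists (c \o sg); split; last split; last split => //=.
- have [h e] := hsg 0 (lexx _).
  by apply/esym/(rho_eq0 pc uw _ e); exact: cw.
- exact: gw.
case: hv => [hv|[s s01 sv]]; [left|right].
  move=> t t0; have [h {2}<-] := hsg t t0.
  have [e|n] := eqVneq (sg t) 0; first by rewrite e c0 (rhoxx pc) addr0.
  by apply: hv; have := andP h; rewrite lt0r n.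
have t0 := rho_ge0 pc w v u; have [ht et] := hsg _ t0.
have ev : rho dl w u (c s) = rho dl w v u by rewrite sv (rhoC pc).
set q := sg _ in ht et *.
have [lt|lt|-> //] := ltgtP q s.
  have := add _ _ (proj1 (andP ht)) lt (proj2 (andP s01)); rewrite et ev => h.
  by rewrite -sv; apply: (rho_eq0 pc (w := w)); [exact: cw | exact: cw | lra].
have := add _ _ (proj1 (andP s01)) lt (proj2 (andP ht)); rewrite et ev => h.
by rewrite -sv; apply/esym/(rho_eq0 pc (w := w)); [exact: cw | exact: cw | lra].
Qed.

End PathRays.

Section SegmentsCircles.
Variables (R : realType) (X : Type) (d : X -> X -> \bar R) (Om : set X).
Hypotheses (em : ext_metric d Om) (pt : ptolemy d Om).
Variable o : X.
Hypothesis no : ~ Om o.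
Variable U : set_system nat.
Hypothesis pc : ptolemy_compact U (bdist d Om o).

Local Notation dl := (bdist d Om o).
Local Notation D := (dd d Om).

(** Sending [t] to infinity turns the Ptolemy equality into additivity of distances. *)
Lemma dd_rho x y z t : x <> t -> y <> t -> z <> t ->
  D x z * D y t = D x y * D z t + D x t * D y z ->
  rho dl t x z = rho dl t x y + rho dl t y z.
Proof.
move=> xt yt zt h.
have hb : dl x z * dl y t = dl x y * dl z t + dl x t * dl y z.
  rewrite /bdist; set p := weight d Om o.
  transitivity (p x * p y * p z * p t * (D x z * D y t)); first by ring.
  by rewrite h; ring.
have := dl_neq0 pc xt; have := dl_neq0 pc yt; have := dl_neq0 pc zt => hz hy hx.
transitivity (dl x z * dl y t / (dl x t * dl y t * dl z t)).
  by rewrite /rho; field; rewrite hx hy hz.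
by rewrite hb /rho; field; rewrite hx hy hz.
Qed.

Lemma homeo_onto_cont (P : Type) (dist : P -> P -> R) (S : set P) (f : P -> X) C :
  homeo_onto d Om dist S f C -> forall p, S p -> forall e : R, 0 < e ->
  exists2 eta : R, 0 < eta & forall q, S q -> dist p q < eta -> dl (f p) (f q) < e.
Proof.
move=> [_ [_ [h _]]] p Sp e e0.
have [_ /(_ p)] := h _ (bdist_ball_open em no pt (a := f p) (e := e)).
case; first by split=> //=; rewrite (dlxx pc).
by move=> eta eta0 hq; exists eta => // q Sq /(hq q Sq)[].
Qed.

(** If [b] precedes [a], or lies beyond [ta], on the other side of infinity, the ray points away
    from [g b]; if [b] is between them, the ray passes through [g b]. *)
Lemma segment_ray_lt (g : R -> X) (ta a b : R) :
  (forall p q : R, 0 <= p <= 1 -> 0 <= q <= 1 -> g p = g q -> p = q) ->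
  (forall s : R, 0 <= s <= 1 -> forall e : R, 0 < e -> exists2 eta : R, 0 < eta &
     forall q : R, 0 <= q <= 1 -> `|s - q| < eta -> dl (g s) (g q) < e) ->
  (forall t1 t2 t3 t4 : R, 0 <= t1 -> t1 < t2 -> t2 < t3 -> t3 < t4 -> t4 <= 1 ->
     D (g t1) (g t3) * D (g t2) (g t4) = D (g t1) (g t2) * D (g t3) (g t4) + D (g t1) (g t4) * D (g t3) (g t2)) ->
  0 <= ta <= 1 -> 0 <= a <= 1 -> 0 <= b <= 1 -> a < ta -> b != ta -> a != b ->
  exists h : R -> X, h 0 = g a /\ (forall t, 0 <= t -> h t <> g ta) /\
    (forall s t, 0 <= s -> 0 <= t -> rho dl (g ta) (h s) (h t) = `|s - t|) /\
    ((forall t, 0 <= t -> rho dl (g ta) (g b) (h t) = rho dl (g ta) (g b) (g a) + t) \/ h (rho dl (g ta) (g b) (g a)) = g b).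
Proof.
move=> inj cont gid Ita Ia Ib ata bta ab.
have gneq p q : 0 <= p <= 1 -> 0 <= q <= 1 -> p != q -> g p <> g q.
  by move=> Ip Iq /eqP pq /(inj p q Ip Iq).
pose m s := a + s * (ta - a).
have mI s : 0 <= s <= 1 -> a <= m s <= ta by rewrite /m => ?; nra.
have m_lt s : s < 1 -> m s < ta by rewrite /m => ?; nra.
have m_gt s : 0 < s -> a < m s by rewrite /m => ?; nra.
have m_mono s1 s2 : s1 < s2 -> m s1 < m s2 by rewrite /m => ?; nra.
have m0 : m 0 = a by rewrite /m; ring.
have m1 : m 1 = ta by rewrite /m; ring.
have nta s : 0 <= s < 1 -> g (m s) <> g ta.
  move=> hs; have := mI s; have := m_lt s => h1 h2; apply: gneq => //; first by lra.
  by rewrite lt_eqF //; lra.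
have btan : g b <> g ta by exact: gneq.
apply: (@path_ray R X U dl pc (g ta) (g a) (g b) (g \o m)) => //=.
- by apply: gneq => //; rewrite lt_eqF.
- move=> s Is e e0; have [|eta eta0 h] := cont (m s) _ e e0; first by have := mI s Is; lra.
  exists eta => // q Iq sq; apply: h; first by have := mI q Iq; lra.
  apply: le_lt_trans sq; have -> : m s - m q = (s - q) * (ta - a) by rewrite /m; ring.
  by rewrite normrM -[leRHS]mulr1 ler_wpM2l // ger0_norm; lra.
- by rewrite m0.
- by rewrite m1.
- move=> s1 s2 h1 h2 h3; apply: dd_rho; try (apply: nta; lra).
    by apply: gneq => //; rewrite lt_eqF.
  rewrite (gid a (m s1) (m s2) ta) ?(ddC em (g (m s2)) (g (m s1))) //; try lra.
  - exact: m_gt.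
  - exact: m_mono.
  - by apply: m_lt; lra.
have [lt|le] := ltP a b; last first.
  left=> s s01; apply: dd_rho => //; first by apply: gneq => //; rewrite lt_eqF.
    by apply: nta; lra.
  have lt : b < a by rewrite lt_neqAle le eq_sym ab.
  rewrite (gid b a (m s) ta) ?(ddC em (g (m s)) (g a)) //; try lra.
  - by apply: m_gt; lra.
  - by apply: m_lt; lra.
have [lt'|le] := ltP b ta.
  right; exists ((b - a) / (ta - a)).
    by rewrite divr_ge0 ?subr_ge0 ?(ltW lt) ?(ltW ata) //= ltr_pdivrMr ?subr_gt0 // mul1r; lra.
  by rewrite /m divfK ?subr_eq0 ?gt_eqF // addrC subrK.
have {}le : ta < b by rewrite lt_neqAle le eq_sym bta.
left=> s s01; apply: dd_rho => //; first by apply: gneq => //; rewrite lt_eqF.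
  by apply: nta; lra.
have : D (g a) (g ta) * D (g (m s)) (g b) = D (g a) (g (m s)) * D (g ta) (g b) + D (g a) (g b) * D (g ta) (g (m s)).
  by have := m_gt s; have := m_lt s; move=> h1 h2; apply: gid; lra.
rewrite (ddC em (g (m s)) (g b)) (ddC em (g ta) (g b)) (ddC em (g a) (g b)) (ddC em (g ta) (g (m s))).
by lra.
Qed.

Lemma segment_ray S w u v : is_ptolemy_segment d Om S -> S w -> S u -> S v ->
  u <> w -> v <> w -> u <> v ->
  exists h : R -> X, h 0 = u /\ (forall t, 0 <= t -> h t <> w) /\
    (forall s t, 0 <= s -> 0 <= t -> rho dl w (h s) (h t) = `|s - t|) /\
    ((forall t, 0 <= t -> rho dl w v (h t) = rho dl w v u + t) \/ h (rho dl w v u) = v).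
Proof.
move=> [g hg gid] Sw Su Sv; have cont := homeo_onto_cont hg.
have [inj [gS _]] := hg.
move: Sw Su Sv; rewrite -gS => -[ta Ita <-] [a Ia <-] [b Ib <-] {w u v} ata bta ab.
have ata' : a != ta by apply/eqP => e; apply: ata; rewrite e.
have bta' : b != ta by apply/eqP => e; apply: bta; rewrite e.
have ab' : a != b by apply/eqP => e; apply: ab; rewrite e.
have [lt|le] := ltP a ta; first exact: (@segment_ray_lt g).
have lt : ta < a by rewrite lt_neqAle le eq_sym ata'.
have := @segment_ray_lt (fun t => g (1 - t)) (1 - ta) (1 - a) (1 - b).
rewrite !subKr; apply.
- move=> p q Ip Iq /inj h; have /h{h} : I01 (1 - p) by rewrite /I01 /=; lra.
  have Iq' : I01 (1 - q) by rewrite /I01 /=; lra.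
  by move=> /(_ Iq'); lra.
- move=> s Is e e0; have [|eta eta0 h] := cont (1 - s) _ e e0; first by rewrite /I01 /=; lra.
  exists eta => // q Iq sq; apply: h; first by rewrite /I01 /=; lra.
  by rewrite /dist1 distrC; have -> : 1 - q - (1 - s) = s - q by ring.
- move=> t1 t2 t3 t4 h1 h2 h3 h4 h5; have := gid (1 - t4) (1 - t3) (1 - t2) (1 - t1).
  rewrite (ddC em (g (1 - t4)) (g (1 - t2))) (ddC em (g (1 - t3)) (g (1 - t1))) (ddC em (g (1 - t4)) (g (1 - t3))).
  rewrite (ddC em (g (1 - t2)) (g (1 - t1))) (ddC em (g (1 - t4)) (g (1 - t1))) (ddC em (g (1 - t2)) (g (1 - t3))).
  by move=> h; have := h; lra.
- by move: Ita; rewrite /I01 /=; lra.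
- by move: Ia; rewrite /I01 /=; lra.
- by move: Ib; rewrite /I01 /=; lra.
- by lra.
- by apply: contra bta' => /eqP e; apply/eqP; lra.
- by apply: contra ab' => /eqP e; apply/eqP; lra.
Qed.

End SegmentsCircles.

(** * Rational parametrization of the circle *)

Section CirclePoints.
Variable R : realType.
Implicit Types (P Q x z p q : R * R).

(* [turn P n m] is [P (n + i m)^2 / |n + i m|^2] in complex notation: the point of the unit circle
   whose stereographic coordinate with respect to [P] is [n / m]. *)
Definition turn P (n m : R) : R * R :=
  ((P.1 * (n ^+ 2 - m ^+ 2) - P.2 * (2 * n * m)) / (n ^+ 2 + m ^+ 2),
   (P.1 * (2 * n * m) + P.2 * (n ^+ 2 - m ^+ 2)) / (n ^+ 2 + m ^+ 2)).

(** The identity [cot (theta / 2) = sin theta / (1 - cos theta)], for the oriented angle [theta]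
    from [P] to [Q]. *)
Definition unturn P Q : R := (P.1 * Q.2 - P.2 * Q.1) / (1 - (P.1 * Q.1 + P.2 * Q.2)).

Lemma turn_S1 P n m : S1 P -> n ^+ 2 + m ^+ 2 != 0 -> S1 (turn P n m).
Proof.
rewrite /S1 /turn /= => hP h.
have -> : forall a b c : R, (a / c) ^+ 2 + (b / c) ^+ 2 = (a ^+ 2 + b ^+ 2) / c ^+ 2.
  by move=> a b c; rewrite !expr_div_n -mulrDl.
apply: (canLR (mulfK _)); first by rewrite expf_neq0.
transitivity ((P.1 ^+ 2 + P.2 ^+ 2) * (n ^+ 2 + m ^+ 2) ^+ 2); first by ring.
by rewrite hP.
Qed.

Lemma turn0 P n : n != 0 -> turn P n 0 = P.
Proof. by move=> h; rewrite /turn [RHS]surjective_pairing; congr pair; field. Qed.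

Lemma turn_hom P n m : m != 0 -> turn P n m = turn P (n / m) 1.
Proof.
move=> h; have h1 : n ^+ 2 + m ^+ 2 != 0.
  by rewrite paddr_eq0 ?sqr_ge0 // !sqrf_eq0 negb_and h orbT.
rewrite /turn; congr pair; field; rewrite h h1 //.
Qed.

Lemma sqr_add1_neq0 (n : R) : n ^+ 2 + 1 ^+ 2 != 0.
Proof. by rewrite gt_eqF // ltr_wpDl ?sqr_ge0 // expr1n. Qed.

Lemma dot_turn P n : S1 P -> 1 - (P.1 * (turn P n 1).1 + P.2 * (turn P n 1).2) = 2 / (n ^+ 2 + 1 ^+ 2).
Proof.
move=> hP; rewrite /turn /=; have h := sqr_add1_neq0 n.
transitivity (1 - (P.1 ^+ 2 + P.2 ^+ 2) * (n ^+ 2 - 1 ^+ 2) / (n ^+ 2 + 1 ^+ 2)).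
  by field; rewrite expr1n in h.
by rewrite hP; field; rewrite expr1n in h.
Qed.

Lemma turnK P n : S1 P -> unturn P (turn P n 1) = n.
Proof.
move=> hP; rewrite /unturn (dot_turn n hP) /turn /=; have h := sqr_add1_neq0 n.
transitivity ((P.1 ^+ 2 + P.2 ^+ 2) * n); first by field; rewrite expr1n in h.
by rewrite hP mul1r.
Qed.

Lemma turn_neq P n : S1 P -> turn P n 1 <> P.
Proof.
move=> hP e; have := dot_turn n hP; rewrite e -!expr2 hP subrr => /esym/eqP.
by rewrite mulf_eq0 invr_eq0 (negbTE (sqr_add1_neq0 n)) orbF pnatr_eq0.
Qed.

Lemma unturnK P Q : S1 P -> S1 Q -> Q <> P -> turn P (unturn P Q) 1 = Q.
Proof.
case: P Q => [p1 p2] [q1 q2]; rewrite /S1 /unturn /= => hP hQ ne.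
have h : 1 - (p1 * q1 + p2 * q2) != 0.
  apply/eqP => h; apply: ne.
  have e : (q1 - p1) ^+ 2 + (q2 - p2) ^+ 2 = 0 by lra.
  have := sqr_ge0 (q1 - p1); have := sqr_ge0 (q2 - p2) => g1 g2.
  have /eqP : (q1 - p1) ^+ 2 = 0 by lra.
  have /eqP : (q2 - p2) ^+ 2 = 0 by lra.
  by rewrite !sqrf_eq0 !subr_eq0 => /eqP-> /eqP->.
set t := _ / _.
have ht : t * (1 - (p1 * q1 + p2 * q2)) = p1 * q2 - p2 * q1 by rewrite /t divfK.
have ht2 : (t ^+ 2 + 1 ^+ 2) * (1 - (p1 * q1 + p2 * q2)) ^+ 2 = 2 * (1 - (p1 * q1 + p2 * q2)).
  transitivity ((t * (1 - (p1 * q1 + p2 * q2))) ^+ 2 + (1 - (p1 * q1 + p2 * q2)) ^+ 2); first by ring.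
  rewrite ht; transitivity (1 + (p1 ^+ 2 + p2 ^+ 2) * (q1 ^+ 2 + q2 ^+ 2) - 2 * (p1 * q1 + p2 * q2)); first by ring.
  by rewrite hP hQ; ring.
have [s sE] : exists s : R, s = 1 - (p1 * q1 + p2 * q2) by eexists.
clearbody t; rewrite -sE in h ht ht2.
have ht3 : (t ^+ 2 + 1 ^+ 2) * s = 2.
  by apply: (mulIf h); rewrite -mulrA -expr2 ht2.
have h2 : t ^+ 2 + 1 ^+ 2 = 2 / s by rewrite -ht3 mulfK.
have h1 : t ^+ 2 - 1 ^+ 2 = 2 / s - 2 by rewrite -h2; ring.
have ht' : t = (p1 * q2 - p2 * q1) / s by rewrite -ht mulfK.
have E a b D : (a * (2 / s - 2) + b * (2 * (D / s) * 1)) / (2 / s) = a - s * a + b * D by field; rewrite h.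
rewrite /turn /= h1 h2 ht'; congr pair.
  rewrite -mulNr E; transitivity (q1 * (p1 ^+ 2 + p2 ^+ 2)); first by rewrite sE; ring.
  by rewrite hP mulr1.
rewrite addrC E; transitivity (q2 * (p1 ^+ 2 + p2 ^+ 2)); first by rewrite sE; ring.
by rewrite hP mulr1.
Qed.

(* Vanishes on the line through [x] and [z]; its sign tells apart the two arcs they bound. *)
Definition chord x z p : R := (p.1 - x.1) * (z.2 - x.2) - (p.2 - x.2) * (z.1 - x.1).

Lemma chord_turn P a b c : S1 P -> chord (turn P a 1) (turn P c 1) (turn P b 1) =
  4 * ((b - a) * (b - c) * (c - a)) / ((a ^+ 2 + 1 ^+ 2) * (b ^+ 2 + 1 ^+ 2) * (c ^+ 2 + 1 ^+ 2)).
Proof.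
move=> hP; have ha := sqr_add1_neq0 a; have hb := sqr_add1_neq0 b; have hc := sqr_add1_neq0 c.
(* The sides agree up to a factor [P.1 ^+ 2 + P.2 ^+ 2], which is put in for the [1]. *)
rewrite -[RHS]mul1r -[X in X * _]hP /chord /turn /=; field.
by move: ha hb hc; rewrite !expr1n => -> -> ->.
Qed.

Lemma chord_pole P a c : S1 P -> chord (turn P a 1) (turn P c 1) P =
  4 * (c - a) / ((a ^+ 2 + 1 ^+ 2) * (c ^+ 2 + 1 ^+ 2)).
Proof.
move=> hP; have ha := sqr_add1_neq0 a; have hc := sqr_add1_neq0 c.
rewrite -[RHS]mul1r -[X in X * _]hP /chord /turn /=; field.
by move: ha hc; rewrite !expr1n => -> ->.
Qed.

Lemma normr_le_dist2 p q : `|p.1 - q.1| <= dist2 p q /\ `|p.2 - q.2| <= dist2 p q.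
Proof.
by rewrite /dist2 -!sqrtr_sqr; split; rewrite ler_wsqrtr // ?lerDl ?lerDr sqr_ge0.
Qed.

Lemma dist2_le p q : dist2 p q <= `|p.1 - q.1| + `|p.2 - q.2|.
Proof.
rewrite /dist2 -[leRHS]ger0_norm ?addr_ge0 // -sqrtr_sqr ler_wsqrtr //.
rewrite -(real_normK (num_real (p.1 - q.1))) -(real_normK (num_real (p.2 - q.2))) sqrrD.
by have := mulr_ge0 (normr_ge0 (p.1 - q.1)) (normr_ge0 (p.2 - q.2)); lra.
Qed.

Lemma chord_lip x z p q :
  `|chord x z p - chord x z q| <= (`|z.2 - x.2| + `|z.1 - x.1| + 1) * dist2 p q.
Proof.
have [h1 h2] := normr_le_dist2 p q; have d0 : 0 <= dist2 p q := sqrtr_ge0 _.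
have -> : chord x z p - chord x z q = (z.2 - x.2) * (p.1 - q.1) - (z.1 - x.1) * (p.2 - q.2) by rewrite /chord; ring.
apply: le_trans (ler_normB _ _) _; rewrite !normrM 2!mulrDl mul1r.
by rewrite -[leLHS]addr0; apply: lerD => //; apply: lerD; rewrite ler_wpM2l.
Qed.

Lemma relopen_chord x z (k : R) : relopen (@dist2 R) (@S1 R) (@S1 R `&` [set p | 0 < k * chord x z p]).
Proof.
split=> [p []//|p [Sp /= hp]]; set L := `|z.2 - x.2| + `|z.1 - x.1| + 1.
have L0 : 0 < L by rewrite ltr_wpDl // addr_ge0.
have k0 : 0 < `|k| by rewrite normr_gt0; apply: contraTneq hp => ->; rewrite mul0r ltxx.
exists (k * chord x z p / (`|k| * L)) => [|q Sq]; first by rewrite divr_gt0 // mulr_gt0.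
rewrite ltr_pdivlMr; last exact: mulr_gt0.
move=> h; split=> //=.
have := ler_wpM2l (ltW k0) (chord_lip x z p q); rewrite -normrM -/L => h2.
have := ler_norm (k * (chord x z p - chord x z q)) => h3; lra.
Qed.

(** Homogeneous parameters make continuity hold also where [m] vanishes, that is, where the path
    reaches [P]. *)
Lemma cvg_turn P (n m : R -> R) (s : R) : n r @[r --> s] --> n s -> m r @[r --> s] --> m s ->
  n s ^+ 2 + m s ^+ 2 != 0 -> forall e : R, 0 < e ->
  exists2 eta : R, 0 < eta & forall r : R, `|s - r| < eta -> dist2 (turn P (n s) (m s)) (turn P (n r) (m r)) < e.
Proof.
move=> hn hm h e e0.
have cD : (n r ^+ 2 + m r ^+ 2)^-1 @[r --> s] --> (n s ^+ 2 + m s ^+ 2)^-1.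
  by apply: cvgV => //; apply: cvgD; apply: cvgM.
have cB : n r ^+ 2 - m r ^+ 2 @[r --> s] --> n s ^+ 2 - m s ^+ 2 by apply: cvgB; apply: cvgM.
have cM : 2 * n r * m r @[r --> s] --> 2 * n s * m s.
  by apply: cvgM => //; apply: cvgM => //; exact: cvg_cst.
have e2 : 0 < e / 2 by rewrite divr_gt0.
have c1 : (turn P (n r) (m r)).1 @[r --> s] --> (turn P (n s) (m s)).1.
  by apply: cvgM => //; apply: cvgB; apply: cvgM => //; exact: cvg_cst.
have c2 : (turn P (n r) (m r)).2 @[r --> s] --> (turn P (n s) (m s)).2.
  by apply: cvgM => //; apply: cvgD; apply: cvgM => //; exact: cvg_cst.
have : \forall r \near s, `|(turn P (n s) (m s)).1 - (turn P (n r) (m r)).1| < e / 2 /\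
    `|(turn P (n s) (m s)).2 - (turn P (n r) (m r)).2| < e / 2.
  by near=> r; split; near: r; [move/cvgrPdist_lt: c1|move/cvgrPdist_lt: c2]; apply.
move=> /nbhs_ballP[eta /= eta0 hball]; exists eta => // r sr.
have [h1 h2] := hball r sr; apply: le_lt_trans (dist2_le _ _) _; lra.
Unshelve. all: by end_near. Qed.

End CirclePoints.

(** * Rays along circles *)

Section CircleRays.
Variables (R : realType) (X : Type) (d : X -> X -> \bar R) (Om : set X).
Hypotheses (em : ext_metric d Om) (pt : ptolemy d Om).
Variable o : X.
Hypothesis no : ~ Om o.
Variable U : set_system nat.
Hypothesis pc : ptolemy_compact U (bdist d Om o).

Local Notation dl := (bdist d Om o).

(** The two sides of the chord cut the punctured circle into disjoint relatively open pieces, with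
    [P] and the point of parameter [b] on different sides. *)
Lemma chord_separates (f : R * R -> X) C (P : R * R) (a b c : R) :
  homeo_onto d Om (@dist2 R) (@S1 R) f C -> S1 P -> a < b -> b < c ->
  ~ same_component d Om (C `&` [set x | x <> f (turn P a 1) /\ x <> f (turn P c 1)]) (f (turn P b 1)) (f P).
Proof.
move=> [inj [fC [_ fopen]]] SP ab bc [A [AC [Aconn [Ab AP]]]]; apply: Aconn.
have St t : S1 (turn P t 1) by apply: turn_S1 => //; exact: sqr_add1_neq0.
have q0 (t : R) : 0 < t ^+ 2 + 1 ^+ 2 by rewrite lt0r sqr_add1_neq0 /= addr_ge0 ?sqr_ge0.
set x := turn P a 1 in AC *; set z := turn P c 1 in AC *.
have [U1 oU1 fU1] := fopen _ (relopen_chord x z 1).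
have [U2 oU2 fU2] := fopen _ (relopen_chord x z (-1)).
have side p : S1 p -> 0 < 1 * chord x z p -> U1 (f p).
  by move=> Sp hp; have [] : (U1 `&` C) (f p) by rewrite -fU1; exists p.
have side' p : S1 p -> 0 < -1 * chord x z p -> U2 (f p).
  by move=> Sp hp; have [] : (U2 `&` C) (f p) by rewrite -fU2; exists p.
have bneg : 0 < -1 * chord x z (turn P b 1).
  rewrite (chord_turn a b c SP) mulN1r -mulNr divr_gt0 ?mulr_gt0 //.
  have : 0 < (b - a) * (c - b) * (c - a) by rewrite !mulr_gt0 ?subr_gt0 //; exact: lt_trans bc.
  by lra.
have Ppos : 0 < 1 * chord x z P.
  rewrite mul1r (chord_pole a c SP) divr_gt0 ?mulr_gt0 // subr_gt0; exact: lt_trans bc.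
exists U1, U2; split=> //; split=> //; split; last split; last split.
- move=> y Ay; have [Cy [yx yz]] := AC y Ay.
  move: Cy; rewrite -fC => -[p Sp py].
  have [e|nP] := pselect (p = P); first by left; rewrite -py e; exact: side.
  have ep := unturnK SP Sp nP; set t := unturn P p in ep.
  have [h|h|h] := ltgtP (chord x z p) 0.
  - by right; rewrite -py; apply: side' => //; rewrite mulN1r oppr_gt0.
  - by left; rewrite -py; apply: side => //; rewrite mul1r.
  exfalso; move: h; rewrite -ep (chord_turn a t c SP) => /eqP.
  rewrite !mulf_eq0 invr_eq0 !mulf_eq0 !(negbTE (sqr_add1_neq0 _)) !subr_eq0 !orbF pnatr_eq0 /=.
  move=> /orP[/orP[]|] /eqP e.
  + by apply: yx; rewrite -py -ep e.
  + by apply: yz; rewrite -py -ep e.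
  + by have := lt_trans ab bc; rewrite e ltxx.
- by exists (f P); split=> //; exact: side.
- by exists (f (turn P b 1)); split=> //; exact: side'.
apply/seteqP; split=> // y [[Ay U1y] U2y]; have [Cy _] := AC y Ay.
have [p [Sp hp] py] : (f @` (@S1 R `&` [set p | 0 < 1 * chord x z p])) y by rewrite fU1.
have [q [Sq hq] qy] : (f @` (@S1 R `&` [set p | 0 < -1 * chord x z p])) y by rewrite fU2.
have pq : p = q by apply: inj; rewrite // py qy.
by move: hp hq; rewrite /= -pq mul1r mulN1r; lra.
Qed.

(** With [w] at infinity the rest of the circle is a geodesic line, parametrized by [h]. Of the two
    rays from [u] the one away from [v] is taken. *)
Lemma circle_ray C w u v : is_circle d Om C -> C w -> C u -> C v ->
  u <> w -> v <> w -> u <> v ->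
  exists h : R -> X, h 0 = u /\ (forall t, 0 <= t -> h t <> w) /\
    (forall s t, 0 <= s -> 0 <= t -> rho dl w (h s) (h t) = `|s - t|) /\
    ((forall t, 0 <= t -> rho dl w v (h t) = rho dl w v u + t) \/ h (rho dl w v u) = v).
Proof.
move=> [[f hf] cid]; have cont := homeo_onto_cont em pt no pc hf.
have [inj [fC _]] := hf.
move=> Cw Cu Cv; move: (Cw) (Cu) (Cv); rewrite -{1 2 3}fC.
move=> [P SP wE] [Q SQ uE] [Q' SQ' vE]; subst w u v => uw vw uv.
have QP : Q <> P by move=> e; apply: uw; rewrite e.
have QP' : Q' <> P by move=> e; apply: vw; rewrite e.
pose h t := f (turn P t 1).
have St t : S1 (turn P t 1) by apply: turn_S1 => //; exact: sqr_add1_neq0.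
have hC t : C (h t) by rewrite -fC; exists (turn P t 1).
have hP t : h t <> f P by move=> /(inj _ _ (St t) SP); exact: turn_neq.
have h_inj s t : h s = h t -> s = t.
  by move=> /(inj _ _ (St s) (St t)) e; rewrite -(turnK s SP) e turnK.
have btw (a b c : R) : a < b -> b < c -> rho dl (f P) (h a) (h c) = rho dl (f P) (h a) (h b) + rho dl (f P) (h b) (h c).
  move=> ab bc; have ac := lt_trans ab bc.
  have ne s t : s < t -> h s <> h t by move=> lt /h_inj e; rewrite e ltxx in lt.
  apply: (dd_rho pc) => //; apply: cid => //; try exact: ne; try exact: chord_separates.
set a := unturn P Q; set b := unturn P Q'.
have eQ : turn P a 1 = Q by exact: unturnK.
have eQ' : turn P b 1 = Q' by exact: unturnK.
have ab : a != b by apply/eqP => e; apply: uv; rewrite -eQ -eQ' e.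
have [e [e0 he]] : exists e : R, (e = 1 \/ e = -1) /\ (b - a) * e < 0.
  have [lt|le] := ltP b a; first by exists 1; split; [left|lra].
  by exists (-1); split; [right|have : a < b by rewrite lt_neqAle ab]; lra.
have e2 : e ^+ 2 = 1 by case: e0 => ->; ring.
(* For [s < 1] the path has stereographic parameter [a + e * (s / (1 - s))]; at [s = 1] it reaches
   [P]. *)
pose n s := a * (1 - s) + e * s; pose r s : R := s / (1 - s).
have hn (s : R) : s < 1 -> turn P (n s) (1 - s) = turn P (a + e * r s) 1.
  move=> s1; have s10 : 1 - s != 0 by rewrite subr_eq0 gt_eqF.
  by rewrite turn_hom //; congr turn; rewrite /n /r; field.
have r_mono (s1 s2 : R) : s1 < s2 -> s2 < 1 -> r s1 < r s2.
  move=> h1 h2; have p1 : 0 < 1 - s1 by lra.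
  have p2 : 0 < 1 - s2 by lra.
  by rewrite /r ltr_pdivrMr // mulrAC ltr_pdivlMr //; nra.
have r0 : r 0 = 0 by rewrite /r mul0r.
have nz (s : R) : n s ^+ 2 + (1 - s) ^+ 2 != 0.
  rewrite paddr_eq0 ?sqr_ge0 // !sqrf_eq0 negb_and subr_eq0.
  have [<-|] := eqVneq 1 s; last by rewrite orbT.
  by rewrite orbF /n subrr mulr0 add0r mulr1 -sqrf_eq0 e2 oner_eq0.
have mono (t1 t2 t3 : R) : t1 < t2 -> t2 < t3 ->
    rho dl (f P) (h (a + e * t1)) (h (a + e * t3)) =
    rho dl (f P) (h (a + e * t1)) (h (a + e * t2)) + rho dl (f P) (h (a + e * t2)) (h (a + e * t3)).
  move=> h1 h2; case: e0 => ->; first by apply: btw; lra.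
  rewrite (rhoC pc) (btw _ (a + -1 * t2)); try lra.
  by rewrite addrC; congr (_ + _); exact: (rhoC pc).
have hu : f Q = h (a + e * 0) by rewrite mulr0 addr0 /h eQ.
apply: (@path_ray R X U dl pc _ _ _ (fun s => f (turn P (n s) (1 - s)))) => //=.
- move=> s _ ep ep0.
  have Sn t : S1 (turn P (n t) (1 - t)) by exact: turn_S1.
  have [eta eta0 heta] := cont _ (Sn s) _ ep0.
  have [||ze ze0 hze] := @cvg_turn R P n (fun t => 1 - t) s _ _ (nz s) eta eta0.
  + by apply: cvgD; apply: cvgM => //; try exact: cvg_cst; apply: cvgB => //; exact: cvg_cst.
  + by apply: cvgB => //; exact: cvg_cst.
  by exists ze => // q _ /hze; apply: heta.
- by rewrite hn // r0 hu.
- by rewrite subrr turn0 // /n subrr mulr0 add0r mulr1 -sqrf_eq0 e2 oner_eq0.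
- by move=> s s01; rewrite hn; [exact: hP|lra].
- move=> s1 s2 h1 h2 h3; rewrite !hn; try lra.
  rewrite hu; apply: mono; last exact: r_mono.
  by rewrite -r0; apply: r_mono => //; lra.
left=> s s01; rewrite hn; last by lra.
pose t := (b - a) * e.
have -> : f Q' = h (a + e * t).
  by rewrite /t /h -eQ'; congr (f (turn P _ 1)); rewrite mulrC -mulrA -expr2 e2; ring.
rewrite hu; apply: mono => //.
by rewrite -r0; apply: r_mono => //; lra.
Qed.

End CircleRays.

Theorem theorem1p4 (R : realType) (X : Type) (d : X -> X -> \bar R) (Om : set X) :
  ext_metric d Om -> ecompact d Om -> ptolemy d Om ->
  (exists x y z : X, x <> y /\ y <> z /\ x <> z) ->
  (forall x y z : X, x <> y -> y <> z -> x <> z ->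
     exists C : set X, (is_circle d Om C \/ is_ptolemy_segment d Om C) /\ C x /\ C y /\ C z) ->
  exists n : nat,
    mobius_equiv d Om (@d0 R n.+1) set0 (@sphere R n) \/
    mobius_equiv d Om (@d0 R n.+1) set0 (@hemisphere R n).
Proof.
move=> em cpt pt three lines.
have [o no] : exists o, ~ Om o.
  have [x [y [_ [xy _]]]] := three.
  have [ox|] := pselect (Om x); last by exists x.
  by exists y => oy; apply: xy; exact: (Om_unique em ox oy).
have [U [UU Uoo]] := @ultraFilterLemma nat \oo _.
have pc := bdist_ptolemy_compact em no pt cpt UU Uoo three.
have rays : has_rays (bdist d Om o).
  move=> w u v uw vw uv; have [||C [CC [Cw [Cu Cv]]]] := lines w u v _ uv; try exact: nesym.
  case: CC => CC; first exact: (circle_ray em pt no pc CC).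
  exact: (segment_ray em pt no pc CC).
have [n [f [mu [finj [mu0 [fE fim]]]]]] := sphere_or_hemisphere pc rays.
have [k [k0 fdd]] : exists k : X -> R, (forall x, k x != 0) /\
    forall x y, dd (@d0 R n.+1) set0 (f x) (f y) = k x * k y * dd d Om x y.
  exists (fun x => mu x * weight d Om o x); split=> [x|x y].
    by rewrite gt_eqF // mulr_gt0 ?mu0 // weight_gt0.
  have -> : dd (@d0 R n.+1) set0 (f x) (f y) = eucl (f x) (f y) by rewrite /dd !memNset.
  by rewrite fE /bdist; ring.
have H A : f @` setT = A -> mobius_equiv d Om (@d0 R n.+1) set0 A.
  move=> fA; exists f; split=> //; split=> // x y z w _.
  (* Every point occurs once in each of the three products, so all of them acquire the same
     factor. *)
  exists (k x * k y * k z * k w)^-1; rewrite !fdd invr_eq0 !mulf_neq0 //; split=> //.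
  by split; last split; field; rewrite !k0.
by exists n; case: fim => /H; [left|right].
Qed.
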